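(* Let $k$ be a field and let $A$ be a pseudocompact $k$-algebra. The following conditions are equivalent: (1) $A$ is (left) topologically semisimple; (2) $J(A)=0$; (3) the free left $A$-module $A$ is isomorphic to a product of simple pseudocompact $A$-modules; (4) every left pseudocompact $A$-module is projective; (5) every left pseudocompact $A$-module is injective; (6) $A$ is an inverse limit of finite dimensional semisimple $k$-algebras; (7) $A$ is isomorphic to a product of full matrix algebras $M_{n_i}(D_i)$, where the $n_i$ are positive integers and the $D_i$ are finite dimensional $k$-division algebras. This product is unique up to permutation of the terms and isomorphism of the division algebras $D_i$.
   Context: $k$ is a field with the discrete topology. A pseudocompact $k$-algebra is a topological (associative, unital) $k$-algebra that is an inverse limit of an inverse system (over a directed poset) of discrete finite dimensional $k$-algebras and algebra homomorphisms; equivalently, it has a basis of neighbourhoods of $0$ consisting of ideals of finite codimension whose intersection is $0$, and it is complete. A discrete $A$-module is an $A$-module $U$ with the discrete topology such that the multiplication $A\times U\to U$ is continuous. A pseudocompact $A$-module is an inverse limit of discrete finite dimensional $A$-modules. Pseudocompact left $A$-modules with continuous module homomorphisms form an abelian category, and ''projective'' and ''injective'' refer to this category. A simple pseudocompact $A$-module is a non-zero pseudocompact $A$-module whose only closed submodules are $0$ and itself. Products carry the product topology, with coordinatewise operations; isomorphisms are isomorphisms of topological modules, respectively topological algebras. $A$ is (left) topologically semisimple if for any closed left ideal $I$ of $A$ there is a closed left ideal $L$ of $A$ with $I\oplus L=A$. $J(A)$ denotes the (topological) Jacobson radical, the intersection of the maximal closed left ideals of $A$ (closed left ideals maximal among proper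 closed left ideals). *)

(* Defs.v *)
From HB Require Import structures.
From mathcomp Require Import all_boot all_order all_algebra all_field.
From mathcomp Require Import all_classical topology function_spaces.

Set Implicit Arguments.
Unset Strict Implicit.
Unset Printing Implicit Defensive.

Import Order.TTheory GRing.Theory.

Local Open Scope classical_set_scope.
Local Open Scope ring_scope.

(* MathComp-Analysis' [TopologicalZmodule] lives in a file whose topological
   modules are all over a [numDomainType]; HB rejects [TopMod] below when that
   file is loaded. *)
HB.mixin Record isTopAddGroup V of Topological V & GRing.Zmodule V := {
  top_add_continuous : continuous (fun z : V * V => z.1 + z.2);
  top_opp_continuous : continuous (-%R : V -> V)
}.

#[short(type="topAddGroupType")]
HB.structure Definition TopAddGroup :=
  {V of Topological V & GRing.Zmodule V & isTopAddGroup V}.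

(* A k-algebra is given by a ring A and its structure map, a unital ring
   morphism [kmap] from k to the centre of A; the scaling is c, a |-> kmap c * a
   and, k being discrete, its continuity follows from that of the product.
   MathComp's [algType] cannot be used, as it excludes the zero algebra, which
   is pseudocompact and is a possible term of an inverse system. *)
HB.mixin Record isTopAlg (k : fieldType) A
    of TopAddGroup A & GRing.PzRing A := {
  kmap : k -> A;
  kmapD : {morph kmap : c d / c + d};
  kmapM : {morph kmap : c d / c * d};
  kmap1 : kmap 1 = 1;
  kmap_central : forall c x, kmap c * x = x * kmap c;
  topalg_mul_continuous : continuous (fun z : A * A => z.1 * z.2)
}.

#[short(type="topAlgType")]
HB.structure Definition TopAlg (k : fieldType) :=
  {A of TopAddGroup A & GRing.PzRing A & isTopAlg k A}.

HB.mixin Record isTopMod (k : fieldType) (A : topAlgType k) M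
    of TopAddGroup M & GRing.Lmodule A M := {
  topmod_scale_continuous : continuous (fun z : A * M => z.1 *: z.2)
}.

HB.structure Definition TopMod (k : fieldType) (A : topAlgType k) :=
  {M of TopAddGroup M & GRing.Lmodule A M & isTopMod k A M}.

Notation topModType A := (@TopMod.type _ A).

(* The free left A-module A (not [A^o], on which MathComp-Analysis already
   declares the topology of a normed field). *)
Definition regmod (k : fieldType) (A : topAlgType k) : Type := A.

HB.instance Definition _ (k : fieldType) (A : topAlgType k) :=
  TopAddGroup.copy (regmod A) A.
HB.instance Definition _ (k : fieldType) (A : topAlgType k) :=
  GRing.Lmodule.copy (regmod A) (A^o).
HB.instance Definition _ (k : fieldType) (A : topAlgType k) :=
  isTopMod.Build k A (regmod A) (@topalg_mul_continuous k A).

Section ProductTopology.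
Variables (I : Type) (K : I -> topologicalType).

Lemma prod_topology_proj_continuous (i : I) :
  continuous (fun x : prod_topology K => x i).
Proof.
move=> x U; rewrite /= nbhsE => -[V [oV Vx] VU].
pose T := initial_topology (fun f : (forall j, K j) => f i).
have /cvg_sup/(_ i) /(_ ((fun y : prod_topology K => y i) @^-1` U)) :
  nbhs x --> x by exact: cvg_id.
apply; rewrite (@nbhsE T).
by exists ((fun y : T => y i) @^-1` V); [split => //; exists V | move=> y /VU].
Qed.

Lemma prod_topology_continuous (T : topologicalType)
    (f : T -> prod_topology K) :
  (forall i, continuous (fun t => f t i)) -> continuous f.
Proof.
move=> fc t; apply/cvg_sup => i U; rewrite (@nbhsE (initial_topology _)).
move=> [_ [[V oV <-] Vt] VU]; apply: filterS; first exact: VU.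
by apply: fc; rewrite nbhsE; exists V.
Qed.

End ProductTopology.

Lemma continuous_pair_comp (X Y Z T : topologicalType) (h : Y * Z -> T)
    (f : X -> Y) (g : X -> Z) :
  continuous h -> continuous f -> continuous g ->
  continuous (fun x => h (f x, g x)).
Proof.
move=> hc fc gc x; apply: (@cvg_comp _ _ _ (fun x => (f x, g x)) h).
  exact: cvg_pair (fc x) (gc x).
exact: hc.
Qed.

Section ProductAddGroup.
Variables (I : Type) (V : I -> topAddGroupType).
Implicit Types x y z : prod_topology V.

Let add x y : prod_topology V := fun i => x i + y i.
Let opp x : prod_topology V := fun i => - x i.
Let zero : prod_topology V := fun=> 0.

Let addA : associative add.
Proof. by move=> x y z; apply/functional_extensionality_dep => i;
  exact: addrA. Qed.
Let addC : commutative add.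
Proof. by move=> x y; apply/functional_extensionality_dep => i;
  exact: addrC. Qed.
Let add0 : left_id zero add.
Proof. by move=> x; apply/functional_extensionality_dep => i;
  exact: add0r. Qed.
Let addN : left_inverse zero opp add.
Proof. by move=> x; apply/functional_extensionality_dep => i;
  exact: addNr. Qed.

HB.instance Definition _ :=
  GRing.isZmodule.Build (prod_topology V) addA addC add0 addN.

Let add_cont :
  continuous (fun z : prod_topology V * prod_topology V => z.1 + z.2).
Proof.
apply: prod_topology_continuous => i.
refine (@continuous_pair_comp (prod_topology V * prod_topology V)%type _ _ _ _
  (fun z : prod_topology V * prod_topology V => z.1 i)
  (fun z : prod_topology V * prod_topology V => z.2 i)
  (@top_add_continuous (V i)) _ _) => z.
- apply: (@cvg_comp _ _ _ fst (fun x : prod_topology V => x i)).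
    exact: cvg_fst.
  exact: prod_topology_proj_continuous.
- apply: (@cvg_comp _ _ _ snd (fun x : prod_topology V => x i)).
    exact: cvg_snd.
  exact: prod_topology_proj_continuous.
Qed.

Let opp_cont : continuous (-%R : prod_topology V -> prod_topology V).
Proof.
apply: prod_topology_continuous => i z.
apply: (@cvg_comp _ _ _ (fun x : prod_topology V => x i) -%R).
  exact: prod_topology_proj_continuous.
exact: top_opp_continuous.
Qed.

HB.instance Definition _ :=
  isTopAddGroup.Build (prod_topology V) add_cont opp_cont.

End ProductAddGroup.

Section ProductAlg.
Variables (k : fieldType) (I : Type) (B : I -> topAlgType k).
Implicit Types x y z : prod_topology B.

Let mul x y : prod_topology B := fun i => x i * y i.
Let one : prod_topology B := fun=> 1.

Let mulA : associative mul.
Proof. by move=> x y z; apply/functional_extensionality_dep => i;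
  exact: mulrA. Qed.
Let mul1 : left_id one mul.
Proof. by move=> x; apply/functional_extensionality_dep => i;
  exact: mul1r. Qed.
Let mulx1 : right_id one mul.
Proof. by move=> x; apply/functional_extensionality_dep => i;
  exact: mulr1. Qed.
Let mulDl : left_distributive mul +%R.
Proof. by move=> x y z; apply/functional_extensionality_dep => i;
  exact: mulrDl. Qed.
Let mulDr : right_distributive mul +%R.
Proof. by move=> x y z; apply/functional_extensionality_dep => i;
  exact: mulrDr. Qed.

HB.instance Definition _ :=
  GRing.Zmodule_isPzRing.Build (prod_topology B) mulA mul1 mulx1 mulDl mulDr.

Let inj (c : k) : prod_topology B := fun=> kmap c.

Let injD : {morph inj : c d / c + d}.
Proof. by move=> c d; apply/functional_extensionality_dep => i;
  exact: kmapD. Qed.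
Let injM : {morph inj : c d / c * d}.
Proof. by move=> c d; apply/functional_extensionality_dep => i;
  exact: kmapM. Qed.
Let inj1 : inj 1 = 1.
Proof. by apply/functional_extensionality_dep => i;
  exact: kmap1. Qed.
Let injC c x : inj c * x = x * inj c.
Proof. by apply/functional_extensionality_dep => i;
  exact: kmap_central. Qed.

Let mul_cont :
  continuous (fun z : prod_topology B * prod_topology B => z.1 * z.2).
Proof.
apply: prod_topology_continuous => i.
refine (@continuous_pair_comp (prod_topology B * prod_topology B)%type _ _ _ _
  (fun z : prod_topology B * prod_topology B => z.1 i)
  (fun z : prod_topology B * prod_topology B => z.2 i)
  (@topalg_mul_continuous k (B i)) _ _) => z.
- apply: (@cvg_comp _ _ _ fst (fun x : prod_topology B => x i)).
    exact: cvg_fst.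
  exact: prod_topology_proj_continuous.
- apply: (@cvg_comp _ _ _ snd (fun x : prod_topology B => x i)).
    exact: cvg_snd.
  exact: prod_topology_proj_continuous.
Qed.

HB.instance Definition _ :=
  isTopAlg.Build k (prod_topology B) injD injM inj1 injC mul_cont.

End ProductAlg.

Section ProductMod.
Variables (k : fieldType) (A : topAlgType k) (I : Type) (M : I -> topModType A).
Implicit Types x y z : prod_topology M.

Let scale (a : A) x : prod_topology M := fun i => a *: x i.

Let scaleA a b x : scale a (scale b x) = scale (a * b) x.
Proof. by apply/functional_extensionality_dep => i;
  exact: scalerA. Qed.
Let scale1 : left_id 1 scale.
Proof. by move=> x; apply/functional_extensionality_dep => i;
  exact: scale1r. Qed.
Let scaleDr : right_distributive scale +%R.
Proof. by move=> a x y; apply/functional_extensionality_dep => i;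
  exact: scalerDr. Qed.
Let scaleDl x : {morph scale^~ x : a b / a + b}.
Proof. by move=> a b; apply/functional_extensionality_dep => i;
  exact: scalerDl. Qed.

HB.instance Definition _ := GRing.Zmodule_isLmodule.Build A (prod_topology M)
  scaleA scale1 scaleDr scaleDl.

Let scale_cont : continuous (fun z : A * prod_topology M => z.1 *: z.2).
Proof.
apply: prod_topology_continuous => i.
refine (@continuous_pair_comp (A * prod_topology M)%type _ _ _ _
  fst (fun z : A * prod_topology M => z.2 i)
  (@topmod_scale_continuous k A (M i)) _ _) => z.
- exact: cvg_fst.
- apply: (@cvg_comp _ _ _ snd (fun x : prod_topology M => x i)).
    exact: cvg_snd.
  exact: prod_topology_proj_continuous.
Qed.

HB.instance Definition _ := isTopMod.Build k A (prod_topology M) scale_cont.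

End ProductMod.

(* The algebra M_n(D) over k (the scaling of 'M[D]_n is that by D) with the
   discrete topology. *)
Definition matalg (k : fieldType) (D : falgType k) (n : nat) : Type := 'M[D]_n.

Section MatrixAlgebra.
Variables (k : fieldType) (D : falgType k) (n : nat).
Local Notation M := (matalg D n).

HB.instance Definition _ := GRing.PzRing.copy M 'M[D]_n.
HB.instance Definition _ := hasNbhs.Build M principal_filter.
HB.instance Definition _ := Discrete_ofNbhs.Build M erefl.

Let discrete2 (f : M * M -> M) : continuous f.
Proof.
move=> z U /nbhs_singleton Uz; exists ([set z.1], [set z.2]).
  by split; exact: discrete_set1.
by move=> [a b] [/= -> ->]; case: z Uz.
Qed.

Let discrete1 (f : M -> M) : continuous f.
Proof.
move=> z U /nbhs_singleton Uz.
by apply: (@filterS _ (nbhs z) _ [set z]); [move=> _ -> | exact: discrete_set1].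
Qed.

HB.instance Definition _ := isTopAddGroup.Build M (@discrete2 _) (@discrete1 _).

Let inj (c : k) : M := (c%:A)%:M.

Let injD : {morph inj : c d / c + d}.
Proof. by move=> c d; rewrite /inj scalerDl raddfD. Qed.
Let injM : {morph inj : c d / c * d}.
Proof.
by move=> c d; rewrite /inj -[RHS]scalar_mxM -scalerAl mul1r scalerA.
Qed.
Let inj1 : inj 1 = 1.
Proof. by rewrite /inj scale1r. Qed.
Let injC c x : inj c * x = x * inj c.
Proof.
rewrite /inj -[LHS]/(_ *m _) -[RHS]/(_ *m _) mul_scalar_mx.
apply/matrixP => i j.
rewrite !mxE (bigD1 j) //= big1 ?addr0; last first.
  by move=> l /negPf lj; rewrite !mxE lj mulr0n mulr0.
by rewrite !mxE eqxx mulr1n -scalerAl mul1r -scalerAr mulr1.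
Qed.

HB.instance Definition _ :=
  isTopAlg.Build k M injD injM inj1 injC (@discrete2 _).

End MatrixAlgebra.

Section InverseLimits.
Local Open Scope order_scope.

Definition directed d (I : porderType d) : Prop :=
  inhabited I /\ forall i j : I, exists2 l, i <= l & j <= l.

Definition inverse_system d (I : porderType d) (X : I -> Type)
    (t : forall i j, i <= j -> X j -> X i) : Prop :=
  (forall i (h : i <= i) x, t i i h x = x) /\
  (forall i j l (hij : i <= j) (hjl : j <= l) (hil : i <= l) x,
     t i j hij (t j l hjl x) = t i l hil x).

(* As a type, [invlim t] carries the subspace topology. *)
Definition invlim d (I : porderType d) (X : I -> topologicalType)
    (t : forall i j, i <= j -> X j -> X i) : set (prod_topology X) :=
  [set x | forall i j (h : i <= j), t i j h (x j) = x i].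

End InverseLimits.

Definition discrete (X : topologicalType) : Prop := forall U : set X, open U.

Definition homeomorphism (X Y : topologicalType) (f : X -> Y) : Prop :=
  continuous f /\
  exists g : Y -> X, [/\ cancel f g, cancel g f & continuous g].

Section TopologicalAlgebras.
Variable k : fieldType.

Definition alg_hom (A B : topAlgType k) (f : A -> B) : Prop :=
  [/\ {morph f : x y / x + y}, {morph f : x y / x * y}, f 1 = 1 &
      forall c : k, f (kmap c) = kmap c].

Definition topalg_iso (A B : topAlgType k) : Prop :=
  exists2 f : A -> B, alg_hom f & homeomorphism f.

Definition findim_alg (A : topAlgType k) : Prop :=
  exists (n : nat) (e : 'I_n -> A),
    forall x, exists c : 'I_n -> k, x = \sum_i kmap (c i) * e i.

Definition left_ideal (A : topAlgType k) (L : set A) : Prop :=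
  [/\ L 0, forall x y, L x -> L y -> L (x + y) & forall a x, L x -> L (a * x)].

Definition direct_sum_decomposition (A : topAlgType k) (I L : set A) : Prop :=
  I `&` L = [set 0] /\ [set x + y | x in I & y in L] = setT.

Definition semisimple_alg (A : topAlgType k) : Prop :=
  forall I : set A, left_ideal I ->
    exists2 L : set A, left_ideal L & direct_sum_decomposition I L.

(* A is the inverse limit, over a directed poset, of discrete algebras
   satisfying P; f identifies A with the limit, whose algebra structure is
   coordinatewise. *)
Definition inverse_limit_of_discrete_algs (P : topAlgType k -> Prop)
    (A : topAlgType k) : Prop :=
  exists (d : Order.disp_t) (I : porderType d) (X : I -> topAlgType k)
      (t : forall i j, (i <= j)%O -> X j -> X i) (f : A -> invlim t),
    [/\ directed I, inverse_system t & forall i j h, alg_hom (t i j h)] /\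
    [/\ forall i, discrete (X i) /\ P (X i),
        homeomorphism f
      & forall i, alg_hom (fun a => set_val (f a) i)].

Definition pseudocompact_alg (A : topAlgType k) : Prop :=
  inverse_limit_of_discrete_algs findim_alg A.

Definition top_semisimple (A : topAlgType k) : Prop :=
  forall I : set A, left_ideal I -> closed I ->
    exists L : set A,
      [/\ left_ideal L, closed L & direct_sum_decomposition I L].

Definition maximal_closed_left_ideal (A : topAlgType k) (I : set A) : Prop :=
  [/\ left_ideal I, closed I, I <> setT &
      forall L : set A, left_ideal L -> closed L -> L <> setT ->
        I `<=` L -> L = I].

Definition jacobson_radical (A : topAlgType k) : set A :=
  \bigcap_(I in [set I : set A | maximal_closed_left_ideal I]) I.

End TopologicalAlgebras.

Arguments jacobson_radical {k} A.

Section TopologicalModules.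
Variables (k : fieldType) (A : topAlgType k).

Definition topmod_iso (M N : topModType A) : Prop :=
  exists2 f : M -> N, linear f & homeomorphism f.

Definition findim_mod (M : topModType A) : Prop :=
  exists (n : nat) (e : 'I_n -> M),
    forall x, exists c : 'I_n -> k, x = \sum_i (kmap (c i) : A) *: e i.

Definition pseudocompact_mod (M : topModType A) : Prop :=
  exists (d : Order.disp_t) (I : porderType d) (X : I -> topModType A)
      (t : forall i j, (i <= j)%O -> X j -> X i) (f : M -> invlim t),
    [/\ directed I, inverse_system t & forall i j h, linear (t i j h)] /\
    [/\ forall i, discrete (X i) /\ findim_mod (X i),
        homeomorphism f
      & forall i, linear (fun m => set_val (f m) i)].

Definition submodule (M : topModType A) (N : set M) : Prop :=
  [/\ N 0, forall x y, N x -> N y -> N (x + y) &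
      forall (a : A) x, N x -> N (a *: x)].

Definition simple_mod (M : topModType A) : Prop :=
  [/\ pseudocompact_mod M, exists m : M, m != 0 &
      forall N : set M, submodule N -> closed N -> N = [set 0] \/ N = setT].

Definition cont_hom (M N : topModType A) (f : M -> N) : Prop :=
  linear f /\ continuous f.

(* Epimorphisms, monomorphisms, projectives and injectives of the category of
   pseudocompact left A-modules and continuous homomorphisms. *)
Definition epi (M N : topModType A) (g : M -> N) : Prop :=
  forall (L : topModType A) (u v : N -> L), pseudocompact_mod L ->
    cont_hom u -> cont_hom v -> u \o g = v \o g -> u = v.

Definition mono (M N : topModType A) (g : M -> N) : Prop :=
  forall (L : topModType A) (u v : L -> M), pseudocompact_mod L ->
    cont_hom u -> cont_hom v -> g \o u = g \o v -> u = v.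

Definition projective (P : topModType A) : Prop :=
  forall (M N : topModType A) (g : M -> N) (f : P -> N),
    pseudocompact_mod M -> pseudocompact_mod N ->
    cont_hom g -> epi g -> cont_hom f ->
    exists2 h : P -> M, cont_hom h & g \o h = f.

Definition injective_mod (Q : topModType A) : Prop :=
  forall (M N : topModType A) (g : M -> N) (f : M -> Q),
    pseudocompact_mod M -> pseudocompact_mod N ->
    cont_hom g -> mono g -> cont_hom f ->
    exists2 h : N -> Q, cont_hom h & h \o g = f.

End TopologicalModules.

Definition division_alg (k : fieldType) (D : falgType k) : Prop :=
  forall x : D, x != 0 -> x \is a GRing.unit.

Definition matalg_product (k : fieldType) (I : Type) (n : I -> nat)
    (D : I -> falgType k) : topAlgType k :=
  prod_topology (fun i => matalg (D i) (n i)).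

(* Main.v *)
Require Import Defs.
From Stdlib Require List.
From HB Require Import structures.
From mathcomp Require Import all_boot all_order all_algebra all_field.
From mathcomp Require Import all_classical topology function_spaces.

(** Everything rests on two facts.  The first is linear compactness: in an inverse
    limit of finite dimensional discrete modules, a directed family of cosets of
    submodules has a common adherent point ([prod_linearly_compact],
    [pseudocompact_pc]).  It yields the closedness of images, the closed graph theorem
    [closed_graph_continuous], and Chevalley's theorem [directed_closed_sub_nbhs].  The
    second is that all conditions of the theorem can be compared with one of them,
    which makes sense for modules: a module is residually simple if every nonzero
    element is avoided by a maximal open submodule.  For A itself this says J(A) = 0.

    A closed submodule K of a residually simple pseudocompact module M has a closed
    complement, namely a minimal closed C with K + C = M ([closed_complement]); for
    M = A this is topological semisimplicity.  Conversely, if just the open left ideals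
    of A have complements, then every pseudocompact module is residually simple
    ([complemented_residually_simple]).  So all closed submodules of all pseudocompact
    modules are complemented, and lifts and extensions along epimorphisms and
    monomorphisms exist algebraically; they are continuous by the closed graph theorem.
    In the other direction, projectivity and injectivity are applied to discrete
    quotients of A: if W is maximal among the left ideals avoiding y, then a splitting
    of A / W -> A / (Ay + W), or a retraction of A / W onto (Ay + W) / W, forces
    Ay + W = A, and W is maximal ([residually_simple_of_cyclic]).

    A topologically semisimple A is the limit of its quotients by open two-sided ideals,
    which are semisimple.  In an arbitrary inverse limit of semisimple algebras X_i the
    image of A in X_i is, by a Mittag-Leffler argument, a quotient of some X_j, whence
    maximal open left ideals avoiding a given element
    ([semisimple_limit_residually_simple]).

    If A is residually simple, each simple discrete module gives a surjection of A onto
    some M_n(D), D being the endomorphism algebra ([simple_quotient]); the kernels are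
    pairwise comaximal and intersect in 0, so that A is the product of these matrix
    algebras ([residually_simple_matrices]).  The columns of the factors then exhibit A
    as a product of simple modules, and the kernel of the map onto a column, or of a
    coordinate map to any simple factor, is a maximal open left ideal.

    For uniqueness, the units of the factors are the minimal central idempotents, so an
    isomorphism of products matches the factors.  An isomorphism f from M_n(D) to
    M_m(E) sends a diagonal matrix unit e to an idempotent of rank one, because
    e M_n(D) e is a division ring; writing f(e) = u v with v u = 1 identifies D with E,
    and comparing dimensions over k gives n = m. *)

Set Implicit Arguments.
Unset Strict Implicit.
Unset Printing Implicit Defensive.

Import Order.TTheory GRing.Theory.

Local Open Scope classical_set_scope.
Local Open Scope ring_scope.

(** * Subspaces of finite codimension *)

(** A subspace of maximal dimension among those contained in S is all of S. *)
Lemma vspace_of_pred (k : fieldType) (V : vectType k) (S : V -> Prop) :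
  S 0 -> (forall x y, S x -> S y -> S (x + y)) ->
  (forall c x, S x -> S (c *: x)) ->
  exists U : {vspace V}, forall v, v \in U <-> S v.
Proof.
move=> S0 SD SZ.
pose P n := `[< exists U : {vspace V}, \dim U = n /\ {in U, forall v, S v} >].
have exP : exists n, P n.
  exists 0%N; apply/asboolP; exists 0%VS; split; first by rewrite dimv0.
  by move=> v; rewrite memv0 => /eqP->.
have boundP n : P n -> (n <= \dim {:V})%N.
  by move=> /asboolP [U [<- _]]; apply: dimvS; exact: subvf.
have [n /asboolP [U [dimU US]] maxn] := ex_maxnP exP boundP.
exists U => v; split; first exact: US.
move=> Sv.
have : (\dim (U + <[v]>) <= n)%N.
  apply: maxn; apply/asboolP; exists (U + <[v]>)%VS; split => //.
  move=> _ /memv_addP [u uU [_ /vlineP [c ->] ->]].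
  by apply: SD; [exact: US | exact: SZ].
rewrite -dimU => le_dim.
have /eqP-> : U == (U + <[v]>)%VS by rewrite eqEdim addvSl.
by rewrite memvE addvSr.
Qed.

Section FiniteCodimension.
Variables (k : fieldType) (A : topAlgType k).

Definition klinear (M : topModType A) (V : vectType k) (f : M -> V) : Prop :=
  {morph f : x y / x + y} /\ forall c x, f ((kmap c : A) *: x) = c *: f x.

(** The quotient by U is represented by a k-linear map with kernel U: preimages
    and intersections then require no quotient to be formed. *)
Definition fincodim (M : topModType A) (U : set M) : Prop :=
  exists (V : vectType k) (f : M -> V),
    klinear f /\ forall x, U x <-> f x = 0.

Definition down_directed (T I : Type) (C : I -> set T) : Prop :=
  forall i j, exists l, C l `<=` C i /\ C l `<=` C j.

Section Basics.
Variable M : topModType A.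
Implicit Types (U W N : set M).

Lemma submodN N x : submodule N -> N x -> N (- x).
Proof. by case=> _ _ NZ Nx; rewrite -scaleN1r; apply: NZ. Qed.

Lemma submodB N x y : submodule N -> N x -> N y -> N (x - y).
Proof. by move=> sN Nx Ny; case: (sN) => _ ND _; apply: ND => //; exact: submodN. Qed.

Lemma submodBC N x y : submodule N -> N (x - y) -> N (y - x).
Proof. by move=> sN Nx; rewrite -opprB; exact: submodN. Qed.

Lemma submod_trans N x y z :
  submodule N -> N (x - y) -> N (y - z) -> N (x - z).
Proof.
move=> [_ ND _] Nxy Nyz.
have -> : x - z = (x - y) + (y - z) by rewrite addrA subrK.
exact: ND.
Qed.

Lemma submodI U W : submodule U -> submodule W -> submodule (U `&` W).
Proof.
move=> [U0 UD UZ] [W0 WD WZ]; split => //.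
- by move=> x y [Ux Wx] [Uy Wy]; split; [exact: UD | exact: WD].
- by move=> a x [Ux Wx]; split; [exact: UZ | exact: WZ].
Qed.

Definition sumset U W : set M := [set x | exists u, U u /\ W (x - u)].

Lemma submod_sum U W : submodule U -> submodule W -> submodule (sumset U W).
Proof.
move=> [U0 UD UZ] [W0 WD WZ]; split.
- by exists 0; rewrite subrr.
- move=> x y [u [Uu Wu]] [v [Uv Wv]]; exists (u + v); split; first exact: UD.
  by rewrite opprD addrACA; exact: WD.
- move=> a x [u [Uu Wu]]; exists (a *: u); split; first exact: UZ.
  by rewrite -scalerBr; exact: WZ.
Qed.

Lemma sub_suml U W : W 0 -> U `<=` sumset U W.
Proof. by move=> W0 x Ux; exists x; rewrite subrr. Qed.

Lemma sub_sumr U W : U 0 -> W `<=` sumset U W.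
Proof. by move=> U0 x Wx; exists 0; rewrite subr0. Qed.

Lemma submod_set1 : submodule [set (0 : M)].
Proof.
split => //= [x y -> ->|a x ->]; first by rewrite addr0.
by rewrite scaler0.
Qed.

Lemma submodT : submodule (@setT M).
Proof. by []. Qed.

Lemma klinear0 (V : vectType k) (f : M -> V) : klinear f -> f 0 = 0.
Proof. by move=> [fD _]; apply: (addrI (f 0)); rewrite -fD !addr0. Qed.

Lemma klinearN (V : vectType k) (f : M -> V) x : klinear f -> f (- x) = - f x.
Proof.
move=> fl; apply/eqP; rewrite -subr_eq0 opprK; case: (fl) => fD _.
by rewrite -fD addNr klinear0.
Qed.

Lemma klinearB (V : vectType k) (f : M -> V) x y :
  klinear f -> f (x - y) = f x - f y.
Proof. by move=> fl; case: (fl) => -> _; rewrite klinearN. Qed.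

Lemma klinear_sum (V : vectType k) (f : M -> V) n (c : 'I_n -> k) (e : 'I_n -> M) :
  klinear f ->
  f (\sum_i (kmap (c i) : A) *: e i) = \sum_i c i *: f (e i).
Proof.
move=> fl; case: (fl) => fD fZ.
rewrite (big_morph f fD (klinear0 fl)).
by apply: eq_bigr => i _; rewrite fZ.
Qed.

(** This turns a family of submodules above U into a family of subspaces of a
    finite dimensional space, which can be compared by dimension. *)
Lemma klinear_image (V : vectType k) (f : M -> V) U W :
  klinear f -> (forall x, U x <-> f x = 0) -> submodule W -> U `<=` W ->
  exists2 X : {vspace V}, forall x, W x <-> f x \in X &
    forall v, v \in X -> exists x, f x = v.
Proof.
move=> fl fU sW UW; case: (fl) => fD fZ; case: (sW) => W0 WD WZ.
have [|||X XP] :=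
    @vspace_of_pred k V (fun v => exists x, W x /\ f x = v).
- by exists 0; rewrite klinear0.
- by move=> _ _ [x [Wx <-]] [y [Wy <-]]; exists (x + y); split => //; exact: WD.
- by move=> c _ [x [Wx <-]]; exists ((kmap c : A) *: x); split; [exact: WZ | rewrite fZ].
exists X => [x|_ /XP [y [_ <-]]]; last by exists y.
split=> [Wx|/XP [y [Wy fyx]]]; first by apply/XP; exists x.
rewrite -(subrK y x); apply: WD => //; apply: UW; apply/fU.
by rewrite klinearB // fyx subrr.
Qed.

Lemma fincodimS U W : fincodim U -> submodule W -> U `<=` W -> fincodim W.
Proof.
move=> [V [f [fl fU]]] sW UW.
have [X XP _] := klinear_image fl fU sW UW; case: (fl) => fD fZ.
exists V, (fun x => f x - projv X (f x)); split; first split.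
- by move=> x y; rewrite fD linearD opprD addrACA.
- by move=> c x; rewrite fZ linearZ scalerBr.
move=> x; split=> [/XP fxX|/eqP]; first by rewrite projv_id // subrr.
by rewrite subr_eq0 => /eqP fxE; apply/XP; rewrite fxE memv_proj.
Qed.

Lemma fincodimI U W : fincodim U -> fincodim W -> fincodim (U `&` W).
Proof.
move=> [V [f [[fD fZ] fU]]] [V' [g [[gD gZ] gW]]].
exists (V * V')%type, (fun x => (f x, g x)); split; first split.
- by move=> x y; rewrite fD gD.
- by move=> c x; rewrite fZ gZ.
by move=> x; split=> [[/fU-> /gW->]|[/fU Ux /gW Wx]].
Qed.

(** A member whose image in the finite dimensional quotient by U has the least
    dimension lies in all others, since the family is directed. *)
Lemma fincodim_dcc U (I : Type) (W : I -> set M) :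
  fincodim U -> inhabited I -> (forall i, submodule (W i)) ->
  (forall i, U `<=` W i) -> down_directed W ->
  exists i, forall j, W i `<=` W j.
Proof.
move=> [V [f [fl fU]]] [i0] sW UW dW.
have /choice [X XP] : forall i, exists X : {vspace V},
    (forall x, W i x <-> f x \in X) /\ forall v, v \in X -> exists x, f x = v.
  by move=> i; have [X] := klinear_image fl fU (sW i) (@UW i); exists X.
have subX i j : W i `<=` W j -> (X i <= X j)%VS.
  move=> Wij; apply/subvP => v vX; have [x fx] := (XP i).2 v vX.
  by move: vX; rewrite -fx => /(XP i).1/Wij/(XP j).1.
pose P n := `[< exists i, \dim (X i) = n >].
have exP : exists n, P n by exists (\dim (X i0)); apply/asboolP; exists i0.
have [n /asboolP [i dimi] minn] := ex_minnP exP.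
exists i => j x Wx; have [l [li lj]] := dW i j; apply: lj; apply/(XP l).1.
suff -> : X l = X i by apply/(XP i).1.
apply/eqP; rewrite eqEdim subX //= dimi.
by apply: minn; apply/asboolP; exists l.
Qed.

End Basics.
End FiniteCodimension.

(** * Linear compactness of pseudocompact modules *)

Section LinearTopology.
Variables (k : fieldType) (A : topAlgType k).

Definition linear_base (M : topModType A) : Prop :=
  forall N : set M, nbhs 0 N ->
    exists U : set M, [/\ submodule U, open U, fincodim U & U `<=` N].

Definition is_coset (M : topModType A) (C : set M) : Prop :=
  exists (x : M) (N : set M), submodule N /\ forall y, C y <-> N (y - x).

(** The cosets are not assumed to be closed, so that the definition can be applied
    to images of cosets; the price is that the common point is only adherent. *)
Definition linearly_compact (M : topModType A) : Prop :=
  forall (I : Type) (C : I -> set M), (forall i, is_coset (C i)) ->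
    down_directed C -> exists x, forall i, closure (C i) x.

Section Translations.
Variable M : topModType A.
Implicit Types (x y : M) (U W N C : set M).

Lemma addl_continuous x : continuous (fun y : M => x + y).
Proof.
apply: (@continuous_pair_comp M M M M (fun z => z.1 + z.2) (fun=> x) id).
- exact: top_add_continuous.
- exact: cst_continuous.
- by move=> y; exact: cvg_id.
Qed.

Lemma scalel_continuous x : continuous (fun a : A => a *: x).
Proof.
apply: (@continuous_pair_comp A A M M (fun z => z.1 *: z.2) id (fun=> x)).
- exact: topmod_scale_continuous.
- by move=> a; exact: cvg_id.
- exact: cst_continuous.
Qed.

Lemma nbhs_shift x N : nbhs x N <-> nbhs 0 [set y | N (x + y)].
Proof.
split=> Nx.
  by have := @addl_continuous x 0 N; rewrite /= addr0 => /(_ Nx).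
have := @addl_continuous (- x) x [set y | N (x + y)]; rewrite addNr => /(_ Nx).
by move=> H; apply: (@filterS _ (nbhs x) _ _ _ _ H) => y /=; rewrite addNKr.
Qed.

Lemma nbhs_submod x U : submodule U -> open U -> nbhs x [set y | U (y - x)].
Proof.
move=> sU oU; apply/nbhs_shift; case: (sU) => U0 _ _.
have : nbhs 0 U by apply: open_nbhs_nbhs.
by apply: filterS => y Uy /=; rewrite addrC addKr.
Qed.

Lemma submod_open U W : submodule U -> submodule W -> open U -> U `<=` W -> open W.
Proof.
move=> sU [W0 WD WZ] oU UW; rewrite openE => x Wx.
apply: filterS (nbhs_submod x sU oU) => y /UW Wyx.
by rewrite -(subrK x y); exact: WD.
Qed.

Lemma open_submod_closed U : submodule U -> open U -> closed U.
Proof.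
move=> sU oU x /(_ _ (nbhs_submod x sU oU)) [y [Uy Uyx]].
by rewrite -(subKr y x); exact: submodB.
Qed.

Lemma closureP C x : linear_base M ->
  closure C x <-> forall U, submodule U -> open U -> exists y, C y /\ U (y - x).
Proof.
move=> base; split=> [clx U sU oU|clx N /nbhs_shift/base [U [sU oU _ UN]]].
  by have [y [Cy Uy]] := clx _ (nbhs_submod x sU oU); exists y.
have [y [Cy Uyx]] := clx U sU oU; exists y; split => //.
by have := UN _ Uyx; rewrite /= addrC subrK.
Qed.

(** For a coset x + N this is N. *)
Definition dirset C : set M := [set z | exists x y, [/\ C x, C y & z = x - y]].

Lemma is_coset_nonempty C : is_coset C -> exists x, C x.
Proof. by move=> [x [N [[N0 _ _] CP]]]; exists x; apply/CP; rewrite subrr. Qed.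

Lemma dirset_coset C : is_coset C ->
  submodule (dirset C) /\ forall x, C x -> forall y, C y <-> dirset C (y - x).
Proof.
move=> [x [N [sN CP]]]; case: (sN) => N0 ND NZ.
have dE : dirset C = N.
  apply/seteqP; split=> [z [a [b [/CP Na /CP Nb ->]]]|z Nz].
    have -> : a - b = (a - x) - (b - x) by rewrite opprB addrA subrK.
    exact: submodB.
  by exists (z + x), x; rewrite addrK; split=> //; apply/CP; rewrite ?addrK ?subrr.
rewrite dE; split=> // a /CP Na b; rewrite CP; split=> Nb.
  have -> : b - a = (b - x) - (a - x) by rewrite opprB addrA subrK.
  exact: submodB.
have -> : b - x = (b - a) + (a - x) by rewrite addrA subrK.
exact: ND.
Qed.

Lemma is_cosetI C D : is_coset C -> is_coset D ->
  (exists x, C x /\ D x) -> is_coset (C `&` D).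
Proof.
move=> /dirset_coset [sC CP] /dirset_coset [sD DP] [x [Cx Dx]].
exists x, (dirset C `&` dirset D); split; first exact: submodI.
by move=> y; split=> [[/(CP _ Cx) ? /(DP _ Dx) ?]|[/(CP _ Cx) ? /(DP _ Dx) ?]].
Qed.

(** The images of the members of H in the finite dimensional quotient by U have a
    least one; a point x of a member with that image has x + U meeting them all. *)
Lemma coset_meeting_all (H : set (set M)) U :
  (exists C, H C) -> (forall C, H C -> is_coset C) ->
  (forall C D, H C -> H D -> exists2 E, H E & E `<=` C `&` D) ->
  submodule U -> fincodim U ->
  exists x, forall C, H C -> exists y, C y /\ U (y - x).
Proof.
move=> [C1 HC1] coH dirH sU fU; case: (sU) => U0 UD UZ.
pose W (C : {C | H C}) := sumset U (dirset (sval C)).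
have sdir (C : {C | H C}) : submodule (dirset (sval C)).
  by case: C => C HC /=; have [] := dirset_coset (coH C HC).
have dir0 (C : {C | H C}) : dirset (sval C) 0 by case: (sdir C).
have [||||[C0 HC0] minC0] := @fincodim_dcc _ _ M U _ W fU.
- by constructor; exists C1.
- by move=> C; exact: submod_sum.
- by move=> C; apply: sub_suml.
- move=> [C HC] [D HD]; have [E HE EI] := dirH _ _ HC HD.
  exists (exist _ E HE); split=> x [u [Uu [a [b [Ea Eb ab]]]]];
    exists u; split => //; exists a, b; split=> //.
  + by case: (EI _ Ea).
  + by case: (EI _ Eb).
  + by case: (EI _ Ea).
  + by case: (EI _ Eb).
have [x C0x] := is_coset_nonempty (coH _ HC0); exists x => C HC.
have [E HE EI] := dirH _ _ HC0 HC.
have [y Ey] := is_coset_nonempty (coH _ HE); have [C0y Cy] := EI _ Ey.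
have : sumset U (dirset C0) (x - y).
  by apply: sub_sumr => //; exists x, y.
move=> /(minC0 (exist _ E HE)) [u [Uu /= dE]].
exists (x - u); split; last by rewrite addrAC subrr add0r; exact: submodN.
have [_ EP] := dirset_coset (coH _ HE).
suff : E (x - u) by case/EI.
by apply/(EP y Ey); rewrite addrAC.
Qed.

Definition coset_base (H : set (set M)) : Prop :=
  (forall C, H C -> is_coset C) /\
  (forall C D, H C -> H D -> exists2 E, H E & E `<=` C `&` D).

(** Let H be maximal. If D meets every member of H, then H stays a coset base when
    all intersections C `&` D with C in H are added to it, so these are in H. *)
Lemma maximal_coset_base (F : set (set M)) :
  coset_base F -> (exists C, F C) ->
  exists H : set (set M), [/\ F `<=` H, coset_base H &
    forall D, is_coset D -> (forall C, H C -> exists x, C x /\ D x) ->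
      exists2 C, H C & C `<=` D].
Proof.
move=> gF [C1 FC1].
pose P (G : set (set M)) := coset_base (F `|` G).
have [|G [[coH dirH] maxG]] := @Zorn_bigcup _ P.
  move=> S SP tS; split=> [C [FC|[G SG GC]]|].
  - by case: gF => co _; exact: co.
  - by have [co _] := SP _ SG; apply: co; right.
  have common C D : (F `|` \bigcup_(X in S) X) C -> (F `|` \bigcup_(X in S) X) D ->
    (F C /\ F D) \/ exists2 G, S G & (F `|` G) C /\ (F `|` G) D.
    move=> [FC|[G SG GC]] [FD|[G' SG' GD]]; first by left.
    - by right; exists G' => //; split; [left|right].
    - by right; exists G => //; split; [right|left].
    - right; have [GG'|G'G] := tS _ _ SG SG'.
        by exists G' => //; split; right => //; exact: GG'.
      by exists G => //; split; right => //; exact: G'G.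
  move=> C D HC HD; have [[FC FD]|[G SG [GC GD]]] := common _ _ HC HD.
    have [_ /(_ _ _ FC FD) [E FE EI]] := gF.
    by exists E => //; left.
  have [_ /(_ _ _ GC GD) [E [FE|GE] EI]] := SP _ SG.
    by exists E => //; left.
  by exists E => //; right; exists G.
exists (F `|` G); split=> [C FC||D coD meetD] /=; [by left|by split|].
pose H := F `|` G; pose K := H `|` [set C `&` D | C in H].
have KD C : K C -> exists2 C', H C' & C' `&` D `<=` C.
  by move=> [HC|[C' HC' <-]]; [exists C => // x []|exists C'].
have PK : P K.
  have FK : F `|` K = K.
    by apply/setUidPr => C FC; left; left.
  rewrite /P FK; split=> [C [HC|[C' HC' <-]]|C C'].
  - exact: coH.
  - by apply: is_cosetI; [exact: coH| |exact: meetD].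
  move=> /KD [B HB BC] /KD [B' HB' BC'].
  have [E HE EI] := dirH _ _ HB HB'.
  exists (E `&` D); first by right; exists E.
  by move=> x [/EI [Bx B'x] Dx]; split; [apply: BC|apply: BC'].
have /contrapT KG : ~ ~ K `<=` G.
  move=> nKG; apply: (maxG K) => //; split => // C GC.
  by left; right.
exists (C1 `&` D); last by move=> x [].
by right; apply: KG; right; exists C1 => //; left.
Qed.

End Translations.
End LinearTopology.

Definition to_set_type (X : Type) (S : set X) (x : X) (Sx : S x) : S :=
  exist (fun x => x \in S) x (mem_set Sx).

Lemma set_type_continuous (T X : topologicalType) (S : set X) (g : T -> S) :
  continuous (fun x => set_val (g x)) -> continuous g.
Proof.
move=> gc x N [/= V [[W oW WV] Vx] VN].
have Wx : nbhs (set_val (g x)) W.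
  by apply: open_nbhs_nbhs; split=> //; move: Vx; rewrite -WV.
apply: (@filterS _ (nbhs x) _ _ _ _ (gc x W Wx)) => y Wy.
by apply: VN; rewrite -WV.
Qed.

Section InverseLimitTopology.
Context d (I : porderType d) (X : I -> topologicalType).
Variable t : forall i j, (i <= j)%O -> X j -> X i.

Lemma invlim_proj_continuous i : continuous (fun z : invlim t => set_val z i).
Proof.
move=> z.
apply: (@continuous_comp _ _ _ set_val (fun y : prod_topology X => y i)).
  exact: initial_continuous.
exact: prod_topology_proj_continuous.
Qed.

Lemma invlim_closed : (forall i, discrete (X i)) -> closed (invlim t).
Proof.
move=> dX x clx i j h.
have [|z [zt [zi zj]]] := clx [set z | z i = x i /\ z j = x j].
  apply: filterI.
    have := @prod_topology_proj_continuous I X i x [set x i]; apply.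
    by apply: open_nbhs_nbhs; split=> //; exact: dX.
  have := @prod_topology_proj_continuous I X j x [set x j]; apply.
  by apply: open_nbhs_nbhs; split=> //; exact: dX.
by rewrite -zi -zj; exact: zt.
Qed.

End InverseLimitTopology.

Section Pseudocompact.
Variables (k : fieldType) (A : topAlgType k).

(** The intrinsic properties of inverse limits of finite dimensional discrete
    modules from which everything below is derived. *)
Record pc_mod (M : topModType A) : Prop := PcMod {
  pc_base : linear_base M;
  pc_sep : forall x : M, x != 0 -> exists2 N, nbhs 0 N & ~ N x;
  pc_compact : linearly_compact M }.

(** The relations between finitely many generators form a subspace K of k^n, and
    projecting k^n along K represents the module. *)
Lemma findim_fincodim (M : topModType A) :
  findim_mod M -> fincodim [set (0 : M)].
Proof.
move=> [n [e espan]].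
pose s (v : 'rV[k]_n) : M := \sum_i (kmap (v 0 i) : A) *: e i.
have sD u v : s (u + v) = s u + s v.
  by rewrite /s -big_split; apply: eq_bigr => i _; rewrite mxE kmapD scalerDl.
have sZ c v : s (c *: v) = (kmap c : A) *: s v.
  by rewrite /s scaler_sumr; apply: eq_bigr => i _; rewrite mxE kmapM scalerA.
have s0 : s 0 = 0 by apply: (addrI (s 0)); rewrite -sD !addr0.
have sN v : s (- v) = - s v by apply/esym/addr0_eq; rewrite -sD subrr.
have [|||K KP] := @vspace_of_pred k 'rV[k]_n (fun v => s v = 0); first exact: s0.
- by move=> u v su sv; rewrite sD su sv addr0.
- by move=> c v sv; rewrite sZ sv scaler0.
have /choice [c cP] : forall x : M, exists v, x = s v.
  move=> x; have [c ->] := espan x; exists (\row_i c i).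
  by apply: eq_bigr => i _; rewrite mxE.
pose q v := v - projv K v.
have qD u v : q (u + v) = q u + q v by rewrite /q linearD opprD addrACA.
have qZ a v : q (a *: v) = a *: q v by rewrite /q linearZ scalerBr.
have q0 v : q v = 0 <-> s v = 0.
  split=> [/eqP|/KP vK]; last by rewrite /q projv_id // subrr.
  by rewrite subr_eq0 => /eqP vE; apply/KP; rewrite vE memv_proj.
have qE u v : s u = s v -> q u = q v.
  move=> suv; rewrite -[u](subrK v) qD (q0 _).2 ?add0r //.
  by rewrite sD sN suv subrr.
exists 'rV[k]_n, (fun x => q (c x)); split; first split.
- by move=> x y; rewrite -qD; apply: qE; rewrite sD -!cP.
- by move=> a x; rewrite -qZ; apply: qE; rewrite sZ -!cP.
- by move=> x; rewrite q0 -cP.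
Qed.

Lemma fincodim_span (M : topModType A) (U : set M) : submodule U -> fincodim U ->
  exists (n : nat) (e : 'I_n -> M),
    forall x, exists c : 'I_n -> k, U (x - \sum_i (kmap (c i) : A) *: e i).
Proof.
move=> [U0 _ _] [V [f [fl fU]]].
have [|X XP /(_ _ _) Xsurj] := klinear_image fl fU (@submodT _ _ M).
  by [].
have /choice [e eP] : forall i : 'I_(\dim X), exists x, f x = (vbasis X)`_i.
  by move=> i; apply: Xsurj; apply: vbasis_mem; rewrite mem_nth // size_tuple.
exists (\dim X), e => x; exists (fun i => coord (vbasis X) i (f x)).
apply/fU; rewrite klinearB // klinear_sum //.
rewrite [X in X - _](@coord_vbasis _ _ _ X); last exact/XP.
by apply/eqP; rewrite subr_eq0; apply/eqP/eq_bigr => i _; rewrite eP.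
Qed.

Lemma fincodim_findim (M : topModType A) :
  fincodim [set (0 : M)] -> findim_mod M.
Proof.
move=> /(fincodim_span (@submod_set1 _ _ M)) [n [e eP]]; exists n, e => x.
by have [c /eqP] := eP x; rewrite subr_eq0 => /eqP; exists c.
Qed.

Section LinearMaps.
Variables (M N : topModType A) (f : M -> N).
Hypothesis fl : linear f.

Lemma linD x y : f (x + y) = f x + f y.
Proof. by rewrite -[in LHS](scale1r x) fl scale1r. Qed.

Lemma lin0 : f 0 = 0.
Proof. by apply: (addrI (f 0)); rewrite -linD !addr0. Qed.

Lemma linZ a x : f (a *: x) = a *: f x.
Proof. by rewrite -[in LHS](addr0 (a *: x)) fl lin0 addr0. Qed.

Lemma linN x : f (- x) = - f x.
Proof. by rewrite -scaleN1r linZ scaleN1r. Qed.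

Lemma linB x y : f (x - y) = f x - f y.
Proof. by rewrite linD linN. Qed.

Lemma submod_preimage U : submodule U -> submodule (f @^-1` U).
Proof.
move=> [U0 UD UZ]; rewrite /preimage; split=> /=; first by rewrite lin0.
  by move=> x y Ux Uy; rewrite linD; exact: UD.
by move=> a x Ux; rewrite linZ; exact: UZ.
Qed.

Lemma submod_image U : submodule U -> submodule (f @` U).
Proof.
move=> [U0 UD UZ]; split; first by exists 0; rewrite ?lin0.
  by move=> _ _ [a Na <-] [b Nb <-]; exists (a + b); rewrite ?linD //; exact: UD.
by move=> a _ [b Nb <-]; exists (a *: b); rewrite ?linZ //; exact: UZ.
Qed.

Lemma is_coset_image C : is_coset C -> is_coset (f @` C).
Proof.
move=> [x [U [sU CP]]]; exists (f x), (f @` U); split; first exact: submod_image.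
move=> y; split=> [[z /CP Nz <-]|[z Nz zE]]; first by exists (z - x); rewrite ?linB.
by exists (z + x); [apply/CP; rewrite addrK | rewrite linD zE subrK].
Qed.

Lemma fincodim_preimage U : fincodim U -> fincodim (f @^-1` U).
Proof.
move=> [V [g [[gD gZ] gU]]]; exists V, (g \o f); split; first split.
- by move=> x y; rewrite /= linD gD.
- by move=> c x; rewrite /= linZ gZ.
- by move=> x; exact: gU.
Qed.

End LinearMaps.

Section DiscreteProduct.
Variables (I : Type) (X : I -> topModType A).
Hypothesis X_discrete : forall i, discrete (X i).
Hypothesis X_findim : forall i, findim_mod (X i).
Local Notation P := (prod_topology X).

Definition coord_ker (i : I) : set P := [set y : P | y i = 0].

Lemma coord_ker_submod i : submodule (coord_ker i).
Proof.
split=> // [x y|a x]; rewrite /coord_ker /=.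
  by move=> x0 y0; rewrite -[LHS]/(x i + y i) x0 y0 addr0.
by move=> x0; rewrite -[LHS]/(a *: x i) x0 scaler0.
Qed.

Lemma coord_ker_open i : open (coord_ker i).
Proof.
have /continuousP/(_ [set 0]) := @prod_topology_proj_continuous I X i.
by apply; exact: X_discrete.
Qed.

Lemma coord_ker_fincodim i : fincodim (coord_ker i).
Proof.
have fl : linear (fun y : P => y i : X i) by move=> a x y; exact: erefl.
exact: (fincodim_preimage fl (findim_fincodim (X_findim i))).
Qed.

Lemma cvg_prod_discrete (F : set_system P) (y : P) : Filter F ->
  (forall i, F [set z | z i = y i]) -> F --> y.
Proof.
move=> FF Fy; apply/cvg_sup => i N; rewrite (@nbhsE (initial_topology _)).
move=> [_ [[V oV <-] Vy] VN]; apply: filterS (Fy i) => z zi.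
by apply: VN; rewrite /= zi.
Qed.

(** The neighbourhoods containing an open submodule of finite codimension form a
    filter, which converges to 0 coordinatewise. *)
Lemma prod_linear_base : linear_base P.
Proof.
pose F : set_system P := [set N | exists U : set P,
  [/\ submodule U, open U, fincodim U & U `<=` N]].
have FF : Filter F.
  split.
  - exists setT; split => //; first exact: openT.
    by exists k^o, (fun=> 0); split=> //; split=> // [x y|c x]; rewrite ?addr0 ?scaler0.
  - move=> N N' [U [sU oU fU UN]] [U' [sU' oU' fU' UN']].
    exists (U `&` U'); split; first exact: submodI.
    + exact: openI.
    + exact: fincodimI.
    + by move=> x [/UN ? /UN' ?].
  - by move=> N N' NN' [U [sU oU fU UN]]; exists U; split=> // x /UN/NN'.
apply: (@cvg_prod_discrete F 0) => i; exists (coord_ker i); split=> //.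
- exact: coord_ker_submod.
- exact: coord_ker_open.
- exact: coord_ker_fincodim.
Qed.

(** A maximal coset base is constant on every coordinate, because the coordinates
    are finite dimensional; the filter that it generates therefore converges. *)
Lemma prod_linearly_compact : linearly_compact P.
Proof.
move=> J C coC dirC.
have [[j0 _]|noJ] := pselect (exists j : J, True); last first.
  by exists 0 => j; case: noJ; exists j.
have [||H [CH [coH dirH] maxH]] := @maximal_coset_base _ _ P (range C).
- split=> [_ [j _ <-]|_ _ [i _ <-] [j _ <-]] //.
  by have [l [li lj]] := dirC i j; exists (C l); [exists l|move=> x Clx; split; auto].
- by exists (C j0), j0.
have exH : exists D, H D by exists (C j0); apply: CH; exists j0.
have exv i : exists v : X i, exists2 D, H D & forall z, D z -> z i = v.
  have [x meet] := coset_meeting_all exH coH dirH (coord_ker_submod i)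
    (coord_ker_fincodim i).
  have [||D HD Dx] := maxH [set y | coord_ker i (y - x)].
  - by exists x, (coord_ker i); split; first exact: coord_ker_submod.
  - by move=> D /meet [y [Dy yx]]; exists y.
  by exists (x i), D => // z /Dx/eqP; rewrite subr_eq0 => /eqP.
pose y : P := fun i => projT1 (cid (exv i)).
exists y => j N Ny.
pose F : set_system P := [set N | exists2 D, H D & D `<=` N].
have FF : Filter F.
  split.
  - by have [D HD] := exH; exists D.
  - move=> N1 N2 [D HD DN] [D' HD' DN'].
    have [E HE EI] := dirH _ _ HD HD'.
    by exists E => // x /EI [/DN ? /DN' ?].
  - by move=> N1 N2 NN' [D HD DN]; exists D => // x /DN/NN'.
have [D HD DN] : F N.
  apply: (@cvg_prod_discrete F y) Ny => i.
  by have [D HD DE] := projT2 (cid (exv i)); exists D.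
have [E HE EI] : exists2 E, H E & E `<=` C j `&` D.
  by apply: dirH => //; apply: CH; exists j.
have [z /EI [Cz Dz]] := is_coset_nonempty (coH _ HE).
by exists z; split=> //; exact: DN.
Qed.

Lemma prod_pc : pc_mod P.
Proof.
split.
- exact: prod_linear_base.
- move=> x x0.
  have [i xi] : exists i, x i <> 0.
    apply: contrapT => nx; case/eqP: x0; apply/functional_extensionality_dep => i.
    by apply: contrapT => xi; apply: nx; exists i.
  exists (coord_ker i); last by [].
  by apply: open_nbhs_nbhs; split; [exact: coord_ker_open | ].
- exact: prod_linearly_compact.
Qed.

End DiscreteProduct.

Lemma linear_embedding_pc (M P : topModType A) (f : M -> P) :
  pc_mod P -> linear f -> continuous f -> injective f -> closed (range f) ->
  (forall x N, nbhs x N -> exists2 N', nbhs (f x) N' & f @^-1` N' `<=` N) ->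
  pc_mod M.
Proof.
move=> pcP fl fc fI cf femb.
have f0 := lin0 fl.
split.
- move=> N /femb [N']; rewrite f0 => /(pc_base pcP) [U [sU oU fU UN]] N'N.
  exists (f @^-1` U); split.
  + exact: submod_preimage.
  + by move: fc => /continuousP; apply.
  + exact: fincodim_preimage.
  + by move=> x /UN/N'N.
- move=> x x0; have [|N N0 Nx] := pc_sep pcP (_ : f x != 0).
    by apply: contra_neq x0 => fx0; apply: fI; rewrite fx0 f0.
  exists (f @^-1` N) => //; apply: fc; by rewrite f0.
- move=> J C coC dirC.
  have [||y yC] := @pc_compact _ pcP J (fun j => f @` C j).
  + by move=> j; exact: is_coset_image.
  + move=> i j; have [l [li lj]] := dirC i j; exists l.
    by split; apply: image_subset.
  have [[j0 _]|noJ] := pselect (exists j : J, True); last first.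
    by exists 0 => j; case: noJ; exists j.
  have [x _ xy] : range f y.
    apply: cf => N Ny; have [_ [[z Cz <-] Nz]] := yC j0 N Ny.
    by exists (f z); split => //; exists z.
  exists x => j N /femb [N']; rewrite xy => /(yC j) [_ [[z Cz <-] N'z]] N'N.
  by exists z; split => //; exact: N'N.
Qed.

(** An inverse limit is a closed submodule of the product of its terms. *)
Lemma pseudocompact_pc (M : topModType A) : pseudocompact_mod M -> pc_mod M.
Proof.
move=> [d [I [X [t [f [[dI invt tl] [dX fh fl]]]]]]].
have {}dX1 i : discrete (X i) by case: (dX i).
have {dX}dX2 i : findim_mod (X i) by case: (dX i).
have [fc [g [fK gK gc]]] := fh.
apply: (@linear_embedding_pc M (prod_topology X) (fun m => set_val (f m))).
- exact: prod_pc.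
- move=> a x y; apply/functional_extensionality_dep => i; exact: fl.
- move=> x; apply: (@continuous_comp _ _ _ f set_val); first exact: fc.
  exact: initial_continuous.
- by move=> x y /val_inj /(can_inj fK).
- have -> : range (fun m => set_val (f m)) = invlim t.
    apply/seteqP; split=> [_ [m _ <-]|x xt]; first exact: set_valP.
    by exists (g (exist _ x (mem_set xt))) => //; rewrite gK.
  exact: invlim_closed.
- move=> x N Nx.
  have : nbhs (f x) (g @^-1` N) by apply: gc; rewrite fK.
  rewrite nbhsE /= => -[V [[W oW WV] Vx] VN]; exists W.
    apply: open_nbhs_nbhs; split=> //.
    by move: Vx; rewrite -WV.
  move=> y Wy; rewrite -(fK y); apply: VN.
  by rewrite -WV.
Qed.

End Pseudocompact.

Section Consequences.
Variables (k : fieldType) (A : topAlgType k).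

Section OneModule.
Variable M : topModType A.
Hypothesis pcM : pc_mod M.
Implicit Types (x y : M) (K U W : set M).

(** Take W = K + U, where y + U does not meet K. *)
Lemma open_submod_sep K y : submodule K -> closed K -> ~ K y ->
  exists W, [/\ submodule W, open W, fincodim W, K `<=` W & ~ W y].
Proof.
move=> sK cK Ky.
have [U [sU oU fU Uy]] : exists U, [/\ submodule U, open U, fincodim U &
    forall z, K z -> ~ U (z - y)].
  apply: contrapT => nU; apply: Ky; apply: cK => N /nbhs_shift/(pc_base pcM).
  move=> [U [sU oU fU UN]]; apply: contrapT => nKN; apply: nU.
  exists U; split=> // z Kz /UN /=; rewrite addrC subrK => Nz.
  by apply: nKN; exists z.
case: (sK) => K0 _ _; case: (sU) => U0 _ _.
have sW : submodule (sumset K U) by exact: submod_sum.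
have UW : U `<=` sumset K U by exact: sub_sumr.
exists (sumset K U); split=> //.
- exact: (submod_open sU).
- exact: (fincodimS fU).
- exact: sub_suml.
- by move=> [z [Kz Uz]]; apply: (Uy z Kz); exact: submodBC.
Qed.

Lemma closed_set0 : closed [set (0 : M)].
Proof.
move=> x clx; apply: contrapT => /eqP x0.
have [N /(pc_base pcM) [U [sU oU _ UN]] Nx] := pc_sep pcM x0.
have [z [-> ]] := (closureP _ _ (pc_base pcM)).1 clx U sU oU.
by rewrite sub0r => /(submodN sU); rewrite opprK => /UN.
Qed.

Lemma pc_eq x y :
  (forall U, submodule U -> open U -> U (x - y)) -> x = y.
Proof.
move=> xy; apply/eqP; rewrite -subr_eq0; apply/eqP/closed_set0.
apply/(closureP _ _ (pc_base pcM)) => U sU oU; exists 0; split=> //.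
by rewrite sub0r; apply: submodN => //; exact: xy.
Qed.

(** The closed set is the intersection of the open submodules V + K, and by
    finite codimension one of them is K. *)
Lemma closed_fincodim_open K : submodule K -> closed K -> fincodim K -> open K.
Proof.
move=> sK cK fK; case: (sK) => K0 KD _.
pose J := {V : set M | submodule V /\ open V}.
have [||||[V [sV oV]] /= minV] := @fincodim_dcc _ _ _ K J (fun V => sumset (sval V) K) fK.
- by constructor; exists setT; split=> //; exact: openT.
- by move=> [V [sV oV]]; exact: submod_sum.
- by move=> [V [sV oV]]; apply: sub_sumr; case: sV.
- move=> [V [sV oV]] [W [sW oW]].
  have sVW : submodule (V `&` W) /\ open (V `&` W).
    by split; [exact: submodI | exact: openI].
  by exists (exist _ (V `&` W) sVW); split=> x [v [[Vv Wv] Kv]]; exists v.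
apply: (submod_open sV) => // x Vx; apply: cK.
apply/(closureP _ _ (pc_base pcM)) => U sU oU.
have [u [Uu Kxu]] : sumset U K x.
  by apply: (minV (exist _ U (conj sU oU))); exact: sub_suml.
exists (x - u); split => //.
by rewrite addrAC subrr add0r; exact: submodN.
Qed.

(** Chevalley's theorem. Let U be an open submodule inside N and W_i + U the least of
    the W_j + U. For x in W_i the cosets (x + U) `&` W_j are not empty; a common
    adherent point lies in all the W_j, hence is 0, and so x is in U. *)
Lemma directed_closed_sub_nbhs (I : Type) (W : I -> set M) (N : set M) :
  inhabited I -> (forall i, submodule (W i)) -> (forall i, closed (W i)) ->
  down_directed W -> (forall x, (forall i, W i x) -> x = 0) ->
  nbhs 0 N -> exists i, W i `<=` N.
Proof.
move=> inhI sW cW dW W0 /(pc_base pcM) [U [sU oU fU UN]]; case: (sU) => U0 _ _.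
have [||||i mini] := @fincodim_dcc _ _ _ U I (fun i => sumset U (W i)) fU.
- by [].
- by move=> i; exact: submod_sum.
- by move=> i; apply: sub_suml; case: (sW i).
- move=> i j; have [l [li lj]] := dW i j; exists l.
  by split=> x [u [Uu Wu]]; exists u; split=> //; [exact: li | exact: lj].
exists i => x Wx; apply: UN.
have [||z zP] := @pc_compact _ _ _ pcM I (fun j => [set y | U (y - x) /\ W j y]).
- move=> j.
  have [u [Uu Wj]] : sumset U (W j) x by apply: mini; apply: sub_sumr.
  exists (x - u), (U `&` W j); split; first exact: submodI.
  move=> y; split=> [[Uy Wy]|[Uy Wy]].
    by split; [rewrite opprB addrCA; case: sU => _ UD _; apply: UD | exact: submodB].
  split; first by rewrite -[y](subrK (x - u)) -addrA [X in _ + X]addrAC subrr add0r; exact: submodB.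
  by case: (sW j) => _ WD _; rewrite -(subrK (x - u) y); exact: WD.
- move=> j l; have [m [mj ml]] := dW j l; exists m.
  by split=> y [Uy Wy]; split=> //; [exact: mj | exact: ml].
have z0 : z = 0.
  apply: W0 => j; apply: cW => N' /(zP j) [y [[_ Wy] Ny]].
  by exists y.
have [i0] := inhI.
have [y [[Uy _]]] := (closureP _ _ (pc_base pcM)).1 (zP i0) U sU oU.
rewrite z0 subr0 => Uy'.
by rewrite -(subKr y x); exact: submodB.
Qed.

Lemma maximal_avoiding U y : submodule U -> ~ U y ->
  exists W, [/\ submodule W, U `<=` W, ~ W y &
    forall Z, submodule Z -> W `<=` Z -> ~ Z y -> Z = W].
Proof.
move=> sU Uy.
pose P (X : set M) := submodule (U `|` X) /\ ~ (U `|` X) y.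
have [F FP tF|X [[sX Xy] maxX]] := @Zorn_bigcup _ P.
  have [[X0 FX0]|nF] := pselect (exists X, F X); last first.
    have -> : \bigcup_(X in F) X = set0.
      by apply/seteqP; split=> // x [X FX]; case: nF; exists X.
    by rewrite /P setU0.
  have inX x : (U `|` \bigcup_(X in F) X) x <-> exists2 X, F X & (U `|` X) x.
    split=> [[Ux|[X FX Xx]]|[X FX [Ux|Xx]]].
    - by exists X0 => //; left.
    - by exists X => //; right.
    - by left.
    - by right; exists X.
  split; last by move=> /inX [X /FP [_ nXy] /nXy].
  split.
  - by left; case: sU.
  - move=> x z /inX [X FX Xx] /inX [Z FZ Zz]; apply/inX.
    have [XZ|ZX] := tF _ _ FX FZ.
      have [[_ D _] _] := FP _ FZ; exists Z => //; apply: D => //.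
      by case: Xx => [|/XZ]; [left | right].
    have [[_ D _] _] := FP _ FX; exists X => //; apply: D => //.
    by case: Zz => [|/ZX]; [left | right].
  - move=> a x /inX [X FX Xx]; apply/inX; exists X => //.
    by have [[_ _ Z] _] := FP _ FX; exact: Z.
exists (U `|` X); split=> // Z sZ UXZ Zy.
apply/seteqP; split=> // z Zz; right; apply: contrapT => Xz.
apply: (maxX Z).
  by split=> [x Xx|ZX]; [apply: UXZ; right | exact/Xz/ZX].
by rewrite /P (_ : U `|` Z = Z) //; apply/setUidPr => x Ux; apply: UXZ; left.
Qed.

End OneModule.

(** A linear map with closed graph is continuous: the preimage of an open
    submodule has finite codimension, and linear compactness makes it closed. *)
Lemma closed_graph_continuous (M N : topModType A) (h : M -> N) :
  pc_mod M -> pc_mod N -> linear h ->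
  (forall x y, (forall V W, nbhs x V -> nbhs y W ->
     exists z, V z /\ W (h z)) -> y = h x) ->
  continuous h.
Proof.
move=> pcM pcN hl hcl.
have hopen U : submodule U -> open U -> fincodim U -> open (h @^-1` U).
  move=> sU oU fU; have sH := submod_preimage hl sU.
  apply: closed_fincodim_open => //; last exact: fincodim_preimage.
  move=> x clx.
  pose J := {V : set M | submodule V /\ open V}.
  have [||y yP] := @pc_compact _ _ _ pcN J
    (fun V => h @` ([set z | sval V (z - x)] `&` h @^-1` U)).
  - move=> [V [sV oV]] /=; apply: is_coset_image => //; apply: is_cosetI.
    + by exists x, V.
    + by exists 0, (h @^-1` U); split=> // z; rewrite subr0.
    + by have [z [Uz Vz]] := clx _ (nbhs_submod x sV oV); exists z.
  - move=> [V [sV oV]] [W [sW oW]].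
    have sVW : submodule (V `&` W) /\ open (V `&` W).
      by split; [exact: submodI | exact: openI].
    exists (exist _ (V `&` W) sVW).
    by split=> _ [z [[Vz Wz] Uz] <-]; exists z.
  have yx : y = h x.
    apply: hcl => V W /nbhs_shift/(pc_base pcM) [V' [sV oV _ V'V]] Wy.
    have [_ [[z [/= Vz Uz] <-] Wz]] := yP (exist _ V' (conj sV oV)) _ Wy.
    by exists z; split=> //; have := V'V _ Vz; rewrite /= addrC subrK.
  rewrite /preimage /= -yx; apply: (open_submod_closed sU oU) => V Vy.
  have [_ [[z [_ Uz] <-] Wz]] :=
    yP (exist _ setT (conj (@submodT _ _ M) openT)) _ Vy.
  by exists (h z).
move=> x N' /nbhs_shift/(pc_base pcN) [U [sU oU fU UN]].
have sH := submod_preimage hl sU.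
have := nbhs_submod x sH (hopen U sU oU fU).
apply: filterS => z; rewrite /preimage /= linB // => /UN /=.
by rewrite addrC subrK.
Qed.

(** The preimages of the neighbourhoods y + V of a limit point y are cosets, and a
    common adherent point of these is mapped to y. *)
Lemma range_closed (M N : topModType A) (g : M -> N) :
  pc_mod M -> pc_mod N -> linear g -> continuous g -> closed (range g).
Proof.
move=> pcM pcN gl gc y cly.
pose J := {V : set N | submodule V /\ open V}.
have [||x xP] := @pc_compact _ _ _ pcM J (fun V => [set z | sval V (g z - y)]).
- move=> [V [sV oV]] /=.
  have [_ [[z _ <-] Vz]] := cly _ (nbhs_submod y sV oV).
  exists z, (g @^-1` V); split; first exact: submod_preimage.
  move=> w /=; rewrite /preimage /= linB //; split=> Vw.
    by apply: (submod_trans (y := y)) => //; exact: submodBC.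
  exact: (submod_trans (y := g z)).
- move=> [V [sV oV]] [W [sW oW]].
  have sVW : submodule (V `&` W) /\ open (V `&` W).
    by split; [exact: submodI | exact: openI].
  by exists (exist _ (V `&` W) sVW); split=> z [].
exists x => //; apply: pc_eq => // V sV oV.
have gV : nbhs x [set z | V (g z - g x)] by exact: (gc x _ (nbhs_submod (g x) sV oV)).
have [z [/= Vz Vx]] := xP (exist _ V (conj sV oV)) _ gV.
by apply: (submod_trans (y := g z)) => //; exact: submodBC.
Qed.

(** * Residually simple modules *)

Definition max_open (M : topModType A) (W : set M) : Prop :=
  [/\ submodule W, open W, W <> setT &
      forall Z, submodule Z -> W `<=` Z -> Z = W \/ Z = setT].

(** For a pseudocompact module this is the vanishing of its radical. *)
Definition residually_simple (M : topModType A) : Prop :=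
  forall y : M, y != 0 -> exists2 W, max_open W & ~ W y.

(** The complement is a minimal closed C with K + C = M, which exists by linear
    compactness.  If it met K in some nonzero y, a maximal open submodule
    avoiding y would cut out a smaller such C. *)
Lemma closed_complement (M : topModType A) (K : set M) :
  pc_mod M -> residually_simple M -> submodule K -> closed K ->
  exists C, [/\ submodule C, closed C, K `&` C = [set 0] &
    forall x, sumset K C x].
Proof.
move=> pcM rsM sK cK; case: (sK) => K0 KD _.
pose good C := [/\ submodule C, closed C & forall x, sumset K C x].
have [F FP tF|X [gX maxX]] := @Zorn_bigcup _ (fun X => good (~` X)).
  have [[X0 FX0]|nF] := pselect (exists X, F X); last first.
    have -> : \bigcup_(X in F) X = set0.
      by apply/seteqP; split=> // x [X FX]; case: nF; exists X.
    rewrite setC0; split; [by []|exact: closedT|move=> x].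
    by exists 0; split=> //; exact: K0.
  rewrite setC_bigcup; split.
  - split.
    + by move=> X /FP [[]].
    + by move=> x y Cx Cy X FX; have [[_ D _] _ _] := FP X FX; apply: D; [exact: Cx | exact: Cy].
    + by move=> a x Cx X FX; have [[_ _ Z] _ _] := FP X FX; apply: Z; exact: Cx.
  - by apply: closed_bigI => X /FP [].
  move=> x.
  pose J := {X : set M | F X}.
  have [||z zP] := @pc_compact _ _ _ pcM J (fun X => [set z | K (z - x)] `&` ~` (sval X)).
  - move=> [X FX] /=; have [sX _ KX] := FP _ FX.
    apply: is_cosetI; first by exists x, K.
      by exists 0, (~` X); split=> // y; rewrite subr0.
    have [u [Ku Xu]] := KX x; exists (x - u); split=> //=.
    by rewrite addrAC subrr add0r; exact: submodN.
  - move=> [X FX] [Y FY]; have [XY|YX] := tF _ _ FX FY.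
      by exists (exist _ Y FY); split=> y [Ky Yy]; split=> //= /XY.
    by exists (exist _ X FX); split=> y [Ky Yy]; split=> //= /YX.
  exists (x - z); split.
    apply: submodBC => //.
    have := zP (exist _ X0 FX0).
    move=> clz; apply: cK => N' /nbhs_shift N0.
    have [|y [[/= Ky _] Ny]] := clz [set y | N' (y - x)].
      apply/nbhs_shift; move: N0; apply: filterS => y /=.
      by rewrite addrAC.
    by exists (y - x).
  rewrite opprB addrCA subrr addr0 => X FX.
  have [_ cX _] := FP X FX; apply: cX => N' Nz.
  by have [y [[_ Xy] Ny]] := zP (exist _ X FX) N' Nz; exists y.
have [sC cC KC] := gX; exists (~` X); split=> //.
apply/seteqP; split=> [y [Ky Cy]|_ ->]; last by split=> //; case: sC.
apply: contrapT => y0.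
have [|W [sW oW _ maxW] Wy] := rsM y; first by apply/eqP.
apply: (maxX (X `|` ~` W)).
  by split=> [x Xx|XW]; [left | apply: Cy; apply: XW; right].
rewrite setCU setCK; split.
- exact: submodI.
- by apply: closedI => //; exact: open_submod_closed.
(* W + (K `&` C) is everything by maximality of W, so the component x - u of x in C
   is the sum of some w in W `&` C and an element of K, which is moved to u *)
move=> x.
have [u [Ku Cu]] := KC x.
pose Z := sumset W (K `&` ~` X).
have sKC : submodule (K `&` ~` X) by exact: submodI.
have ZT : Z = setT.
  have [||ZW|//] := maxW Z.
  - exact: submod_sum.
  - by apply: sub_suml; case: sKC.
  by case: Wy; rewrite -ZW; apply: sub_sumr; [case: sW | ].
have [w [Ww [Kw Cw]]] : Z (x - u) by rewrite ZT.
exists (u + (x - u - w)); split; first exact: KD.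
have -> : x - (u + (x - u - w)) = w by rewrite opprD addrA subKr.
split=> //; rewrite -(subKr (x - u) w).
exact: (@submodB _ _ _ (~` X)).
Qed.

Section MaximalAvoiding.
Variables (M : topModType A) (y : M) (W : set M).

Definition avoids_maximally : Prop :=
  [/\ submodule W, open W, ~ W y &
    forall Z, submodule Z -> W `<=` Z -> ~ Z y -> Z = W].

Definition cyclic_over : set M := [set x | exists a : A, W (x - a *: y)].

Lemma cyclic_over_submod : submodule W -> submodule cyclic_over.
Proof.
move=> [W0 WD WZ]; split; first by exists 0; rewrite scale0r subrr.
- move=> x z [a Wx] [b Wz]; exists (a + b).
  by rewrite scalerDl opprD addrACA; exact: WD.
- by move=> a x [b Wx]; exists (a * b); rewrite -scalerA -scalerBr; exact: WZ.
Qed.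

Lemma sub_cyclic_over : W `<=` cyclic_over.
Proof. by move=> x Wx; exists 0; rewrite scale0r subr0. Qed.

Lemma cyclic_over_id : submodule W -> cyclic_over y.
Proof. by case=> W0 _ _; exists 1; rewrite scale1r subrr. Qed.

(** Every submodule properly above W contains y. *)
Lemma avoids_maximally_max_open :
  avoids_maximally -> cyclic_over = setT -> max_open W.
Proof.
move=> [sW oW Wy maxW] WyT; split=> // [WT|Z sZ WZ]; first by apply: Wy; rewrite WT.
have [->|ZW] := pselect (Z = W); [by left|right].
have Zy : Z y by apply: contrapT => /(maxW Z sZ WZ).
apply/seteqP; split=> // x _; case: (sZ) => _ ZD ZZ.
have [a Wx] : cyclic_over x by rewrite WyT.
by rewrite -(subrK (a *: y) x); apply: ZD; [exact: WZ | exact: ZZ].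
Qed.

End MaximalAvoiding.

(** For y nonzero there is a W maximal among the submodules avoiding y.  Complements,
    projectivity and injectivity will each be used only to show Ay + W = M. *)
Lemma residually_simple_of_cyclic (M : topModType A) : pc_mod M ->
  (forall (y : M) W, avoids_maximally y W -> cyclic_over y W = setT) ->
  residually_simple M.
Proof.
move=> pcM cyc y y0.
have [|W0 [sW0 oW0 _ _ W0y]] :=
    open_submod_sep pcM (@submod_set1 _ _ M) (closed_set0 pcM) (y := y).
  by move/eqP: y0.
have [W [sW W0W Wy maxW]] := maximal_avoiding sW0 W0y.
have avW : avoids_maximally y W by split=> //; exact: (submod_open sW0).
by exists W => //; apply: avoids_maximally_max_open avW (cyc _ _ avW).
Qed.

Definition open_ideals_complemented : Prop :=
  forall T : set A, left_ideal T -> open T ->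
    exists2 C, left_ideal C & direct_sum_decomposition T C.

(** For z in M, complementing the ideal of all a with az in S = Ay + W writes
    1 = t + c with tz in S and (W + Cz) meeting S in W; then cz is in W by
    maximality of W, and z is in S. *)
Lemma complemented_residually_simple (M : topModType A) :
  open_ideals_complemented -> pc_mod M -> residually_simple M.
Proof.
move=> OC pcM; apply: residually_simple_of_cyclic => // y W [sW oW Wy maxW].
set Z := cyclic_over y W.
have sZ : submodule Z by exact: cyclic_over_submod.
have WZ' : W `<=` Z by exact: sub_cyclic_over.
have Zy : Z y by exact: cyclic_over_id.
apply/seteqP; split=> // z _; case: (sZ) => Z0 ZD ZZ; case: (sW) => W00 WD WZ.
pose T := [set a : A | Z (a *: z)].
have oT : open T.
  have /continuousP := @scalel_continuous _ _ _ z; apply.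
  exact: (submod_open sW).
have lT : left_ideal T.
  split; rewrite /T /=.
  - by rewrite scale0r.
  - by move=> a b Ta Tb; rewrite scalerDl; exact: ZD.
  - by move=> a b Tb; rewrite -scalerA; exact: ZZ.
have [C [C0 CD CM] [TC0 TC]] := OC T lT oT.
have [t Tt [c Cc tc1]] : [set x + y | x in T & y in C] 1 by rewrite TC.
suff Wcz : W (c *: z).
  by rewrite -[z]scale1r -tc1 scalerDl; apply: ZD => //; exact: WZ'.
pose S := sumset [set a *: z | a in C] W.
have sCz : submodule [set a *: z | a in C].
  split; first by exists 0; rewrite ?scale0r.
  - by move=> _ _ [a Ca <-] [b Cb <-]; exists (a + b); rewrite ?scalerDl //; exact: CD.
  - by move=> a _ [b Cb <-]; exists (a * b); rewrite ?scalerA //; exact: CM.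
have sS : submodule S by exact: submod_sum.
have WS : W `<=` S by apply: sub_sumr; case: sCz.
suff <- : S = W by apply: sub_suml => //; exists c.
apply: maxW => // -[_ [[b Cb <-] Wyb]].
have Tb : T b.
  rewrite /T /= -(subKr y (b *: z)); apply: submodB => //; exact: WZ'.
have : (T `&` C) b by [].
rewrite TC0 => b0; apply: Wy; move: Wyb; rewrite b0 scale0r subr0; exact.
Qed.

End Consequences.

(** * Discrete quotients *)

(** Only quotients by open subgroups are formed: they are discrete, so that all
    maps out of them are continuous. *)
Record open_subgroup (V : topAddGroupType) := OpenSubgroup {
  osg_set :> V -> Prop;
  osg0 : osg_set 0;
  osgB : forall x y, osg_set x -> osg_set y -> osg_set (x - y);
  osg_open : open (osg_set : set V) }.

Section CosetSpace.
Variables (V : topAddGroupType) (W : open_subgroup V).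

Definition same_coset : rel V := fun x y => `[< W (x - y) >].

Lemma same_coset_equiv : equiv_class_of same_coset.
Proof.
have N x : W x -> W (- x).
  by move=> Wx; rewrite -sub0r; apply: osgB => //; exact: osg0.
split=> [x|x y|y x z].
- by apply/asboolP; rewrite subrr; exact: osg0.
- by apply/asboolP/asboolP => /N; rewrite opprB.
- move=> /asboolP xy /asboolP yz; apply/asboolP.
  have -> : x - z = (x - y) - (z - y) by rewrite opprB addrA subrK.
  by apply: osgB => //; rewrite -opprB; exact: N.
Qed.

Canonical same_coset_equiv_rel := EquivRelPack same_coset_equiv.

Definition coset_space : Type := {eq_quot same_coset_equiv_rel}%qT.
HB.instance Definition _ := Choice.on coset_space.

Definition cls (x : V) : coset_space := (\pi_({eq_quot same_coset_equiv_rel}) x)%qT.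
Definition rep (p : coset_space) : V :=
  repr (p : {eq_quot same_coset_equiv_rel}%qT).

Lemma repK : cancel rep cls.
Proof. exact: reprK. Qed.

Lemma cls_eqP x y : cls x = cls y <-> W (x - y).
Proof. by split=> [/eqmodP/asboolP|h]; last by apply/eqmodP/asboolP. Qed.

Lemma rep_cls x : W (x - rep (cls x)).
Proof. by apply/cls_eqP; rewrite repK. Qed.

Lemma osgD x y : W x -> W y -> W (x + y).
Proof.
move=> Wx Wy; rewrite -[y]opprK -[- y]sub0r.
by apply: osgB => //; apply: osgB => //; exact: osg0.
Qed.

Let add p q := cls (rep p + rep q).
Let opp p := cls (- rep p).

Let addE x y : add (cls x) (cls y) = cls (x + y).
Proof.
apply/esym/cls_eqP; rewrite opprD addrACA.
by apply: osgD; exact: rep_cls.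
Qed.

Let oppE x : opp (cls x) = cls (- x).
Proof.
apply/cls_eqP; rewrite opprK addrC; exact: rep_cls.
Qed.

Let addA : associative add.
Proof.
move=> p q r; rewrite -(repK p) -(repK q) -(repK r).
by rewrite !addE addrA.
Qed.
Let addC : commutative add.
Proof. by move=> p q; rewrite /add addrC. Qed.
Let add0 : left_id (cls 0) add.
Proof. by move=> p; rewrite -(repK p) addE add0r. Qed.
Let addN : left_inverse (cls 0) opp add.
Proof. by move=> p; rewrite -(repK p) oppE addE addNr. Qed.

HB.instance Definition _ :=
  GRing.isZmodule.Build coset_space addA addC add0 addN.
HB.instance Definition _ := hasNbhs.Build coset_space principal_filter.
HB.instance Definition _ := Discrete_ofNbhs.Build coset_space erefl.

Lemma clsD x y : cls (x + y) = cls x + cls y.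
Proof. by rewrite -addE. Qed.

Lemma cls0 : cls 0 = 0.
Proof. by []. Qed.

Lemma cls_eq0 x : cls x = 0 <-> W x.
Proof. by rewrite -cls0 cls_eqP subr0. Qed.

Lemma coset_space_discrete : discrete coset_space.
Proof. by move=> U; rewrite openE => x Ux; apply/principal_filterP. Qed.

Lemma continuous_discrete2 (f : coset_space * coset_space -> coset_space) :
  continuous f.
Proof.
move=> z U /nbhs_singleton Uz; exists ([set z.1], [set z.2]).
  by split; exact: discrete_set1.
by move=> [a b] [/= -> ->]; case: z Uz.
Qed.

Lemma continuous_discrete1 (T : topologicalType) (f : coset_space -> T) :
  continuous f.
Proof.
move=> z U /nbhs_singleton Uz.
by apply: (@filterS _ (nbhs z) _ [set z]); [move=> _ -> | exact: discrete_set1].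
Qed.

HB.instance Definition _ := isTopAddGroup.Build coset_space
  (@continuous_discrete2 _) (@continuous_discrete1 _ _).

Lemma nbhs_cls x : nbhs x [set y | cls y = cls x].
Proof.
have c : continuous (fun y : V => y + - x).
  apply: (@continuous_pair_comp V V V V (fun z => z.1 + z.2) id (fun=> - x)).
  - exact: top_add_continuous.
  - by move=> y; exact: cvg_id.
  - exact: cst_continuous.
have : nbhs x ((fun y : V => y + - x) @^-1` W).
  apply: (c x W); apply: open_nbhs_nbhs; split; first exact: osg_open.
  by rewrite subrr; exact: osg0.
by apply: filterS => y Wy; apply/cls_eqP.
Qed.

Lemma cls_continuous : continuous cls.
Proof.
move=> x U /nbhs_singleton Ux; apply: filterS (nbhs_cls x) => y yx.
by rewrite /preimage /= yx.
Qed.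

End CosetSpace.

Section QuotientModule.
Variables (k : fieldType) (A : topAlgType k) (M : topModType A).

Record open_submod := OpenSubmod {
  os_set :> M -> Prop;
  os_submod : submodule (os_set : set M);
  os_open : open (os_set : set M) }.

Definition os_subgroup (W : open_submod) : open_subgroup M :=
  @OpenSubgroup M W (let: And3 W0 _ _ := os_submod W in W0)
    (fun x y Wx Wy => submodB (os_submod W) Wx Wy) (os_open W).

Variable W : open_submod.

Definition modquot : Type := coset_space (os_subgroup W).
HB.instance Definition _ := TopAddGroup.on modquot.

Definition mcls (x : M) : modquot := cls (os_subgroup W) x.
Definition mrep (p : modquot) : M := @rep _ (os_subgroup W) p.

Lemma mrepK : cancel mrep mcls. Proof. exact: repK. Qed.

Lemma mcls_eqP x y : mcls x = mcls y <-> W (x - y).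
Proof. exact: (cls_eqP (os_subgroup W)). Qed.

Let scale (a : A) (p : modquot) : modquot := mcls (a *: mrep p).

Let scaleE a x : scale a (mcls x) = mcls (a *: x).
Proof.
apply/mcls_eqP; rewrite -scalerBr; case: (os_submod W) => _ _; apply.
by apply/mcls_eqP; rewrite mrepK.
Qed.

Let scaleA a b p : scale a (scale b p) = scale (a * b) p.
Proof. by rewrite -(mrepK p) !scaleE scalerA. Qed.
Let scale1 : left_id 1 scale.
Proof. by move=> p; rewrite -(mrepK p) scaleE scale1r. Qed.
Let scaleDr : right_distributive scale +%R.
Proof.
move=> a p q; rewrite -(mrepK p) -(mrepK q) -[mcls _ + mcls _]clsD.
by rewrite !scaleE scalerDr; exact: clsD.
Qed.
Let scaleDl p : {morph scale^~ p : a b / a + b}.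
Proof. by move=> a b; rewrite -(mrepK p) !scaleE scalerDl; exact: clsD. Qed.

HB.instance Definition _ := GRing.Zmodule_isLmodule.Build A modquot
  scaleA scale1 scaleDr scaleDl.

Let scale_cont : continuous (fun z : A * modquot => z.1 *: z.2).
Proof.
move=> [a p] U /nbhs_singleton /= Uap.
exists ([set b | mcls (b *: mrep p) = mcls (a *: mrep p)], [set p]).
  split; last exact: discrete_set1.
  exact: (scalel_continuous (nbhs_cls (os_subgroup W) (a *: mrep p))).
move=> [b q] /= [ba ->].
suff -> : b *: p = a *: p by [].
by rewrite -(mrepK p) -![_ *: mcls _]/(scale _ _) !scaleE.
Qed.

HB.instance Definition _ := isTopMod.Build k A modquot scale_cont.

Lemma mcls_linear : linear (mcls : M -> modquot).
Proof. by move=> a x y; rewrite -[a *: mcls x]/(scale a (mcls x)) scaleE; exact: clsD. Qed.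

Lemma mcls_eq0 x : mcls x = 0 <-> W x.
Proof. exact: (cls_eq0 (os_subgroup W)). Qed.

Lemma mcls_continuous : continuous mcls.
Proof. exact: cls_continuous. Qed.

Lemma modquot_discrete : discrete modquot.
Proof. exact: coset_space_discrete. Qed.

End QuotientModule.

Section FiniteModules.
Variables (k : fieldType) (A : topAlgType k).

(** The limit of a system with a single term. *)
Lemma discrete_findim_pseudocompact (M : topModType A) :
  discrete M -> findim_mod M -> pseudocompact_mod M.
Proof.
move=> dM fM.
pose X (i : 'I_1) := M.
pose t (i j : 'I_1) (_ : (i <= j)%O) (x : X j) : X i := x.
have inl x : invlim t (fun=> x) by [].
pose f (x : M) : invlim t := to_set_type (inl x).
exists _, 'I_1, X, t, f; split; split.
- by split; [constructor; exact: ord0 | move=> i j; exists i; rewrite ?(ord1 i) ?(ord1 j)].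
- by split.
- by [].
- by [].
- split.
    apply: set_type_continuous; apply: prod_topology_continuous => i y.
    exact: cvg_id.
  exists (fun z : invlim t => set_val z ord0); split=> //.
    move=> z; apply: val_inj; apply/functional_extensionality_dep => i.
    by rewrite (ord1 i).
  exact: invlim_proj_continuous.
- by [].
Qed.

Lemma pc_open_fincodim (M : topModType A) (W : set M) :
  pc_mod M -> submodule W -> open W -> fincodim W.
Proof.
move=> pcM sW oW; have [|U [sU oU fU UW]] := pc_base pcM (_ : nbhs 0 W).
  by apply: open_nbhs_nbhs; split=> //; case: sW.
exact: (fincodimS fU).
Qed.

Lemma modquot_findim (M : topModType A) (W : open_submod M) :
  pc_mod M -> findim_mod (modquot W).
Proof.
move=> pcM; apply: fincodim_findim.
have [V [f [fl fW]]] := pc_open_fincodim pcM (os_submod W) (@os_open _ _ _ W).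
have fE x y : mcls W x = mcls W y -> f x = f y.
  move=> /mcls_eqP/fW; rewrite klinearB // => /eqP.
  by rewrite subr_eq0 => /eqP.
have mD : forall x y, mcls W (x + y) = mcls W x + mcls W y.
  by move=> x y; exact: (linD (@mcls_linear _ _ _ W)).
have mZ : forall a x, mcls W (a *: x) = a *: mcls W x.
  by move=> a x; exact: (linZ (@mcls_linear _ _ _ W)).
exists V, (fun p => f (mrep p)); split; first split.
- by move=> p q; case: (fl) => <- _; apply: fE; rewrite mD !mrepK.
- by move=> c p; case: (fl) => _ <-; apply: fE; rewrite mZ !mrepK.
- move=> p; rewrite -fW -{1}(mrepK p); exact: mcls_eq0.
Qed.

Lemma modquot_pseudocompact (M : topModType A) (W : open_submod M) :
  pc_mod M -> pseudocompact_mod (modquot W).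
Proof.
move=> pcM; apply: discrete_findim_pseudocompact; first exact: modquot_discrete.
exact: modquot_findim.
Qed.

End FiniteModules.

(** Restriction of scalars along a continuous homomorphism to a discrete
    algebra. *)
Section Restriction.
Variables (k : fieldType) (A : topAlgType k).

Record discrete_hom (B : topAlgType k) := DiscreteHom {
  dh_fun :> A -> B;
  dh_hom : alg_hom dh_fun;
  dh_cont : continuous dh_fun;
  dh_discrete : discrete B }.

Definition restrict_scalars (B : topAlgType k) (h : discrete_hom B) : Type := B.

Variables (B : topAlgType k) (h : discrete_hom B).
Local Notation resmod := (restrict_scalars h).

HB.instance Definition _ := TopAddGroup.copy resmod B.

Let scale (a : A) (b : resmod) : resmod := h a * b.

Let scaleA a b x : scale a (scale b x) = scale (a * b) x.
Proof. by case: (dh_hom h) => _ hM _ _; rewrite /scale hM mulrA. Qed.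
Let scale1 : left_id 1 scale.
Proof. by case: (dh_hom h) => _ _ h1 _ x; rewrite /scale h1 mul1r. Qed.
Let scaleDr : right_distributive scale +%R.
Proof. by move=> a x y; exact: mulrDr. Qed.
Let scaleDl x : {morph scale^~ x : a b / a + b}.
Proof. by case: (dh_hom h) => hD _ _ _ a b; rewrite /scale hD; exact: mulrDl. Qed.

HB.instance Definition _ := GRing.Zmodule_isLmodule.Build A resmod
  scaleA scale1 scaleDr scaleDl.

Let scale_cont : continuous (fun z : A * resmod => z.1 *: z.2).
Proof.
apply: (@continuous_pair_comp (A * B)%type B B B (fun z => z.1 * z.2)
  (fun z => h z.1) snd).
- exact: topalg_mul_continuous.
- move=> z; apply: (@cvg_comp _ _ _ fst h); first exact: cvg_fst.
  exact: dh_cont.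
- by move=> z; exact: cvg_snd.
Qed.

HB.instance Definition _ := isTopMod.Build k A resmod scale_cont.

Lemma resmod_scaleE (a : A) (x : resmod) : a *: x = h a * (x : B).
Proof. by []. Qed.

Lemma resmod_findim : findim_alg B -> findim_mod resmod.
Proof.
move=> [n [e eP]]; exists n, e => x; have [c ->] := eP x; exists c.
by apply: eq_bigr => i _; rewrite resmod_scaleE; case: (dh_hom h) => _ _ _ ->.
Qed.

End Restriction.

(** The terms of an inverse system with limit A are A-modules through the
    projections from A. *)
Lemma regmod_pseudocompact (k : fieldType) (A : topAlgType k) :
  pseudocompact_alg A -> pseudocompact_mod (regmod A).
Proof.
move=> [d [I [X [t [f [[dI invt th] [dX fh fhom]]]]]]].
have phic i : continuous (fun a : A => set_val (f a) i).
  move=> a; have [fc _] := fh.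
  apply: (@continuous_comp _ _ _ f (fun z : invlim t => set_val z i)); first exact: fc.
  exact: invlim_proj_continuous.
pose h i := DiscreteHom (fhom i) (phic i) (dX i).1.
have thi i j (hij : (i <= j)%O) a : t i j hij (h j a) = h i a.
  exact: (set_valP (f a)).
exists d, I, (fun i => restrict_scalars (h i)), t, f; split; split=> //.
- move=> i j hij a x y; case: (th i j hij) => tD tM _ _.
  by rewrite tD (@resmod_scaleE _ _ _ (h i)) -(thi i j hij) -tM.
- by move=> i; split; [exact: (dX i).1 | apply: resmod_findim; exact: (dX i).2].
- move=> i a x y; case: (fhom i) => fD fM _ _.
  by rewrite -[LHS]/(set_val (f (a * x + y)) i) fD fM.
Qed.

(** * Semisimplicity, projectivity and injectivity *)

Section Semisimplicity.
Variables (k : fieldType) (A : topAlgType k).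
Local Notation RA := (regmod A).

(** A proper closed left ideal lies in a proper open one, so the maximal closed left
    ideals are open. *)
Lemma max_open_left_idealP (I : set A) : pc_mod RA ->
  @max_open _ A RA I <-> maximal_closed_left_ideal I.
Proof.
move=> pcA; split=> [[sI oI IT maxI]|[sI cI IT maxI]].
  split=> // [|L sL cL LT IL]; first exact: (@open_submod_closed _ _ RA).
  by have [] := maxI L sL IL.
have I1 : ~ I 1.
  move=> I1; apply: IT; apply/seteqP; split=> // x _.
  by rewrite -(mulr1 x); case: sI => _ _; apply.
have [W [sW oW fW IW W1]] := @open_submod_sep _ _ RA pcA I 1 sI cI I1.
have <- : W = I.
  apply: maxI => //; first exact: (@open_submod_closed _ _ RA).
  by move=> WT; apply: W1; rewrite WT.
split=> // [WT|Z sZ WZ]; first by apply: W1; rewrite WT.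
have [->|ZT] := pselect (Z = setT); [by right|left].
have oZ : open Z by exact: (@submod_open _ _ RA W).
have cZ : closed Z by exact: (@open_submod_closed _ _ RA).
have IZ : I `<=` Z by move=> x /IW/WZ.
rewrite (maxI Z) //; apply/esym/maxI => //; first exact: (@open_submod_closed _ _ RA).
by move=> WT; apply: W1; rewrite WT.
Qed.

Lemma jacobson_residually_simple : pc_mod RA ->
  jacobson_radical A = [set 0] <-> residually_simple RA.
Proof.
move=> pcA; split=> [J0 y y0|rsA].
  apply: contrapT => nW; case/eqP: (y0).
  have : jacobson_radical A y.
    move=> I mI; apply: contrapT => Iy; apply: nW.
    by exists I => //; apply/max_open_left_idealP.
  by rewrite J0.
apply/seteqP; split=> [y Jy|_ -> I [[I0 _ _] _ _ _]] //.
apply: contrapT => /eqP y0; have [W mW Wy] := rsA y y0.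
by apply: Wy; apply: Jy; apply/max_open_left_idealP.
Qed.

Lemma residually_simple_top_semisimple :
  pc_mod RA -> residually_simple RA -> top_semisimple A.
Proof.
move=> pcA rsA I sI cI.
have [C [sC cC IC0 IC]] := @closed_complement _ _ RA I pcA rsA sI cI.
exists C; split=> //; split=> //.
apply/seteqP; split=> // x _; have [u [Iu Cu]] := IC x.
by exists u => //; exists (x - u) => //; rewrite addrCA subrr addr0.
Qed.

Lemma top_semisimple_open : top_semisimple A -> open_ideals_complemented A.
Proof.
move=> ssA T sT oT; have [|L [sL cL TL]] := ssA T sT.
  exact: (@open_submod_closed _ _ RA).
by exists L.
Qed.

Section Cancellation.
Variables (M N : topModType A) (g : M -> N).
Hypothesis gl : cont_hom g.

Lemma injective_is_mono : injective g -> mono g.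
Proof.
move=> gI L u v _ _ _ guv; apply/funext => x; apply: gI.
by have := congr1 (fun h => h x) guv.
Qed.

Lemma surjective_is_epi : (forall y, exists x, g x = y) -> epi g.
Proof.
move=> gS L u v _ _ _ ugv; apply/funext => y; have [x <-] := gS y.
by have := congr1 (fun h => h x) ugv.
Qed.

(** An element m of the kernel is detected by the map a |-> a *: m from A. *)
Lemma mono_is_injective : pseudocompact_mod RA -> mono g -> injective g.
Proof.
move=> pcA gm x y gxy; apply/eqP; rewrite -subr_eq0; apply/eqP.
set m := x - y.
have gm0 : g m = 0 by rewrite linB ?gxy ?subrr //; case: gl.
have uv := gm RA (fun a => (a : A) *: m) (fun=> 0) pcA.
have := congr1 (fun h => h 1) (uv _ _ _); rewrite /= scale1r; apply.
- split; first by move=> a b c; rewrite scalerDl scalerA.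
  exact: scalel_continuous.
- split; first by move=> a b c; rewrite scaler0 addr0.
  exact: cst_continuous.
- apply/funext => a /=; case: gl => gl1 _.
  by rewrite linZ // gm0 scaler0 lin0.
Qed.

(** The range is closed; if it misses y, it lies in an open submodule W that misses
    y, and the projection to N / W cannot be told from 0 on the range. *)
Lemma epi_is_surjective : pc_mod M -> pc_mod N -> epi g -> forall y, exists x, g x = y.
Proof.
move=> pcM pcN ge y; case: gl => gl1 gc.
apply: contrapT => ny.
have cg : closed (range g) by exact: range_closed.
have sg : submodule (range g) by exact: submod_image.
have [|W [sW oW _ gW Wy]] := open_submod_sep pcN sg cg (y := y).
  by move=> [x _ gx]; apply: ny; exists x.
pose Q := OpenSubmod sW oW.
apply: Wy; apply/(mcls_eq0 Q).
have uv := ge (modquot Q) (mcls Q) (fun=> 0) (modquot_pseudocompact _ pcN).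
have := congr1 (fun h => h y) (uv _ _ _); apply.
- by split; [exact: mcls_linear | exact: mcls_continuous].
- split; first by move=> a b c; rewrite scaler0 addr0.
  exact: cst_continuous.
- by apply/funext => x /=; apply/mcls_eq0; apply: gW; exists x.
Qed.

End Cancellation.

(** A complement C of the kernel of g is mapped bijectively onto N, so f lifts to a
    unique map h with values in C, and the graph of h is closed. *)
Lemma open_complemented_projective (M : topModType A) :
  open_ideals_complemented A -> pseudocompact_mod M -> projective M.
Proof.
move=> OC /pseudocompact_pc pcP M1 N g f /pseudocompact_pc pcM /pseudocompact_pc pcN.
move=> gh ge fh; have gS := epi_is_surjective gh pcM pcN ge.
case: gh => gl gc; case: fh => fl fc.
have sK : submodule (g @^-1` [set 0]) by apply: submod_preimage => //; exact: submod_set1.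
have cK : closed (g @^-1` [set 0]).
  apply: closed_comp => [x _|]; [exact: gc | exact: closed_set0].
have [C [sC cC KC0 KC]] :=
  closed_complement pcM (complemented_residually_simple OC pcM) sK cK.
have exh p : exists c, C c /\ g c = f p.
  have [m gm] := gS (f p); have [u [gu Cu]] := KC m.
  by exists (m - u); split=> //; rewrite linB // gm gu subr0.
have uniq c c' : C c -> C c' -> g c = g c' -> c = c'.
  move=> Cc Cc' gcc; apply/eqP; rewrite -subr_eq0; apply/eqP.
  have : (g @^-1` [set 0] `&` C) (c - c').
    split; last exact: submodB.
    by rewrite /preimage /= linB // gcc subrr.
  by rewrite KC0.
have [h hP] := choice exh.
have hl : linear h.
  move=> a x y; apply: uniq.
  - by case: (hP (a *: x + y)).
  - by case: sC => _ CD CZ; apply: CD; [apply: CZ|]; apply: (hP _).1.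
  - by rewrite (hP _).2 fl gl !(hP _).2.
exists h; last by apply/funext => p; rewrite /= (hP p).2.
split=> //; apply: closed_graph_continuous => // p c gr.
have Cc : C c.
  by apply: cC => N' Nc; have [z [_ Nz]] := gr setT N' filterT Nc;
    exists (h z); split=> //; exact: (hP z).1.
apply: uniq => //; first exact: (hP p).1.
rewrite (hP p).2; apply: pc_eq => // V sV oV.
have [z [/= fz gz]] := gr _ _ (fc p _ (nbhs_submod (f p) sV oV))
  (gc c _ (nbhs_submod (g c) sV oV)).
move: gz; rewrite (hP z).2 => gz.
by apply: (submod_trans (y := f z)) => //; exact: submodBC.
Qed.

(** The retraction r of N onto M along a complement of the image has closed graph,
    and f \o r extends f. *)
Lemma open_complemented_injective (M : topModType A) : pseudocompact_mod RA ->
  open_ideals_complemented A -> pseudocompact_mod M -> injective_mod M.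
Proof.
move=> pcA OC /pseudocompact_pc pcQ M1 N g f /pseudocompact_pc pcM /pseudocompact_pc pcN.
move=> gh gm fh; have gI := mono_is_injective gh pcA gm.
case: gh => gl gc; case: fh => fl fc.
have [C [sC cC KC0 KC]] := closed_complement pcN
  (complemented_residually_simple OC pcN) (submod_image gl (@submodT _ _ M1))
  (range_closed pcM pcN gl gc).
have exr n : exists m, C (n - g m).
  by have [_ [[m _ <-] Cm]] := KC n; exists m.
have uniq n m m' : C (n - g m) -> C (n - g m') -> m = m'.
  move=> Cm Cm'; apply/eqP; rewrite -subr_eq0; apply/eqP/gI.
  rewrite lin0 //; suff : (range g `&` C) (g (m - m')) by rewrite KC0.
  split; first by exists (m - m').
  rewrite linB // -(opprK (g m - _)) opprB.
  have -> : g m' - g m = (n - g m) - (n - g m') by rewrite opprB [RHS]addrC addrA subrK.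
  by apply: submodN => //; exact: submodB.
have [r rP] := choice exr.
have rl : linear r.
  move=> a x y; apply: uniq; first exact: rP.
  rewrite gl opprD addrACA -scalerBr; case: sC => _ CD CZ.
  by apply: CD; [apply: CZ|]; exact: rP.
have rc : continuous r.
  apply: closed_graph_continuous => // n m gr.
  apply: (uniq n); last exact: rP.
  apply: cC => N' /nbhs_shift/(pc_base pcN) [V [sV oV _ VN]].
  have [z [/= zn gz]] := gr _ _ (nbhs_submod n sV oV) (gc m _ (nbhs_submod (g m) sV oV)).
  exists (z - g (r z)); split; first exact: rP.
  have /VN /= : V ((z - n) - (g (r z) - g m)) by exact: submodB.
  have -> : (z - n) - (g (r z) - g m) = (z - g (r z)) - (n - g m).
    by rewrite !opprB addrACA [RHS]addrACA [- n - _]addrC.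
  by rewrite addrC subrK.
exists (f \o r).
  split; first by move=> a x y; rewrite /= rl fl.
  by move=> n; apply: (@continuous_comp _ _ _ r f); [exact: rc | exact: fc].
apply/funext => m /=; congr f; apply: (uniq (g m)); first exact: rP.
by rewrite subrr; case: sC.
Qed.

End Semisimplicity.

Section ConverseSemisimplicity.
Variables (k : fieldType) (A : topAlgType k).
Local Notation RA := (regmod A).

Section Quotients.
Hypothesis pcA : pc_mod RA.
Variables (y : RA) (W : set RA).
Hypothesis avW : avoids_maximally y W.

Let sW : submodule W. Proof. by case: avW. Qed.
Let oW : open W. Proof. by case: avW. Qed.
Let maxW : forall Z, submodule Z -> W `<=` Z -> ~ Z y -> Z = W.
Proof. by case: avW. Qed.
Let QW := OpenSubmod sW oW.

(** A splitting of A / W -> A / S, where S = Ay + W, yields a submodule meeting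
    S in W, which is W itself. *)
Lemma projective_cyclic :
  (forall M : topModType A, pseudocompact_mod M -> projective M) ->
  cyclic_over y W = setT.
Proof.
move=> proj.
set S := cyclic_over y W.
have sS : submodule S by exact: cyclic_over_submod.
have WS : W `<=` S by exact: sub_cyclic_over.
have oS : open S by exact: (submod_open sW).
pose QS := OpenSubmod sS oS.
pose g (p : modquot QW) : modquot QS := mcls QS (mrep p).
have gE x : g (mcls QW x) = mcls QS x.
  by apply/(mcls_eqP QS)/WS/(mcls_eqP QW); rewrite mrepK.
have gl : linear g.
  move=> a p q; rewrite -(mrepK p) -(mrepK q) -(@mcls_linear _ _ _ QW) !gE.
  exact: mcls_linear.
have gh : cont_hom g by split; [exact: gl | exact: continuous_discrete1].
have gS : forall q, exists p, g p = q.
  by move=> q; exists (mcls QW (mrep q)); rewrite gE mrepK.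
have [|||||h [hl _] gh1] := proj (modquot QS) (modquot_pseudocompact QS pcA)
  (modquot QW) (modquot QS) g id.
- exact: modquot_pseudocompact.
- exact: modquot_pseudocompact.
- exact: gh.
- exact: surjective_is_epi.
- by split=> // a p q.
have gK q : g (h q) = q by have := congr1 (fun f => f q) gh1.
pose C : set RA := [set a | mcls QW a = h (mcls QS a)].
have WC : C = W.
  apply: maxW.
  - split; rewrite /C /=.
    + by rewrite (lin0 (@mcls_linear _ _ _ QS)) (lin0 hl) (lin0 (@mcls_linear _ _ _ QW)).
    + move=> a b ha hb.
      by rewrite (linD (@mcls_linear _ _ _ QS)) (linD hl) (linD (@mcls_linear _ _ _ QW)) ha hb.
    + move=> a b hb.
      by rewrite (linZ (@mcls_linear _ _ _ QS)) (linZ hl) (linZ (@mcls_linear _ _ _ QW)) hb.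
  - move=> a Wa; rewrite /C /= (mcls_eq0 QS a).2 ?(lin0 hl); last exact: WS.
    exact/mcls_eq0.
  - rewrite /C /= (mcls_eq0 QS y).2 ?(lin0 hl); last exact: cyclic_over_id.
    by move=> /(mcls_eq0 QW); case: avW.
apply/seteqP; split=> // a _.
pose b : RA := mrep (h (mcls QS a)).
have Sb : mcls QS b = mcls QS a by rewrite -gE mrepK gK.
have /WS/(mcls_eq0 QS) Sb0 : W b by rewrite -WC /C /= Sb mrepK.
by apply/(mcls_eq0 QS); rewrite -Sb.
Qed.

(** A retraction of A / W onto its submodule S / W, which is A / (W : y), has a
    kernel meeting S in W. *)
Lemma injective_cyclic :
  (forall M : topModType A, pseudocompact_mod M -> injective_mod M) ->
  cyclic_over y W = setT.
Proof.
move=> inj.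
pose L : set RA := [set a | W (a *: y)].
have lscal : linear (fun a : RA => (a : A) *: y).
  by move=> a b c; rewrite scalerDl scalerA.
have scalc : continuous (fun a : RA => (a : A) *: y).
  exact: scalel_continuous.
have sL : submodule L by exact: (submod_preimage lscal).
have oL : open L by move/continuousP: scalc; apply.
pose QL := OpenSubmod sL oL.
pose g (p : modquot QL) : modquot QW := mcls QW ((mrep p : A) *: y).
have gE a : g (mcls QL a) = mcls QW ((a : A) *: y).
  apply/(mcls_eqP QW); rewrite -scalerBl; apply/(mcls_eqP QL).
  by rewrite mrepK.
have gl : linear g.
  move=> a p q; rewrite -(mrepK p) -(mrepK q) -(@mcls_linear _ _ _ QL) !gE.
  rewrite (lscal a) (linD (@mcls_linear _ _ _ QW)).
  by rewrite (linZ (@mcls_linear _ _ _ QW)).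
have gh : cont_hom g by split; [exact: gl | exact: continuous_discrete1].
have gI : injective g.
  move=> p q; rewrite -(mrepK p) -(mrepK q) !gE => /(mcls_eqP QW).
  by rewrite -scalerBl => h; apply/(mcls_eqP QL).
have [|||||h [hl _] hg1] := inj (modquot QL) (modquot_pseudocompact QL pcA)
  (modquot QL) (modquot QW) g id.
- exact: modquot_pseudocompact.
- exact: modquot_pseudocompact.
- exact: gh.
- exact: injective_is_mono.
- by split=> // a p q.
have gK p : h (g p) = p by have := congr1 (fun f => f p) hg1.
pose C : set RA := [set a | h (mcls QW a) = 0].
have WC : C = W.
  apply: maxW.
  - split; rewrite /C /=.
    + by rewrite (lin0 (@mcls_linear _ _ _ QW)) (lin0 hl).
    + move=> a b ha hb.
      by rewrite (linD (@mcls_linear _ _ _ QW)) (linD hl) ha hb addr0.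
    + move=> a b hb.
      by rewrite (linZ (@mcls_linear _ _ _ QW)) (linZ hl) hb scaler0.
  - by move=> a Wa; rewrite /C /= (mcls_eq0 QW a).2 // (lin0 hl).
  - rewrite /C /= -[y]scale1r -gE gK => /(mcls_eq0 QL).
    by rewrite /= /L /= scale1r; case: avW.
apply/seteqP; split=> // a _.
exists (mrep (h (mcls QW a))); rewrite -{1}WC /C /=.
by rewrite (linB (@mcls_linear _ _ _ QW)) (linB hl) -gE gK mrepK subrr.
Qed.

End Quotients.
End ConverseSemisimplicity.

(** The kernel of a coordinate map to a simple module is a maximal open left ideal. *)
Lemma product_of_simples_residually_simple (k : fieldType) (A : topAlgType k)
    (I : Type) (S : I -> topModType A) :
  (forall i, simple_mod (S i)) -> topmod_iso (regmod A) (prod_topology S) ->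
  residually_simple (regmod A).
Proof.
move=> simS [f fl [fc [g [fK _ _]]]] y y0.
have [i fyi] : exists i, f y i <> 0.
  apply: contrapT => nfy; case/eqP: y0; apply: (can_inj fK); rewrite (lin0 fl).
  apply/functional_extensionality_dep => i.
  by apply: contrapT => fyi; apply: nfy; exists i.
have [pcS [m m0] simpleS] := simS i.
have {}pcS := pseudocompact_pc pcS.
(* a simple module is discrete, since a proper open submodule must vanish *)
have o0 : open [set (0 : S i)].
  have [|W [sW oW _ _ Wm]] := open_submod_sep pcS (@submod_set1 _ _ (S i)) (closed_set0 pcS) (y := m).
    by move/eqP: m0.
  have [<- //|WT] := simpleS W sW (open_submod_closed sW oW).
  by case: Wm; rewrite WT.
pose p (a : regmod A) : S i := f a i.
have pl : linear p by move=> a b c; rewrite /p fl.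
have pc : continuous p.
  move=> a; apply: (@continuous_comp _ _ _ f (fun z : prod_topology S => z i)); first exact: fc.
  exact: prod_topology_proj_continuous.
have sW : submodule (p @^-1` [set 0]) by apply: submod_preimage => //; exact: submod_set1.
exists (p @^-1` [set 0]); last exact: fyi.
split=> //.
- by move/continuousP: pc; apply.
- by move=> WT; apply: fyi; rewrite -[_ = 0]/((p @^-1` [set 0]) y) WT.
move=> Z sZ WZ.
have sp : submodule (p @` Z) by exact: submod_image.
have op : open (p @` Z).
  apply: (submod_open (@submod_set1 _ _ _) sp o0) => _ ->.
  by case: sp.
have [p0|pT] := simpleS _ sp (open_submod_closed sp op); [left|right].
  apply/seteqP; split=> // z Zz; rewrite -[_ z]/([set 0] (p z)) -p0.
  by exists z.
apply/seteqP; split=> // x _; have [z Zz zx] : (p @` Z) (p x) by rewrite pT.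
rewrite -(subrK z x); case: (sZ) => _ ZD _; apply: ZD => //; apply: WZ.
by rewrite /preimage /= (linB pl) zx subrr.
Qed.

(** * Inverse limits of semisimple algebras *)

Section QuotientAlgebra.
Variables (k : fieldType) (A : topAlgType k).

Definition open_ideal (U : set A) : Prop :=
  [/\ left_ideal U, forall x a, U x -> U (x * a) & open U].

Definition ideal_subgroup (U : set A) (oU : open_ideal U) : open_subgroup A :=
  let: And3 lU _ opU := oU in
  @OpenSubgroup A U (let: And3 U0 _ _ := lU in U0)
    (fun x y Ux Uy => @submodB k A (regmod A) U x y lU Ux Uy) opU.

Variables (U : set A) (oU : open_ideal U).

Lemma ideal_subgroupE : ideal_subgroup oU = U :> set A.
Proof. by rewrite /ideal_subgroup; case: oU. Qed.

Definition algquot : Type := coset_space (ideal_subgroup oU).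
HB.instance Definition _ := TopAddGroup.on algquot.

Definition acls (x : A) : algquot := cls (ideal_subgroup oU) x.
Definition arep (p : algquot) : A := @rep _ (ideal_subgroup oU) p.

Lemma arepK : cancel arep acls. Proof. exact: repK. Qed.

Lemma acls_eqP x y : acls x = acls y <-> U (x - y).
Proof. by have := cls_eqP (ideal_subgroup oU) x y; rewrite ideal_subgroupE. Qed.

Let mul (p q : algquot) : algquot := acls (arep p * arep q).

Let mulE x y : mul (acls x) (acls y) = acls (x * y).
Proof.
have [[_ UD UM] UR _] := oU; apply/acls_eqP.
set x' := arep _; set y' := arep _.
have -> : x' * y' - x * y = x' * (y' - y) + (x' - x) * y.
  by rewrite mulrBr mulrBl addrA subrK.
by apply: UD; [apply: UM | apply: UR]; apply/acls_eqP; rewrite arepK.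
Qed.

Let aclsD x y : acls (x + y) = acls x + acls y. Proof. exact: clsD. Qed.

Let mulA : associative mul.
Proof. by move=> p q r; rewrite -(arepK p) -(arepK q) -(arepK r) !mulE mulrA. Qed.
Let mul1 : left_id (acls 1) mul.
Proof. by move=> p; rewrite -(arepK p) mulE mul1r. Qed.
Let mulx1 : right_id (acls 1) mul.
Proof. by move=> p; rewrite -(arepK p) mulE mulr1. Qed.
Let mulDl : left_distributive mul +%R.
Proof.
move=> p q r; rewrite -(arepK p) -(arepK q) -(arepK r).
by rewrite -aclsD !mulE mulrDl aclsD.
Qed.
Let mulDr : right_distributive mul +%R.
Proof.
move=> p q r; rewrite -(arepK p) -(arepK q) -(arepK r).
by rewrite -aclsD !mulE mulrDr aclsD.
Qed.

HB.instance Definition _ :=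
  GRing.Zmodule_isPzRing.Build algquot mulA mul1 mulx1 mulDl mulDr.

Lemma aclsM x y : acls (x * y) = acls x * acls y.
Proof. by rewrite -[RHS]/(mul _ _) mulE. Qed.

Let inj (c : k) : algquot := acls (kmap c).

Let injD : {morph inj : c d / c + d}.
Proof. by move=> c d; rewrite /inj kmapD aclsD. Qed.
Let injM : {morph inj : c d / c * d}.
Proof. by move=> c d; rewrite /inj kmapM aclsM. Qed.
Let inj1 : inj 1 = 1.
Proof. by rewrite /inj kmap1. Qed.
Let injC c x : inj c * x = x * inj c.
Proof. by rewrite /inj -(arepK x) -!aclsM kmap_central. Qed.

HB.instance Definition _ := isTopAlg.Build k algquot injD injM inj1 injC
  (@continuous_discrete2 _ (ideal_subgroup oU) _).

Lemma acls_hom : alg_hom acls.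
Proof. by split=> [x y|x y||c]; rewrite ?aclsM. Qed.

Lemma algquot_discrete : discrete algquot.
Proof. exact: coset_space_discrete. Qed.

Lemma acls_continuous : continuous acls.
Proof. exact: cls_continuous. Qed.

Lemma algquot_findim : pc_mod (regmod A) -> findim_alg algquot.
Proof.
move=> pcA; case: (oU) => lU _ opU.
have [n [e eP]] := fincodim_span (M := regmod A) lU (pc_open_fincodim pcA lU opU).
exists n, (fun i => acls (e i)) => p; have [c Uc] := eP (arep p); exists c.
rewrite -(arepK p); move/acls_eqP: Uc => ->.
have [hD hM _ hk] := acls_hom.
rewrite (big_morph acls hD (_ : acls 0 = 0)) //.
by apply: eq_bigr => i _; rewrite -hk -hM.
Qed.

Lemma algquot_semisimple : open_ideals_complemented A -> semisimple_alg algquot.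
Proof.
move=> OC I [I0 ID IM].
have [hD hM _ hk] := acls_hom.
have lT : left_ideal (acls @^-1` I).
  split; rewrite /preimage /=.
  - by have -> : acls 0 = 0 by [].
  - by move=> x y Ix Iy; rewrite hD; exact: ID.
  - by move=> a x Ix; rewrite hM; exact: IM.
have oT : open (acls @^-1` I).
  by have /continuousP := acls_continuous; apply; exact: algquot_discrete.
have [C [C0 CD CM] [TC0 TC]] := OC _ lT oT.
exists (acls @` C); split.
- by exists 0.
- by move=> _ _ [x Cx <-] [y Cy <-]; exists (x + y); rewrite ?hD //; exact: CD.
- move=> p _ [x Cx <-]; exists (arep p * x); first exact: CM.
  by rewrite hM arepK.
- apply/seteqP; split=> [p [Ip [c Cc cp]]|_ ->]; last by split=> //; exists 0.
  rewrite -cp in Ip *; suff : (acls @^-1` I `&` C) c by rewrite TC0 => ->.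
  by split.
- apply/seteqP; split=> // p _.
  have [x Tx [c Cc xc]] : [set x + y | x in acls @^-1` I & y in C] (arep p) by rewrite TC.
  exists (acls x) => //; exists (acls c); first by exists c.
  by rewrite -hD xc arepK.
Qed.

End QuotientAlgebra.

(** The largest two-sided ideal inside a left ideal L. *)
Definition ideal_core (k : fieldType) (A : topAlgType k) (L : set A) : set A :=
  [set a | forall b, L (a * b)].

Section InverseLimitOfQuotients.
Variables (k : fieldType) (A : topAlgType k).
Local Notation RA := (regmod A).
Hypothesis pcA : pc_mod RA.

Lemma ideal_core_sub (L : set A) : ideal_core L `<=` L.
Proof. by move=> a /(_ 1); rewrite mulr1. Qed.

(** If e spans A modulo L over k, the core is cut out by a * e_j in L. *)
Lemma ideal_core_open (L : set A) : left_ideal L -> open L ->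
  open_ideal (ideal_core L).
Proof.
move=> lL oL; case: (lL) => L0 LD LM.
have sI : @submodule _ A RA (ideal_core L).
  split=> [b|x y Lx Ly b|a x Lx b]; first by rewrite mul0r.
  - by rewrite mulrDl; apply: LD; [exact: Lx | exact: Ly].
  - by rewrite -mulrA; apply: LM; exact: Lx.
split=> // [x a Lx b|]; first by rewrite -mulrA; exact: Lx.
have [n [e eP]] := fincodim_span (M := RA) lL (pc_open_fincodim pcA lL oL).
have : nbhs (0 : A) [set a | forall j, L (a * e j)].
  apply: filter_forall => j; apply: (@scalel_continuous _ _ RA (e j) 0 L).
  by rewrite scale0r; apply: open_nbhs_nbhs.
have : [set a | forall j, L (a * e j)] `<=` ideal_core L.
  move=> a La b; have [c Lc] := eP b.
  rewrite -[b](subrK (\sum_i (kmap (c i) : A) *: (e i : RA))) mulrDr.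
  apply: (LD); first exact: LM.
  rewrite mulr_sumr; apply: (big_ind (fun x => L x)) => [||i _]; [exact: L0|exact: LD|].
  by rewrite -[_ *: _]/(kmap (c i) * e i) mulrA -kmap_central -mulrA; exact: LM.
move=> sub /(filterS sub) /(pc_base pcA) [V [sV oV _ VL]].
exact: (@submod_open _ _ RA V).
Qed.

Lemma open_ideal_base (N : set A) : nbhs (0 : RA) N ->
  exists2 U, open_ideal U & U `<=` N.
Proof.
move=> /(pc_base pcA) [V [sV oV _ VN]]; exists (ideal_core V).
  exact: ideal_core_open.
by move=> x /ideal_core_sub/VN.
Qed.

Definition open_ideals : Type := [set U : set A | open_ideal U].
HB.instance Definition _ := Choice.on open_ideals.

(** Smaller ideals come later, as their quotients are larger. *)
Definition open_ideals_le (U V : open_ideals) : bool :=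
  `[< set_val V `<=` set_val U >].

Lemma open_ideals_le_refl : reflexive open_ideals_le.
Proof. by move=> U; apply/asboolP. Qed.

Lemma open_ideals_le_anti : antisymmetric open_ideals_le.
Proof.
move=> U V /andP [/asboolP VU /asboolP UV]; apply: val_inj.
by apply/seteqP.
Qed.

Lemma open_ideals_le_trans : transitive open_ideals_le.
Proof.
move=> V U W /asboolP VU /asboolP WV; apply/asboolP.
exact: subset_trans VU.
Qed.

HB.instance Definition _ := Order.Le_isPOrder.Build Order.default_display open_ideals
  open_ideals_le_refl open_ideals_le_anti open_ideals_le_trans.

End InverseLimitOfQuotients.

Section SemisimpleLimits.
Variables (k : fieldType) (A : topAlgType k).
Local Notation RA := (regmod A).
Hypothesis pcA : pc_mod RA.

(** A is the limit of its quotients by open two-sided ideals, which are semisimple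
    because complements pass to quotients; linear compactness gives the surjectivity
    of the map to the limit. *)
Lemma complemented_limit : open_ideals_complemented A ->
  inverse_limit_of_discrete_algs (fun B => findim_alg B /\ semisimple_alg B) A.
Proof.
move=> OC.
pose oi (U : open_ideals A) : open_ideal (set_val U) := set_valP U.
pose X (U : open_ideals A) : topAlgType k := algquot (oi U).
pose t (U V : open_ideals A) (_ : (U <= V)%O) (p : X V) : X U :=
  acls (oi U) (arep p).
have tE U V h a : t U V h (acls (oi V) a) = acls (oi U) a.
  have /asboolP VU := h.
  by apply/acls_eqP/VU/acls_eqP; rewrite arepK.
have fl a : invlim t (fun U => acls (oi U) a) by move=> U V h; exact: tE.
pose f (a : A) : invlim t := to_set_type (fl a).
have fc : continuous f.
  apply: set_type_continuous; apply: prod_topology_continuous => U.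
  exact: acls_continuous.
have fI : injective f.
  move=> a b fab; apply/eqP; rewrite -subr_eq0; apply/eqP.
  apply: contrapT => /eqP /(pc_sep pcA) [N /(open_ideal_base pcA) [U oU UN]]; apply.
  apply: UN; apply/(acls_eqP oU).
  pose i : open_ideals A := to_set_type oU.
  have := congr1 (fun z : invlim t => set_val z i) fab.
  by rewrite /f /= => /acls_eqP h; apply/acls_eqP.
have idealI U V : open_ideal U -> open_ideal V -> open_ideal (U `&` V : set A).
  move=> [lU rU oU] [lV rV oV]; split; last exact: openI.
    exact: (@submodI _ A RA U V).
  by move=> x a [Ux Vx]; split; [exact: rU | exact: rV].
have fS z : exists a, f a = z.
  have [||a aP] := @pc_compact _ _ _ pcA (open_ideals A)
    (fun U => [set a | acls (oi U) a = set_val z U]).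
  - move=> U; exists (arep (set_val z U)), (set_val U).
    split; first by case: (oi U).
    by move=> a; rewrite /= -{1}(arepK (set_val z U)); exact: acls_eqP.
  - move=> U V; exists (to_set_type (idealI _ _ (oi U) (oi V))).
    set W := to_set_type _.
    have UW : (U <= W)%O by apply/asboolP => x [].
    have VW : (V <= W)%O by apply/asboolP => x [].
    have zt i j h : t i j h (set_val z j) = set_val z i := set_valP z i j h.
    by split=> a /= aW; [rewrite -(zt _ _ UW)|rewrite -(zt _ _ VW)]; rewrite -aW tE.
  exists a; apply: val_inj; apply/functional_extensionality_dep => U.
  have [b [/= bU ba]] := aP U _ (nbhs_cls (ideal_subgroup (oi U)) a).
  by rewrite -[LHS]ba; exact: bU.
have [g gP] := choice fS.
have fK : cancel f g by move=> a; apply: fI.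
exists _, (open_ideals A), X, t, f; split; split=> //.
- split; first by constructor; exists setT; apply/mem_set; split=> //; exact: openT.
  move=> U V; exists (to_set_type (idealI _ _ (oi U) (oi V))).
    by apply/asboolP => x [].
  by apply/asboolP => x [].
- split=> [U h p|U V W h1 h2 h3 p].
    by rewrite -(arepK p) tE.
  by rewrite -(arepK p) !tE.
- move=> U V h; case: (acls_hom (oi U)) => uD uM u1 uk.
  case: (acls_hom (oi V)) => vD vM v1 vk; split.
  + by move=> p q; rewrite -(arepK p) -(arepK q) -vD !tE uD.
  + by move=> p q; rewrite -(arepK p) -(arepK q) -vM !tE uM.
  + by rewrite -v1 tE.
  + by move=> c; rewrite -vk tE.
- move=> U; split; first exact: algquot_discrete.
  by split; [exact: algquot_findim | exact: algquot_semisimple].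
- split=> //; exists g; split=> // z N Nz.
  have [U oU UN] := open_ideal_base pcA ((@nbhs_shift _ _ RA (g z) N).1 Nz).
  pose i : open_ideals A := to_set_type oU.
  have : nbhs z ((fun z : invlim t => set_val z i) @^-1` [set set_val z i]).
    by apply: invlim_proj_continuous; apply: open_nbhs_nbhs; split=> //; exact: algquot_discrete.
  apply: filterS => y yz; rewrite /preimage /=.
  have /UN /= : U (g y - g z).
    apply/(acls_eqP (oi i)).
    by have := yz; rewrite /preimage /= -{1}(gP y) -{1}(gP z).
  by rewrite addrC subrK.
- by move=> U; exact: acls_hom.
Qed.

(** Mittag-Leffler: the images in X_i of the later terms stabilize, and linear
    compactness lifts every element of the stable image to the limit. *)
Lemma limit_stable_image d (I : porderType d) (X : I -> topAlgType k)
    (t : forall i j, (i <= j)%O -> X j -> X i) (f : A -> invlim t) :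
  directed I -> inverse_system t -> (forall i j h, alg_hom (t i j h)) ->
  (forall i, discrete (X i) /\ findim_alg (X i)) -> homeomorphism f ->
  (forall i, alg_hom (fun a => set_val (f a) i)) ->
  forall i, exists j (h : (i <= j)%O),
    forall z, exists a, t i j h z = set_val (f a) i.
Proof.
move=> [_ dI] [tid tcomp] th dX [fc [g [fK gK gc]]] fhom i.
have phic l : continuous (fun a : A => set_val (f a) l).
  move=> a.
  apply: (@continuous_comp _ _ _ f (fun z : invlim t => set_val z l)); first exact: fc.
  exact: invlim_proj_continuous.
pose h l := DiscreteHom (fhom l) (phic l) (dX l).1.
have thl l m (lm : (l <= m)%O) a : t l m lm (h m a) = h l a.
  exact: (set_valP (f a)).
pose R l : topModType A := restrict_scalars (h l).
have tl l m (lm : (l <= m)%O) : linear (t l m lm : R m -> R l).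
  move=> a x y; case: (th l m lm) => tD tM _ _.
  by rewrite tD (@resmod_scaleE _ _ _ (h l)) -(thl l m lm) -tM.
have dR l : discrete (R l) := (dX l).1.
have fR l : findim_mod (R l) by apply: resmod_findim; exact: (dX l).2.
pose J := {j : I | (i <= j)%O}.
have [||||[j ij] /= minj] := @fincodim_dcc _ _ (R i) _ J
  (fun j => range (t i (sval j) (proj2_sig j) : R (sval j) -> R i)) (findim_fincodim (fR i)).
- by constructor; exists i.
- by move=> [j ij] /=; apply: submod_image => //; exact: tl.
- by move=> [j ij] _ -> /=; exists 0 => //; apply: lin0; exact: tl.
- move=> [j ij] [l il]; have [m jm lm] := dI j l.
  have im : (i <= m)%O by exact: le_trans jm.
  exists (exist _ m im); split=> _ [z _ <-] /=.
    by exists (t j m jm z) => //; exact: tcomp.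
  by exists (t l m lm z) => //; exact: tcomp.
exists j, ij => z0; set x := t i j ij z0.
(* the families with i-th coordinate x that are compatible up to the index j *)
pose C (j : J) : set (prod_topology R) :=
  [set y | y i = x /\ forall l (h : (l <= sval j)%O), t l (sval j) h (y (sval j)) = y l].
have [||y yC] := @prod_linearly_compact _ _ I R fR J C.
- move=> [l il].
  have [|z _ /= zx] := minj (exist _ l il) x; first by exists z0.
  pose y0 : prod_topology R := fun m =>
    match pselect (m <= l)%O with left h => t m l h z | right _ => 0 end.
  have y0E m (ml : (m <= l)%O) : y0 m = t m l ml z.
    rewrite /y0; case: pselect => [ml'|/(_ ml) //].
    by rewrite (bool_irrelevance ml' ml).
  have y0l : y0 l = z by rewrite (y0E l (lexx l)) tid.
  exists y0, [set y | y i = 0 /\ forall m (h : (m <= l)%O), t m l h (y l) = y m].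
  split; first split.
  + by split=> // m ml; exact: (lin0 (tl m l ml)).
  + move=> u v [u0 ut] [v0 vt]; split.
      by rewrite -[LHS]/(u i + v i) u0 v0 addr0.
    by move=> m ml; rewrite -[RHS]/(u m + v m) -ut -vt; exact: (linD (tl m l ml)).
  + move=> a u [u0 ut]; split.
      by rewrite -[LHS]/(a *: u i) u0 scaler0.
    by move=> m ml; rewrite -[RHS]/(a *: u m) -ut; exact: (linZ (tl m l ml)).
  move=> y; rewrite /C /=; split=> -[yi yt]; split.
  + by rewrite -[LHS]/(y i - y0 i) yi (y0E i il) zx subrr.
  + move=> m ml; rewrite -[RHS]/(y m - y0 m) -[(y - y0) l]/(y l - y0 l).
    by rewrite (linB (tl m l ml)) yt y0l y0E.
  + apply/eqP; rewrite -subr_eq0 -zx -(y0E i il).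
    by rewrite -[_ - _]/((y - y0) i) yi.
  + move=> m ml; have := yt m ml.
    rewrite -[RHS]/(y m - y0 m) -[(y - y0) l]/(y l - y0 l) (linB (tl m l ml)).
    by rewrite y0l y0E => /addIr.
- move=> [j1 ij1] [j2 ij2]; have [m jm1 jm2] := dI j1 j2.
  have im : (i <= m)%O by exact: le_trans jm1.
  have down l il : (l <= m)%O -> C (exist _ m im) `<=` C (exist _ l il).
    move=> lm y [/= yi yt]; split=> // n nl /=.
    by rewrite -(yt l lm) (tcomp _ _ _ _ _ (le_trans nl lm)) yt.
  by exists (exist _ m im); split; exact: down.
have near_y l : nbhs y [set z : prod_topology R | z l = y l].
  have := @prod_topology_proj_continuous I R l y [set y l]; apply.
  by apply: open_nbhs_nbhs; split=> //; exact: dR.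
have yt : invlim t y.
  move=> l m lm; have [n im mn] := dI i m.
  have [|z [[_ zt] [[zl zm] zn]]] := yC (exist _ n im)
    [set z | (z l = y l /\ z m = y m) /\ z n = y n].
    by apply: filterI; [apply: filterI|]; exact: near_y.
  rewrite -zl -zm -(zt m mn) -(zt l (le_trans lm mn)) /=; exact: tcomp.
have yi : y i = x.
  have [z [[zx _] zi]] := yC (exist _ i (lexx i)) _ (near_y i).
  by rewrite -zi.
exists (g (to_set_type yt)); rewrite gK.
by rewrite -[RHS]/(y i) yi.
Qed.

(** The maps A -> X_i need not be surjective, and a subalgebra of a semisimple algebra
    need not be semisimple; but by Mittag-Leffler the image of A in X_i is a quotient
    of some later X_j.  A maximal left ideal of X_j that contains the kernel and avoids
    the image of y is then transported to A. *)
Lemma semisimple_limit_residually_simple :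
  inverse_limit_of_discrete_algs (fun B => findim_alg B /\ semisimple_alg B) A ->
  residually_simple RA.
Proof.
move=> [d [I [X [t [f [[dI invt th] [dX fh fhom]]]]]]] y y0.
have fc : continuous f by case: fh.
have fI : injective f by case: fh => _ [g [/can_inj]].
pose phi i (a : A) : X i := set_val (f a) i.
have [i fyi] : exists i, phi i y <> 0.
  apply: contrapT => nfy; case/eqP: y0; apply: fI; apply: val_inj.
  apply/functional_extensionality_dep => i.
  have -> : \val (f y) i = 0 by apply: contrapT => fyi; apply: nfy; exists i.
  have [fD _ _ _] := fhom i; apply/esym/(addrI (phi i 0)).
  by rewrite -[LHS]fD !addr0.
have [j [ij tj]] := limit_stable_image dI invt th
  (fun i => conj (dX i).1 (dX i).2.1) fh fhom i.
have [fD fM f1 _] := fhom i; have [tD tM t1 _] := th i j ij.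
have f0 : phi i 0 = 0 by apply: (addrI (phi i 0)); rewrite -[LHS]fD !addr0.
have fN a : phi i (- a) = - phi i a.
  by apply/esym/addr0_eq; rewrite -[LHS]fD subrr.
have t0 : t i j ij 0 = 0 by apply: (addrI (t i j ij 0)); rewrite -tD !addr0.
have tN a : t i j ij (- a) = - t i j ij a.
  by apply/esym/addr0_eq; rewrite -tD subrr.
have tphi a : t i j ij (phi j a) = phi i a by exact: (set_valP (f a)).
pose Xj := regmod (X j).
have sK : @submodule _ _ Xj [set z | t i j ij z = 0].
  split=> [|x z|a x] /=; first exact: t0.
    by rewrite tD => -> ->; rewrite addr0.
  by rewrite tM => ->; rewrite mulr0.
have [|n [sn Kn ny maxn]] := @maximal_avoiding _ _ Xj _ (phi j y) sK.
  by rewrite /= tphi.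
have avn : @avoids_maximally _ _ Xj (phi j y) n.
  by split=> //; exact: (dX j).1.
pose S := @cyclic_over _ _ Xj (phi j y) n.
have sS : submodule S by exact: cyclic_over_submod.
have [C lC [SC0 SC]] := (dX j).2.2 S sS.
have sCn : @submodule _ _ Xj (@sumset _ _ Xj C n) by exact: submod_sum.
have n0 : n 0 by case: sn.
have Cn : C `<=` n.
  have <- : @sumset _ _ Xj C n = n.
    apply: maxn => //; first by apply: sub_sumr; case: lC.
    move=> [c [Cc nc]]; apply: ny.
    have : (S `&` C) c.
      split=> //; exists 1; rewrite scale1r; exact: submodBC.
    by rewrite SC0 => c0; move: nc; rewrite c0 subr0.
  exact: (@sub_suml _ _ Xj C n n0).
have ST : S = setT.
  apply/seteqP; split=> // x _.
  have [s Ss [c Cc <-]] : [set x + y | x in S & y in C] x by rewrite SC.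
  case: (sS) => _ SD _; apply: SD => //.
  by apply: sub_cyclic_over; exact: Cn.
have [_ _ nT maxn'] := avoids_maximally_max_open avn ST.
have phic : continuous (phi i).
  move=> a; apply: (@continuous_comp _ _ _ f (fun z : invlim t => set_val z i)); first exact: fc.
  exact: invlim_proj_continuous.
pose m : set RA := [set a | exists2 z, n z & t i j ij z = phi i a].
have nD := let: And3 _ D _ := sn in D.
have nM := let: And3 _ _ M := sn in M.
have sm : submodule m.
  split; first by exists 0; rewrite ?t0 ?f0.
  - move=> a b [u nu ua] [v nv vb]; exists (u + v); first exact: nD.
    by rewrite tD ua vb; exact/esym/fD.
  - move=> a b [u nu ub]; exists (phi j a * u); first exact: nM.
    by rewrite tM tphi ub; exact/esym/fM.
have my : ~ m y.
  move=> [z nz zy]; apply: ny.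
  rewrite -[phi j y](subrK z); apply: nD => //; apply: Kn => /=.
  by rewrite tD tN zy tphi subrr.
have kerm a : phi i a = 0 -> m a by move=> a0; exists 0; rewrite ?t0 ?a0.
exists m => //; split=> //.
- have /continuousP/(_ [set b | exists2 z, n z & t i j ij z = b]) := phic.
  by apply; exact: (dX i).1.
- by move=> mT; apply: my; rewrite mT.
move=> Z sZ mZ; case: (sZ) => Z0 ZD ZM.
pose Z' : set Xj := [set z | exists2 a, Z a & t i j ij z = phi i a].
have sZ' : submodule Z'.
  split; first by exists 0; rewrite ?t0 ?f0.
  - move=> u v [a Za ua] [b Zb vb]; exists (a + b); first exact: ZD.
    by rewrite tD ua vb; exact/esym/fD.
  - move=> u v [b Zb vb]; have [a ua] := tj u.
    exists (a * b : RA); first exact: ZM.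
    by rewrite tM ua vb; exact/esym/fM.
have nZ' : n `<=` Z'.
  by move=> z nz; have [a za] := tj z; exists a => //; apply: mZ; exists z.
have [Zn|ZT] := maxn' Z' sZ' nZ'; [left|right].
  apply/seteqP; split=> // a Za; exists (phi j a); last exact: tphi.
  by rewrite -Zn; exists a => //; exact: tphi.
apply/seteqP; split=> // x _.
have [a Za xa] : Z' (phi j x) by rewrite ZT.
rewrite -(subrK a x); apply: ZD => //; apply: mZ; apply: kerm.
have -> : phi i (x - a) = phi i x - phi i a by rewrite -fN; exact: fD.
by rewrite -xa tphi subrr.
Qed.

End SemisimpleLimits.

(** * The simple quotients *)

Section Wedderburn.
Variables (k : fieldType) (A : topAlgType k).
Local Notation RA := (regmod A).
Variable m : set RA.
Hypotheses (mm : max_open m).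
Let sm : submodule m. Proof. by case: mm. Qed.
Let m_max Z : submodule Z -> m `<=` Z -> (exists2 z, Z z & ~ m z) -> Z = setT.
Proof.
by case: mm => _ _ _ mx sZ mZ [z Zz mz]; have [E|] := mx Z sZ mZ; first by rewrite E in Zz.
Qed.

Lemma fincodim_coordinates : fincodim m ->
  exists (d : nat) (kappa : RA -> 'rV[k]_d),
    [/\ klinear kappa, forall x, m x <-> kappa x = 0 &
        forall v, exists x, kappa x = v].
Proof.
move=> [V [f [fl fU]]].
have [|X XP Xsurj] := klinear_image fl fU (@submodT _ _ RA).
  by [].
have fX x : f x \in X by apply/XP.
pose kappa (x : RA) : 'rV[k]_(\dim X) := \row_i coord (vbasis X) i (f x).
exists (\dim X), kappa; split.
- case: fl => fD fZ; split=> [x y|c x]; apply/rowP => i; rewrite !mxE.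
    by rewrite fD linearD.
  by rewrite fZ linearZ.
- move=> x; rewrite fU; split=> [fx|/rowP kx].
    by apply/rowP => i; rewrite !mxE fx linear0.
  rewrite (coord_vbasis (fX x)); apply: big1 => i _.
  by have := kx i; rewrite !mxE => ->; rewrite scale0r.
- move=> v; have [|x fx] := Xsurj (\sum_i v 0 i *: (vbasis X)`_i).
    apply: memv_suml => i _; apply: memvZ; apply: vbasis_mem.
    by rewrite mem_nth // size_tuple.
  exists x; apply/rowP => i; rewrite mxE fx coord_sum_free //.
  exact: basis_free (vbasisP X).
Qed.

Section Coordinates.
Variables (d' : nat).
Local Notation d := d'.+1.
Variable kappa : RA -> 'rV[k]_d.
Hypotheses (kl : klinear kappa) (km : forall x, m x <-> kappa x = 0)
  (ks : forall v, exists x, kappa x = v).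

Let kD x y : kappa (x + y) = kappa x + kappa y. Proof. by case: kl. Qed.
Let kZ c (x : A) : kappa (kmap c * x) = c *: kappa x.
Proof. by case: kl => _ kZ; exact: kZ. Qed.

(** The action of A on the simple module A / m, identified with row vectors: as
    matrices act on the right, it reverses products. *)
Lemma row_action : exists rho : A -> 'M[k]_d,
  forall a b : A, kappa (a * b) = kappa b *m rho a.
Proof.
have /choice [s sP] := ks.
exists (fun a => \matrix_i kappa (a * s (delta_mx 0 i) : A)) => a b.
rewrite mulmx_sum_row.
pose e i : RA := s (delta_mx 0 i).
have mb : m ((b : RA) - \sum_i (kmap (kappa b 0 i) : A) *: e i).
  apply/km; rewrite klinearB // klinear_sum // [X in X - _]row_sum_delta.
  by apply/eqP; rewrite subr_eq0; apply/eqP/eq_bigr => i _; rewrite sP.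
have /km : m (a *: ((b : RA) - \sum_i (kmap (kappa b 0 i) : A) *: e i)).
  by case: sm => _ _; apply.
rewrite scalerBr klinearB // => /eqP; rewrite subr_eq0 => /eqP E.
rewrite -[LHS]/(kappa ((a : A) *: (b : RA))) E scaler_sumr.
have -> : \sum_i a *: ((kmap (kappa b 0 i) : A) *: e i) =
          \sum_i (kmap (kappa b 0 i) : A) *: (a *: e i).
  by apply: eq_bigr => i _; rewrite !scalerA kmap_central.
rewrite klinear_sum //; apply: eq_bigr => i _.
by rewrite rowK.
Qed.

Variable rho : A -> 'M[k]_d.
Hypothesis rhoP : forall a b : A, kappa (a * b) = kappa b *m rho a.

Let row_ext (M N : 'M[k]_d) : (forall u : 'rV_d, u *m M = u *m N) -> M = N.
Proof. by move=> MN; apply/row_matrixP => i; rewrite !rowE MN. Qed.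

Let rho_ext (M N : 'M[k]_d) : (forall x, kappa x *m M = kappa x *m N) -> M = N.
Proof. by move=> MN; apply: row_ext => u; have [x <-] := ks u. Qed.

Lemma rhoD a b : rho (a + b) = rho a + rho b.
Proof. by apply: rho_ext => x; rewrite mulmxDr -!rhoP mulrDl -kD. Qed.

Lemma rhoM a b : rho (a * b) = rho b *m rho a.
Proof. by apply: rho_ext => x; rewrite mulmxA -!rhoP mulrA. Qed.

Lemma rhoZ c : rho (kmap c) = c%:M.
Proof. by apply: rho_ext => x; rewrite -rhoP kZ mul_mx_scalar. Qed.

Lemma rho1 : rho 1 = 1%:M.
Proof. by rewrite -rhoZ kmap1. Qed.

Lemma rho0 : rho 0 = 0.
Proof. by apply: (addrI (rho 0)); rewrite -rhoD !addr0. Qed.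

Lemma rhoB a b : rho (a - b) = rho a - rho b.
Proof. by apply/eqP; rewrite -subr_eq0 opprB addrA -rhoD subrK subrr. Qed.

(** Matrices act on row vectors from the right and so does the commutant D: the simple
    module becomes a right D-space, and A maps to matrices over D itself rather than
    over the opposite algebra. *)
Definition commutes (T : 'M[k]_d) : Prop := forall a, rho a *m T = T *m rho a.

Lemma commutant_aspace :
  exists U : {aspace 'M[k]_d}, forall T, T \in U <-> commutes T.
Proof.
have [|||U UP] := @vspace_of_pred k 'M[k]_d commutes.
- by move=> a; rewrite mulmx0 mul0mx.
- by move=> S T cS cT a; rewrite mulmxDr mulmxDl cS cT.
- by move=> c T cT a; rewrite -scalemxAr -scalemxAl cT.
have aU : is_aspace U.
  rewrite /is_aspace has_algid1 /=; last first.
    by apply/UP => a; rewrite mulmx1 mul1mx.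
  apply/prodvP => S T /UP cS /UP cT; apply/UP => a.
  by rewrite mulmxA cS -mulmxA cT mulmxA.
by exists (ASpace aU) => T; exact: UP.
Qed.

Variable U : {aspace 'M[k]_d}.
Hypothesis UP : forall T, T \in U <-> commutes T.
Local Notation D := (subvs_of U).

Let cD (T : D) : commutes (vsval T). Proof. by apply/UP; exact: subvsP. Qed.

Let vsval1 : vsval (1 : D) = 1%:M.
Proof.
apply/eqP; rewrite -[vsval 1]/(algid U) algid_eq1; apply/UP => a.
by rewrite mulmx1 mul1mx.
Qed.

Let vsval0 : vsval (0 : D) = 0.
Proof. exact: linear0. Qed.

Let vsvalA c : vsval (c%:A : D) = c%:M.
Proof. by rewrite -[LHS]/(c *: vsval (1 : D)) vsval1; exact: scalemx1. Qed.

(** Schur's lemma: the kernel of a matrix commuting with A is a submodule. *)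
Lemma commutant_division : division_alg D.
Proof.
move=> T T0; apply: vsval_unitr.
have sL : submodule [set x : RA | kappa x *m vsval T = 0].
  split=> [|x y|a x] /=.
  - by rewrite klinear0 // mul0mx.
  - by move=> x0 y0; rewrite kD mulmxDl x0 y0 addr0.
  - by move=> x0; rewrite [kappa _]rhoP -mulmxA cD mulmxA x0 mul0mx.
have mL : m `<=` [set x : RA | kappa x *m vsval T = 0].
  by move=> x /km kx; rewrite /= kx mul0mx.
have inj (u : 'rV_d) : u *m vsval T = 0 -> u = 0.
  have [x <-] := ks u; move=> xT; apply: contrapT => kx; case/eqP: T0.
  apply: val_inj; apply: rho_ext => y; rewrite mulmx0.
  have LT := m_max sL mL; rewrite -[LHS]/(kappa y *m vsval T).
  suff : [set x : RA | kappa x *m vsval T = 0] y by [].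
  by rewrite LT //; exists x => //; apply/km.
rewrite -[_ \is a _]/(vsval T \in unitmx) -row_free_unit -kermx_eq0.
apply/eqP/row_matrixP => i; rewrite row0; apply: inj.
by apply/sub_kermxP; exact: row_sub.
Qed.

(** A maximal tuple of this kind will be a basis of the simple module over its
    endomorphism algebra D.  That A moves a basis to arbitrary vectors is the density
    theorem, here built into the choice of the basis. *)
Definition free_orbit n (v : 'I_n -> 'rV[k]_d) : Prop :=
  forall w : 'I_n -> 'rV[k]_d, exists a, forall j, v j *m rho a = w j.

(** Such vectors are linearly independent over k. *)
Lemma free_orbit_bound n (v : 'I_n -> 'rV[k]_d) : free_orbit v -> (n <= d)%N.
Proof.
move=> fv; suff /eqP <- : row_free (\matrix_i v i) by exact: rank_leq_col.
rewrite -kermx_eq0; apply/eqP/row_matrixP => i; rewrite row0.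
have : row i (kermx (\matrix_i v i)) *m (\matrix_i v i) = 0.
  by apply/sub_kermxP; exact: row_sub.
move: (row _ _) => u uv; apply/rowP => j; rewrite mxE.
have [a av] := fv (fun l => (l == j)%:R *: delta_mx 0 0).
have := congr1 (fun z => z *m rho a) uv; rewrite mul0mx (mulmx_sum_row u) mulmx_suml.
rewrite (bigD1 j) //= big1 => [|l /negPf lj]; last first.
  by rewrite rowK -scalemxAl av lj scale0r scaler0.
rewrite rowK -scalemxAl av eqxx scale1r addr0 => /rowP/(_ 0).
by rewrite !mxE !eqxx mulr1.
Qed.

Lemma free_orbit_max : exists n (v : 'I_n -> 'rV[k]_d), free_orbit v /\
  forall n' (v' : 'I_n' -> 'rV[k]_d), free_orbit v' -> (n' <= n)%N.
Proof.
pose P n := `[< exists v : 'I_n -> 'rV[k]_d, free_orbit v >].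
have exP : exists n, P n.
  by exists 0%N; apply/asboolP; exists (fun=> 0) => w; exists 0 => -[].
have bP n : P n -> (n <= d)%N by move=> /asboolP [v /free_orbit_bound].
have [n /asboolP [v fv] maxn] := ex_maxnP exP bP.
by exists n, v; split=> // n' v' fv'; apply: maxn; apply/asboolP; exists v'.
Qed.

Variables (n : nat) (v : 'I_n -> 'rV[k]_d).
Hypotheses (fv : free_orbit v)
  (maxv : forall n' (v' : 'I_n' -> 'rV[k]_d), free_orbit v' -> (n' <= n)%N).

Definition combine (T : 'I_n -> D) : 'rV[k]_d := \sum_i v i *m vsval (T i).

Lemma combine_inj T T' : combine T = combine T' -> T =1 T'.
Proof.
move=> TT' i; apply: val_inj; apply: row_ext => u /=.
have [a av] := fv (fun l => (l == i)%:R *: u).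
have E S : combine S *m rho a = u *m vsval (S i).
  rewrite mulmx_suml (bigD1 i) //= big1 => [|l /negPf li].
    by rewrite addr0 -mulmxA -cD mulmxA av eqxx scale1r.
  by rewrite -mulmxA -cD mulmxA av li scale0r mul0mx.
by rewrite -!E TT'.
Qed.

(** If the annihilator of v moved u, it would move u everywhere by simplicity,
    and v could be extended by u. *)
Lemma annihilator_kills (u : 'rV[k]_d) a :
  (forall j, v j *m rho a = 0) -> u *m rho a = 0.
Proof.
move=> va; apply: contrapT => ua.
pose L : set RA := [set b | exists2 c, (forall j, v j *m rho c = 0) & kappa b = u *m rho c].
have LT : L = setT.
  apply: m_max.
  - split.
    + by exists 0 => [j|]; rewrite rho0 mulmx0 // klinear0.
    + move=> b b' [c vc bc] [c' vc' bc']; exists (c + c') => [j|].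
        by rewrite rhoD mulmxDr vc vc' addr0.
      by rewrite kD rhoD mulmxDr bc bc'.
    + move=> x b [c vc bc]; exists (x * c) => [j|].
        by rewrite rhoM mulmxA vc mul0mx.
      by rewrite [kappa _]rhoP rhoM mulmxA bc.
  - by move=> b /km kb; exists 0 => [j|]; rewrite rho0 mulmx0.
  - have [b kb] := ks (u *m rho a).
    by exists b; [exists a | move=> /km; rewrite kb].
pose v' (j : 'I_n.+1) := if unlift ord_max j is Some i then v i else u.
suff /maxv : free_orbit v' by rewrite ltnn.
move=> w; have [b bv] := fv (fun i => w (lift ord_max i)).
have [x kx] := ks (w ord_max - u *m rho b).
have [c vc xc] : L x by rewrite LT.
exists (b + c) => j; rewrite /v'; case: unliftP => [i ->|->].
  by rewrite rhoD mulmxDr bv vc addr0.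
by rewrite rhoD mulmxDr -xc kx addrC subrK.
Qed.

(** T_i sends a vector w to u a, where a moves v_i to w and kills the other v_j; by the
    previous lemma this does not depend on a, and it commutes with the action of A. *)
Lemma combine_surj (u : 'rV[k]_d) : exists T, u = combine T.
Proof.
have /choice [e' e'P] : forall ir : 'I_n * 'I_d, exists a, forall j,
    v j *m rho a = (j == ir.1)%:R *: delta_mx 0 ir.2 by move=> ir; exact: fv.
pose e i r := e' (i, r).
have eP i r j : v j *m rho (e i r) = (j == i)%:R *: delta_mx 0 r by exact: e'P.
pose T i : 'M[k]_d := \matrix_r (u *m rho (e i r)).
have uE a (w : 'I_n -> 'rV[k]_d) : (forall j, v j *m rho a = w j) ->
    u *m rho a = \sum_i w i *m T i.
  move=> av; pose b := \sum_i \sum_r kmap (w i 0 r) * e i r.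
  have rb (x : 'rV_d) : x *m rho b = \sum_i \sum_r w i 0 r *: (x *m rho (e i r)).
    rewrite /b (big_morph rho rhoD rho0) mulmx_sumr; apply: eq_bigr => i _.
    rewrite (big_morph rho rhoD rho0) mulmx_sumr; apply: eq_bigr => r _.
    by rewrite rhoM rhoZ mul_mx_scalar scalemxAr.
  have vb j : v j *m rho b = w j.
    rewrite rb (bigD1 j) //= [X in _ + X]big1 ?addr0.
      rewrite [RHS]row_sum_delta; apply: eq_bigr => r _.
      by rewrite eP eqxx scale1r.
    move=> i /negPf ij; apply: big1 => r _.
    by rewrite eP eq_sym ij scale0r scaler0.
  have -> : u *m rho a = u *m rho b.
    apply/eqP; rewrite -subr_eq0 -mulmxBr -rhoB; apply/eqP/annihilator_kills => j.
    by rewrite rhoB mulmxBr av vb subrr.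
  rewrite rb; apply: eq_bigr => i _; rewrite mulmx_sum_row; apply: eq_bigr => r _.
  by rewrite rowK.
have TU i : T i \in U.
  apply/UP => a; apply/row_matrixP => r.
  rewrite !row_mul rowK -mulmxA -rhoM.
  rewrite (uE _ (fun j => (j == i)%:R *: (delta_mx 0 r *m rho a))).
    rewrite (bigD1 i) //= big1 => [|j /negPf ji]; last by rewrite ji scale0r mul0mx.
    by rewrite eqxx scale1r addr0 -rowE.
  by move=> j; rewrite rhoM mulmxA eP -scalemxAl.
exists (fun i => vsproj U (T i)); rewrite -[u]mulmx1 -rho1 (uE _ v).
  by apply: eq_bigr => i _; rewrite vsprojK.
by move=> j; rewrite rho1 mulmx1.
Qed.

(** The (i, j) entry of the matrix of a is the v_i-coordinate of a v_j over D. *)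
Lemma simple_quotient_in_coordinates :
  (0 < n)%N /\ exists theta : A -> matalg D n,
    [/\ alg_hom theta, forall X, exists a, theta a = X &
        forall a, theta a = 0 <-> ideal_core m a].
Proof.
split.
  have [T uT] := combine_surj (delta_mx 0 0).
  rewrite lt0n; apply/eqP => n0.
  move: uT; rewrite /combine big1; last first.
    by move=> i _; have := ltn_ord i; rewrite [X in (_ < X)%N]n0.
  by move=> /rowP/(_ 0)/eqP; rewrite !mxE !eqxx oner_eq0.
have /choice [th thP] : forall a, exists X : 'M[D]_n,
    forall j, v j *m rho a = combine (X^~ j).
  move=> a; have /choice [T TP] j := combine_surj (v j *m rho a).
  exists (\matrix_(i, j) T j i) => j; rewrite TP; congr combine.
  by apply/funext => i; rewrite mxE.
have th_eq a (X : 'M[D]_n) : (forall j, v j *m rho a = combine (X^~ j)) -> th a = X.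
  move=> aX; apply/matrixP => i j.
  by apply: (@combine_inj (fun i => th a i j) (X^~ j)); rewrite -thP aX.
exists th; split; first split.
- move=> a b; apply: th_eq => j; rewrite rhoD mulmxDr !thP /combine -big_split /=.
  by apply: eq_bigr => i _; rewrite mxE -mulmxDr.
- move=> a b; apply: th_eq => j; rewrite rhoM mulmxA thP /combine mulmx_suml.
  under eq_bigr => l _ do rewrite -mulmxA -cD mulmxA thP /combine mulmx_suml.
  rewrite exchange_big /=; apply: eq_bigr => i _.
  rewrite mxE raddf_sum mulmx_sumr; apply: eq_bigr => l _.
  by rewrite -mulmxA.
- apply: th_eq => j; rewrite rho1 mulmx1 /combine (bigD1 j) //= big1 => [|i /negPf ij].
    by rewrite addr0 mxE eqxx mulr1n vsval1 mulmx1.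
  by rewrite mxE ij mulr0n vsval0 mulmx0.
- move=> c; apply: th_eq => j; rewrite rhoZ mul_mx_scalar /combine (bigD1 j) //= big1 => [|i /negPf ij].
    by rewrite addr0 mxE eqxx mulr1n [vsval _]vsvalA mul_mx_scalar.
  by rewrite mxE ij mulr0n vsval0 mulmx0.
- move=> X; have [a aX] := fv (fun j => combine (X^~ j)).
  by exists a; exact: th_eq.
- move=> a; split=> [a0 b|ca].
    have va j : v j *m rho a = 0.
      rewrite thP a0 /combine big1 // => i _.
      by rewrite mxE vsval0 mulmx0.
    by apply/km; rewrite rhoP annihilator_kills.
  apply: th_eq => j; rewrite /combine big1 => [|i _]; last by rewrite mxE vsval0 mulmx0.
  by have [x <-] := ks (v j); rewrite -rhoP; apply/km; exact: ca.
Qed.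

End Coordinates.

(** The theorem of Wedderburn and Artin for the quotient by the annihilator of a simple
    module. *)
Theorem simple_quotient : fincodim m ->
  exists (n : nat) (D : falgType k) (theta : A -> matalg D n),
    [/\ (0 < n)%N, division_alg D, alg_hom theta,
        forall X, exists a, theta a = X &
        forall a, theta a = 0 <-> ideal_core m a].
Proof.
move=> /fincodim_coordinates [[|d'] [kappa [kl km ks]]].
  case: mm => _ _ mT _; case: mT; apply/seteqP; split=> // x _.
  by apply/km; apply/rowP => -[].
have [rho rhoP] := row_action kl km ks.
have [U UP] := commutant_aspace rho.
have [n [v [fv maxv]]] := free_orbit_max rho.
have [n0 [theta [th ths thk]]] :=
  simple_quotient_in_coordinates kl km ks rhoP UP fv maxv.
exists n, (subvs_of U), theta; split=> //.
exact: (commutant_division kl km ks rhoP UP).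
Qed.

End Wedderburn.

(** * Products of matrix algebras *)

Lemma delta_mul_delta (R : pzRingType) m n (X : 'M[R]_(m, n)) m' n'
    (r : 'I_m') p q (s : 'I_n') :
  delta_mx r p *m X *m delta_mx q s = X p q *: delta_mx r s.
Proof.
apply/matrixP => i j; rewrite !mxE (bigD1 q) //= big1 => [|l /negPf lq]; last first.
  by rewrite !mxE lq /= mulr0.
rewrite addr0 !mxE (bigD1 p) //= big1 => [|l /negPf lp]; last first.
  by rewrite !mxE lp andbF mul0r.
rewrite addr0 !mxE !eqxx andbT /=.
by case: (i == r); case: (j == s); rewrite ?mul0r ?mulr0 ?mul1r ?mulr1 //= ?mul0r.
Qed.

Lemma matalg_discrete (k : fieldType) (D : falgType k) n : discrete (matalg D n).
Proof. by move=> U; rewrite openE => x Ux; apply/principal_filterP. Qed.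

Section MatrixAlgebras.
Variables (k : fieldType) (D : falgType k) (n : nat).
Hypothesis divD : division_alg D.

Lemma matalg_simple (Q : matalg D n -> Prop) (X : matalg D n) :
  Q 0 -> (forall x y, Q x -> Q y -> Q (x + y)) ->
  (forall a x b, Q x -> Q (a * x * b)) ->
  Q X -> X != 0 -> Q 1.
Proof.
move=> Q0 QD QM QX X0.
have [p [q Xpq]] : exists p q, (X : 'M[D]_n) p q != 0.
  apply: contrapT => nX; case/eqP: X0; apply/matrixP => p q; rewrite mxE.
  by apply: contrapT => Xpq; apply: nX; exists p, q; apply/eqP.
pose B r : 'M[D]_n := ((X : 'M[D]_n) p q)^-1 *: delta_mx r p.
have E r : B r *m (X : 'M[D]_n) *m delta_mx q r = delta_mx r r.
  by rewrite -!scalemxAl delta_mul_delta scalerA mulVr ?divD // scale1r.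
have -> : (1 : matalg D n) =
    \sum_r (B r : matalg D n) * X * (delta_mx q r : matalg D n).
  rewrite [LHS](mx1_sum_delta D n); apply: eq_bigr => r _.
  exact/esym/E.
by apply: (big_ind Q) => // r _; exact: QM.
Qed.

(** This makes the matrices with vanishing q-th column a maximal left ideal. *)
Lemma column_generates (q : 'I_n) (X Y : matalg D n) :
  (exists p, (X : 'M[D]_n) p q != 0) ->
  exists B : matalg D n, forall r, ((B * X : matalg D n) : 'M[D]_n) r q = (Y : 'M[D]_n) r q.
Proof.
move=> [p Xpq].
pose B : 'M[D]_n := \matrix_(i, j) (if j == p then (Y : 'M[D]_n) i q * ((X : 'M[D]_n) p q)^-1 else 0).
exists B => r; rewrite mxE (bigD1 p) //= big1 => [|l /negPf lp]; last first.
  by rewrite !mxE lp mul0r.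
by rewrite !mxE eqxx addr0 -mulrA mulVr ?divD // mulr1.
Qed.

End MatrixAlgebras.

Section FromMatrices.
Variables (k : fieldType) (A : topAlgType k).
Local Notation RA := (regmod A).
Variables (I : Type) (n : I -> nat) (D : I -> falgType k).
Hypothesis divD : forall i, division_alg (D i).
Variable phi : A -> matalg_product n D.
Hypotheses (phih : alg_hom phi) (phiH : homeomorphism phi).
Local Notation index := {i : I & 'I_(n i)}.

Let entry (a : A) (i : I) : 'M[D i]_(n i) := phi a i.

Let entryD a b i : entry (a + b) i = entry a i + entry b i.
Proof. by rewrite /entry; case: phih => -> _ _ _. Qed.
Let entryM a b i : entry (a * b) i = entry a i *m entry b i.
Proof. by rewrite /entry; case: phih => _ -> _ _. Qed.
Let entry0 i : entry 0 i = 0.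
Proof. by apply: (addrI (entry 0 i)); rewrite -entryD !addr0. Qed.
Let entryB a b i : entry (a - b) i = entry a i - entry b i.
Proof. by apply/eqP; rewrite -subr_eq0 opprB addrA -entryD subrK subrr. Qed.

Let entry_inj a b : (forall i, entry a i = entry b i) -> a = b.
Proof.
move=> ab; case: phiH => _ [g [gK _ _]]; apply: (can_inj gK).
by apply/functional_extensionality_dep => i; exact: ab.
Qed.

Let entry_surj (X : forall i, 'M[D i]_(n i)) : exists a, forall i, entry a i = X i.
Proof.
by case: phiH => _ [g [_ gK _]]; exists (g X) => i; rewrite /entry gK.
Qed.

Let entry_continuous i : continuous (fun a => entry a i : matalg (D i) (n i)).
Proof.
move=> a; apply: (@continuous_comp _ _ _ phi (fun z : matalg_product n D => z i)).
  by case: phiH => c _; exact: c.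
exact: prod_topology_proj_continuous.
Qed.

Definition column_ideal (iq : index) : set RA :=
  [set a | forall r, entry a (projT1 iq) r (projT2 iq) = 0].

Lemma column_ideal_max iq : max_open (column_ideal iq).
Proof.
case: iq => i q.
have sW : submodule (column_ideal (existT _ i q)).
  split=> [r|x y x0 y0 r|a x x0 r] /=.
  - by rewrite entry0 mxE.
  - by rewrite entryD mxE x0 y0 addr0.
  - by rewrite [entry _ i]entryM mxE big1 // => l _; rewrite x0 mulr0.
split=> //.
- have /continuousP/(_ [set X : matalg (D i) (n i) | forall r, (X : 'M[D i]_(n i)) r q = 0]) := @entry_continuous i.
  by apply; exact: matalg_discrete.
- move=> WT; have : column_ideal (existT _ i q) 1 by rewrite WT.
  move=> /(_ q) /=; rewrite /entry; case: phih => _ _ -> _.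
  by rewrite mxE eqxx => /eqP; rewrite oner_eq0.
move=> Z sZ WZ; have [ZW|ZW] := pselect (Z `<=` column_ideal (existT _ i q)).
  by left; apply/seteqP.
right; apply/seteqP; split=> // x _.
have [z Zz [p zp]] : exists2 z, Z z & exists p, entry z i p q != 0.
  apply: contrapT => nz; apply: ZW => z Zz r /=; apply: contrapT => zr.
  by apply: nz; exists z => //; exists r; apply/eqP.
have [B BP] := @column_generates _ _ _ (@divD i) q (entry z i) (entry x i)
  (ex_intro _ p zp).
have [b bB] : exists b, entry b i = B.
  have [b bP] := entry_surj (fun j => match pselect (i = j) with
    | left e => eq_rect i (fun j => 'M[D j]_(n j)) B j e | right _ => 0 end).
  exists b; rewrite bP; case: pselect => // e.
  by rewrite (Prop_irrelevance e erefl).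
case: (sZ) => _ ZD ZM; rewrite -(subrK (b * (z : A) : RA) x); apply: ZD; last exact: ZM.
apply: WZ => r /=; rewrite [entry _ i]entryB mxE entryM bB.
by rewrite !mxE -BP !mxE subrr.
Qed.

Lemma matrices_residually_simple : residually_simple RA.
Proof.
move=> y y0.
have [iq yiq] : exists iq, ~ column_ideal iq y.
  apply: contrapT => ny; case/eqP: y0; apply: entry_inj => i.
  apply/matrixP => r q; rewrite entry0 mxE; apply: contrapT => yrq.
  by apply: ny; exists (existT _ i q) => /(_ r).
by exists (column_ideal iq) => //; exact: column_ideal_max.
Qed.

(** The columns of all factors: a matrix can be prescribed column by column. *)
Lemma matrices_product_of_simples : pc_mod RA ->
  exists (J : Type) (S : J -> topModType A),
    (forall i, simple_mod (S i)) /\ topmod_iso RA (prod_topology S).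
Proof.
move=> pcA.
pose W (iq : index) : open_submod RA :=
  let: And4 s o _ _ := column_ideal_max iq in OpenSubmod s o.
have WE iq x : W iq x <-> column_ideal iq x.
  by rewrite /W; case: (column_ideal_max iq).
pose S iq : topModType A := modquot (W iq).
have clsl iq : linear (mcls (W iq) : RA -> S iq) by exact: mcls_linear.
exists index, S; split=> [iq|].
  have [sW oW WT maxW] := column_ideal_max iq.
  split; first exact: modquot_pseudocompact.
    exists (mcls (W iq) 1); apply/eqP => /mcls_eq0/WE W1.
    apply: WT; apply/seteqP; split=> // x _; rewrite -(mulr1 x).
    by case: sW => _ _; apply.
  move=> N sN _.
  have sZ := submod_preimage (clsl iq) sN.
  have [|ZW|ZT] := maxW _ sZ; [|left|right].
  - move=> x /WE/mcls_eq0 Wx; rewrite /preimage /=.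
    by rewrite [X in N X]Wx; case: sN.
  - apply/seteqP; split=> [p Np|_ ->]; last by case: sN.
    rewrite -[p]mrepK; apply/mcls_eq0/WE; rewrite -ZW /preimage /=.
    by rewrite mrepK.
  - apply/seteqP; split=> // p _.
    suff : (mcls (W iq) @^-1` N) (mrep p) by rewrite /preimage /= mrepK.
    by rewrite ZT.
pose psi (a : RA) : prod_topology S := fun iq => mcls (W iq) a.
have psil : linear psi.
  by move=> a x y; apply/functional_extensionality_dep => iq; exact: clsl.
have psic : continuous psi.
  by apply: prod_topology_continuous => iq; exact: mcls_continuous.
have psiI : injective psi.
  move=> a b ab; apply: entry_inj => i; apply/matrixP => r q.
  have /WE/(_ r) /= : W (existT _ i q) (a - b).
    by apply/mcls_eqP; have := congr1 (fun z => z (existT _ i q)) ab.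
  by rewrite [entry _ i]entryB !mxE => /eqP; rewrite subr_eq0 => /eqP.
have psiS z : exists a, psi a = z.
  have [a aP] := entry_surj (fun i =>
    \matrix_(r, q) entry (mrep (z (existT _ i q))) i r q).
  exists a; apply/functional_extensionality_dep => -[i q].
  rewrite -[z _]mrepK; apply/mcls_eqP/WE => r /=.
  by rewrite [entry _ i]entryB aP !mxE subrr.
have [g gP] := choice psiS.
have gK : cancel psi g by move=> a; apply: psiI.
exists psi => //; split=> //; exists g; split=> //.
have pcS : pc_mod (prod_topology S).
  apply: prod_pc => iq; first exact: modquot_discrete.
  exact: modquot_findim.
apply: closed_graph_continuous => //.
  move=> a x y; apply: psiI.
  by rewrite gP psil !gP.
move=> z a gr; apply: psiI; rewrite gP; apply: (pc_eq pcS) => V sV oV.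
have [w [/= wz wa]] := gr _ _ (nbhs_submod z sV oV) (psic a _ (nbhs_submod (psi a) sV oV)).
move: wa; rewrite gP => wa.
by apply: (submod_trans (y := w)) => //; exact: submodBC.
Qed.

End FromMatrices.

Section ToMatrices.
Variables (k : fieldType) (A : topAlgType k).
Local Notation RA := (regmod A).
Hypotheses (pcA : pc_mod RA) (rsA : residually_simple RA).

(** A representation on a simple module, as provided by simple_quotient. *)
Record simple_rep (P : set A) := SimpleRep {
  sr_n : nat;
  sr_D : falgType k;
  sr_map : A -> matalg sr_D sr_n;
  sr_n0 : (0 < sr_n)%N;
  sr_div : division_alg sr_D;
  sr_hom : alg_hom sr_map;
  sr_surj : forall X, exists a, sr_map a = X;
  sr_ker : forall a, sr_map a = 0 <-> P a }.

Arguments sr_surj {P} s X.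
Arguments sr_ker {P} s a.

Definition primitive (P : set A) : Prop :=
  exists2 m : set RA, max_open m & P = ideal_core m.

Lemma primitive_rep P : primitive P -> exists r : simple_rep P, True.
Proof.
move=> [m mm ->]; case: (mm) => sm om _ _.
have [n [D [th [n0 divD thh ths thk]]]] :=
  simple_quotient mm (pc_open_fincodim pcA sm om).
by exists (SimpleRep n0 divD thh ths thk).
Qed.

Let index := {P : set A | primitive P}.
Let r (i : index) : simple_rep (sval i) := projT1 (cid (primitive_rep (svalP i))).
Let th i := sr_map (r i).

Let thD i x y : th i (x + y) = th i x + th i y.
Proof. by rewrite /th; case: (sr_hom (r i)). Qed.
Let thM i x y : th i (x * y) = th i x * th i y.
Proof. by rewrite /th; case: (sr_hom (r i)). Qed.
Let th1 i : th i 1 = 1.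
Proof. by rewrite /th; case: (sr_hom (r i)). Qed.
Let primitive_ideal (i : index) : open_ideal (sval i).
Proof.
have [m [sm om _ _] ->] := svalP i; exact: ideal_core_open.
Qed.

Let index_eq (i j : index) : sval i = sval j -> i = j.
Proof. by case: i j => P pP [Q pQ] /= PQ; exact: eq_exist. Qed.

Let th0 i : th i 0 = 0.
Proof. by apply: (addrI (th i 0)); rewrite -thD !addr0. Qed.
Let th_ker i x : th i x = 0 <-> sval i x.
Proof. exact: (sr_ker (r i)). Qed.
Let thN i x : th i (- x) = - th i x.
Proof. by apply/esym/addr0_eq; rewrite -thD subrr th0. Qed.
Let thB i x y : th i (x - y) = th i x - th i y.
Proof. by rewrite thD thN. Qed.

(** A two-sided ideal not contained in the kernel of the surjection th i maps
    onto the simple algebra M_n(D). *)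
Lemma not_sub_comaximal (i : index) (Q : set A) : open_ideal Q -> ~ Q `<=` sval i ->
  exists2 q, Q q & th i q = 1.
Proof.
move=> [[Q0 QD QM] QR _] Qi.
have [q Qq qi] : exists2 q, Q q & ~ sval i q.
  by apply: contrapT => nq; apply: Qi => q Qq; apply: contrapT => qi; apply: nq; exists q.
have [|||||q' Qq' q'1] := @matalg_simple _ _ _ (@sr_div _ (r i))
  (fun X => exists2 q, Q q & th i q = X) (th i q).
- by exists 0.
- by move=> _ _ [x Qx <-] [y Qy <-]; exists (x + y); [exact: QD | exact: thD].
- move=> a _ b [x Qx <-].
  have [a' <-] := sr_surj (r i) a; have [b' <-] := sr_surj (r i) b.
  by exists (a' * x * b'); [apply: QR; exact: QM | rewrite !thM].
- by exists q.
- by apply/eqP => /(sr_ker (r i)).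
by exists q'.
Qed.

(** One of the two kernels is not contained in the other; if that is the kernel of
    th i, replace an element q of it with th j q = 1 by 1 - q. *)
Lemma comaximal (i j : index) : i <> j -> exists2 q, sval j q & th i q = 1.
Proof.
move=> ij.
have [ji|] := pselect (sval j `<=` sval i); last exact: not_sub_comaximal.
have [|q iq jq] := @not_sub_comaximal j (sval i) (primitive_ideal i).
  by move=> ij'; apply: ij; apply: index_eq; apply/seteqP.
exists (1 - q); first by apply/th_ker; rewrite thB th1 jq subrr.
by rewrite thB th1 (th_ker i q).2 // subr0.
Qed.

Lemma chinese_unit (i : index) (s : seq index) : ~ List.In i s ->
  exists b, th i b = 1 /\ forall j, List.In j s -> sval j b.
Proof.
elim: s => [_|j s IH ijs]; first by exists 1; split.
have [|b [ib sb]] := IH; first by move=> is_; apply: ijs; right.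
have [|q jq iq] := @comaximal i j; first by move=> ij; apply: ijs; left.
exists (q * b); split=> [|l]; first by rewrite thM iq ib mulr1.
have [[_ _ lM] _ _] := primitive_ideal l.
move=> [<-|/sb lb]; last exact: lM.
by have [_ jR _] := primitive_ideal j; exact: jR.
Qed.

Lemma chinese_remainder (T : forall i, matalg (sr_D (r i)) (sr_n (r i)))
    (s : seq index) : exists a, forall i, List.In i s -> th i a = T i.
Proof.
elim: s => [|i s [a aT]]; first by exists 0.
have [is_|nis] := pselect (List.In i s).
  by exists a => j [<-|]; exact: aT.
have [b [ib sb]] := chinese_unit nis.
have [c ic] := sr_surj (r i) (T i - th i a).
exists (a + c * b) => j [<-|js].
  by rewrite thD thM ib mulr1 /th ic addrC subrK.
rewrite thD aT // thM (th_ker j b).2 ?mulr0 ?addr0 //; exact: sb.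
Qed.

Let common (s : seq index) : set RA := [set a | forall i, List.In i s -> sval i a].

Let common_submod s : submodule (common s).
Proof.
split=> [i _|x y x0 y0 i si|a x x0 i si] /=; have [[i0 iD iM] _ _] := primitive_ideal i.
- exact: i0.
- by apply: iD; [exact: x0 | exact: y0].
- by apply: iM; exact: x0.
Qed.

Let common_closed s : closed (common s).
Proof.
have -> : common s = \bigcap_(i in [set i | List.In i s]) (sval i : set RA) by [].
apply: closed_bigI => i _; have [si _ oi] := primitive_ideal i.
exact: (@open_submod_closed _ _ RA).
Qed.

Let common_cat s s' : common (s ++ s') `<=` common s /\ common (s ++ s') `<=` common s'.
Proof.
by split=> a sa i is_; apply: sa; apply: List.in_or_app; [left | right].
Qed.

Let common0 x : (forall s, common s x) -> x = 0.
Proof.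
move=> x0; apply: contrapT => /eqP /rsA [m mm mx]; apply: mx.
have pm : primitive (ideal_core m) by exists m.
apply: ideal_core_sub; apply: (x0 [:: exist _ _ pm] (exist _ _ pm)).
by left.
Qed.

(** The map to the product of the M_n(D) is injective as A is residually simple, and
    surjective by the Chinese remainder theorem and linear compactness.  Its inverse
    is continuous since, by Chevalley's theorem, every neighbourhood of 0 contains a
    finite intersection of kernels. *)
Theorem residually_simple_matrices :
  exists (I : Type) (n : I -> nat) (D : I -> falgType k),
    [/\ forall i, (0 < n i)%N, forall i, division_alg (D i)
      & topalg_iso A (matalg_product n D)].
Proof.
exists index, (fun i => sr_n (r i)), (fun i => sr_D (r i)); split.
- by move=> i; exact: sr_n0.
- by move=> i; exact: sr_div.
pose phi (a : A) : matalg_product (fun i => sr_n (r i)) (fun i => sr_D (r i)) :=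
  fun i => th i a.
have phiB0 a b i : th i a = th i b <-> sval i (a - b).
  rewrite -th_ker thB; split=> [->|/eqP]; first by rewrite subrr.
  by rewrite subr_eq0 => /eqP.
have phic : continuous phi.
  apply: prod_topology_continuous => i a N /nbhs_singleton Na.
  have [li _ oi] := primitive_ideal i.
  apply: filterS (@nbhs_submod _ _ RA a _ li oi) => b /phiB0 ab.
  by rewrite /preimage /= -[phi b i]/(th i b) ab.
have phiI : injective phi.
  move=> a b ab; apply/eqP; rewrite -subr_eq0; apply/eqP/common0 => s i _.
  by apply/phiB0; have := congr1 (fun z => z i) ab.
have phiS T : exists a, phi a = T.
  have [||a aC] := @pc_compact _ _ _ pcA (seq index)
    (fun s => [set a | forall i, List.In i s -> th i a = T i]).
  - move=> s; have [a aT] := chinese_remainder T s.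
    exists a, (common s); split; first exact: common_submod.
    move=> b; split=> [bT i is_|ab i is_] /=; first by apply/phiB0; rewrite bT // aT.
    by rewrite -aT //; apply/phiB0; exact: ab.
  - move=> s s'; exists (s ++ s').
    by split=> a aT i is_; apply: aT; apply: List.in_or_app; [left | right].
  exists a; apply/functional_extensionality_dep => i.
  have [li _ oi] := primitive_ideal i.
  have [b [bT ab]] := aC [:: i] _ (@nbhs_submod _ _ RA a _ li oi).
  rewrite -(bT i); last by left.
  by apply/esym/phiB0.
have [g gP] := choice phiS.
have gK : cancel phi g by move=> a; apply: phiI.
exists phi; first split.
- by move=> a b; apply/functional_extensionality_dep => i; exact: thD.
- by move=> a b; apply/functional_extensionality_dep => i; exact: thM.
- by apply/functional_extensionality_dep => i; exact: th1.
- by move=> c; apply/functional_extensionality_dep => i; have [_ _ _ h] := sr_hom (r i); exact: h.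
split=> //; exists g; split=> // T N Nx.
have /= N0 := (@nbhs_shift _ _ RA (g T) N).1 Nx.
have [||s sN] := @directed_closed_sub_nbhs _ _ RA pcA (seq index) common _ _
  common_submod common_closed _ common0 N0.
- by constructor; exact: [::].
- by move=> s s'; exists (s ++ s'); exact: common_cat.
have : nbhs T [set T' | forall i, List.In i s -> T' i = T i].
  elim: s {sN} => [|i s IH]; first by apply: filterS filterT => T' _ i [].
  have Ti : nbhs T [set T' : matalg_product (fun i => sr_n (r i)) (fun i => sr_D (r i)) | T' i = T i].
    have := @prod_topology_proj_continuous _ (fun i => matalg (sr_D (r i)) (sr_n (r i))) i T [set T i].
    by apply; apply: open_nbhs_nbhs; split=> //; exact: matalg_discrete.
  by apply: filterS (filterI Ti IH) => T' [T'i T's] j [<-|/T's].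
apply: filterS => T' T'T; rewrite /preimage /=.
have /sN /= : common s (g T' - g T).
  move=> i is_; apply/phiB0.
  by rewrite -[th i _]/(phi (g T') i) gP T'T // -{1}[T]gP.
by rewrite addrC subrK.
Qed.

End ToMatrices.

(** * Uniqueness of the decomposition *)

Lemma injective_surjective_bijective (S T : Type) (f : S -> T) :
  injective f -> (forall y, exists x, f x = y) -> bijective f.
Proof.
by move=> fI /choice [g gP]; exists g => // x; apply: fI.
Qed.

Section MatrixIsomorphism.
Variables (k : fieldType) (D E : falgType k).
Hypotheses (divD : division_alg D) (divE : division_alg E).

Lemma division_mulf_eq0 (x y : E) : x != 0 -> x * y = 0 -> y = 0.
Proof. by move=> x0 xy; rewrite -[y](mulKr (divE x0)) xy mulr0. Qed.

Variables (n m : nat) (f : 'M[D]_n -> 'M[E]_m) (g : 'M[E]_m -> 'M[D]_n).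
Hypotheses (fD : {morph f : X Y / X + Y}) (fM : {morph f : X Y / X *m Y})
  (fk : forall c : k, f (c%:A)%:M = (c%:A)%:M).
Hypotheses (fK : cancel f g) (gK : cancel g f).

Let f0 : f 0 = 0.
Proof. by apply: (addrI (f 0)); rewrite -fD !addr0. Qed.

Let e (i : 'I_n) : 'M[D]_n := delta_mx i i.

Let ee i : e i *m e i = e i.
Proof. exact: mul_delta_mx. Qed.

Let corner i (Y : 'M[D]_n) : e i *m Y *m e i = Y i i *: e i.
Proof. exact: delta_mul_delta. Qed.

Let eZ i d : e i *m (d *: e i) = d *: e i.
Proof.
apply/matrixP => r s; rewrite !mxE (bigD1 i) //= big1 => [|l /negPf li]; last first.
  by rewrite !mxE li andbF mul0r.
rewrite addr0 !mxE !eqxx andbT /=.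
by case: (r == i); rewrite ?mul1r // mul0r mulr0.
Qed.

(** As e_i M_n(D) e_i is a division ring, the idempotent f(e_i) has rank one. *)
Lemma rank_one_idempotent i : exists (u : 'cV[E]_m) (v : 'rV[E]_m),
  f (e i) = u *m v /\ v *m u = 1%:M.
Proof.
set p := f (e i).
have pp : p *m p = p by rewrite /p -fM ee.
have [a [b pab]] : exists a b, p a b != 0.
  apply: contrapT => np.
  have p0 : p = 0.
    apply/matrixP => a b; rewrite mxE; apply: contrapT => pab.
    by apply: np; exists a, b; apply/eqP.
  have := congr1 (fun X => g X i i) p0; rewrite /p fK -[in g 0]f0 fK !mxE !eqxx /=.
  by move/eqP; rewrite oner_eq0.
pose x := col b p *m row a p.
have pcol : p *m col b p = col b p by rewrite colE mulmxA pp.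
have prow : row a p *m p = row a p by rewrite -row_mul pp.
have xab : x a b != 0.
  rewrite !mxE big_ord1 !mxE; apply/eqP => /(division_mulf_eq0 pab)/eqP.
  by rewrite (negPf pab).
have gxE : g x = g x i i *: e i.
  rewrite -corner; apply: (can_inj fK); rewrite !fM gK.
  by rewrite -/p /x mulmxA pcol -mulmxA prow.
have gx0 : g x i i != 0.
  apply/eqP => gx0; move/eqP: xab; apply.
  by rewrite -[x]gK gxE gx0 scale0r f0 mxE.
pose y := (g x i i)^-1 *: e i.
have xy : x *m f y = p.
  rewrite -[x]gK gxE -fM /p; congr f.
  by rewrite -scalemxAl eZ scalerA mulrV ?divD // scale1r.
exists (col b p), (row a p *m f y); split; first by rewrite mulmxA.
set v := _ *m f y; set u := col b p.
have uvu : u *m (v *m u) = u by rewrite mulmxA /v /u [_ *m (_ *m f y)]mulmxA xy.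
rewrite [v *m u]mx11_scalar; congr (_%:M).
have := congr1 (fun X : 'cV[E]_m => X a 0) uvu; rewrite [v *m u]mx11_scalar.
rewrite mxE big_ord1 [_%:M 0 0]mxE eqxx mulr1n /u [col b p a 0]mxE => pz.
apply/eqP; rewrite -subr_eq0; apply/eqP; apply: (division_mulf_eq0 pab).
by rewrite mulrBr pz mulr1 subrr.
Qed.

Lemma rank_one_family : exists (u : 'I_n -> 'cV[E]_m) (v : 'I_n -> 'rV[E]_m),
  (forall i, f (e i) = u i *m v i) /\
  (forall i j, v i *m u j = (i == j)%:R%:M).
Proof.
have /choice [uv uvP] : forall i, exists uv : 'cV[E]_m * 'rV[E]_m,
    f (e i) = uv.1 *m uv.2 /\ uv.2 *m uv.1 = 1%:M.
  by move=> i; have [u [v]] := rank_one_idempotent i; exists (u, v).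
exists (fun i => (uv i).1), (fun i => (uv i).2); split=> [i|i j].
  by case: (uvP i).
case: eqVneq => [->|ij]; first by case: (uvP j).
have [ei vui] := uvP i; have [ej vuj] := uvP j.
have : f (e i) *m f (e j) = 0 by rewrite -fM /e mul_delta_mx_0.
rewrite ei ej => /(congr1 (fun X => (uv i).2 *m X *m (uv j).1)).
rewrite mulmx0 mul0mx !mulmxA vui mul1mx -!mulmxA vuj mulmx1 => ->.
by rewrite raddf0.
Qed.

(** The u_j and v_i form matrices with V U = 1, so that E^n embeds into E^m; compare
    dimensions over k. *)
Lemma matrix_iso_size_le : (n <= m)%N.
Proof.
have [u [v [_ vu]]] := rank_one_family.
pose U : 'M[E]_(m, n) := \matrix_(a, j) u j a 0.
pose V : 'M[E]_(n, m) := \matrix_(i, a) v i 0 a.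
have VU : V *m U = 1%:M.
  apply/matrixP => i j; have := congr1 (fun X : 'M[E]_1 => X 0 0) (vu i j).
  rewrite !mxE eqxx mulr1n => vuij.
  by rewrite -[RHS]vuij; apply: eq_bigr => a _; rewrite !mxE.
pose h (x : {ffun 'I_n -> E}) : {ffun 'I_m -> E} :=
  [ffun a => \sum_i x i * V i a].
have hl : linear h.
  move=> c x y; apply/ffunP => a; rewrite !ffunE scaler_sumr -big_split /=.
  by apply: eq_bigr => i _; rewrite !ffunE mulrDl scalerAl.
pose hL := GRing.isLinear.Build k _ _ _ h hl.
pose H : {linear {ffun 'I_n -> E} -> {ffun 'I_m -> E}} := HB.pack h hL.
have hI : lker (linfun H) == 0%VS.
  apply/lker0P => x y; rewrite !lfunE /= => hxy.
  pose r (z : {ffun 'I_n -> E}) : 'rV[E]_n := \row_i z i.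
  have hr z a : h z a = (r z *m V) 0 a.
    by rewrite ffunE mxE; apply: eq_bigr => i _; rewrite [r z _ _]mxE.
  have rxy : r x *m V = r y *m V.
    by apply/rowP => a; rewrite -!hr hxy.
  have : r x = r y by rewrite -[r x]mulmx1 -VU mulmxA rxy -mulmxA VU mulmx1.
  by move=> /rowP rr; apply/ffunP => i; have := rr i; rewrite !mxE.
have := limg_dim_eq (f := linfun H) (U := fullv).
rewrite (eqP hI) capv0 => /(_ erefl) dimH.
have := dimvS (subvf (linfun H @: fullv)); rewrite dimH !dimvf /dim /= !card_ord.
by rewrite leq_pmul2r // FalgType_proper.
Qed.

Variable i0 : 'I_n.

(** D is e M_n(D) e for a diagonal matrix unit e, and f(e) = u v with v u = 1
    identifies f(e) M_m(E) f(e) with E by X |-> v X u. *)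
Lemma matrix_iso_coefficients : exists h : {lrmorphism D -> E}, bijective h.
Proof.
have [u [v [euv vu]]] := rank_one_family.
pose U := u i0; pose V := v i0.
have VU : V *m U = 1%:M by rewrite vu eqxx.
have eUV : f (e i0) = U *m V by exact: euv.
pose io (d : D) : 'M[D]_n := d *: e i0.
have ioM d d' : io (d * d') = io d *m io d'.
  by rewrite /io -scalemxAl eZ scalerA.
have ioe d : io d = e i0 *m io d *m e i0.
  by rewrite corner !mxE !eqxx mulr1.
have io1 : io 1 = e i0 by rewrite /io scale1r.
pose h d : E := (V *m f (io d) *m U) 0 0.
have hE d : V *m f (io d) *m U = (h d)%:M by rewrite -mx11_scalar.
have fE d : f (io d) = U *m (h d)%:M *m V.
  by rewrite -hE {1}ioe !fM eUV !mulmxA.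
have sI (x y : E) : x%:M = y%:M :> 'M[E]_1 -> x = y.
  by move=> /matrixP/(_ 0 0); rewrite !mxE eqxx !mulr1n.
have ioer d : io d *m e i0 = io d by rewrite -scalemxAl ee.
have hD : {morph h : x y / x + y}.
  by move=> x y; rewrite /h /io scalerDl fD mulmxDr mulmxDl mxE.
have hM : {morph h : x y / x * y}.
  move=> x y; apply: sI; rewrite -hE ioM -{1}[io x]ioer !fM eUV.
  by rewrite scalar_mxM -!hE !mulmxA.
have hZ c : {morph h : x / c *: x}.
  move=> x; have ioZ : io (c *: x) = (c%:A)%:M *m io x.
    by rewrite mul_scalar_mx /io scalerA -scalerAl mul1r.
  have AZ (X : 'M[E]_m) : V *m (c%:A *: X) = c%:A *: (V *m X).
    apply/matrixP => r s; rewrite !mxE mulr_sumr; apply: eq_bigr => l _.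
    by rewrite mxE -!scalerAl !mul1r scalerAr.
  rewrite /h ioZ fM fk mul_scalar_mx AZ -scalemxAl mxE.
  by rewrite -scalerAl mul1r.
have hl : linear h by move=> c x y; rewrite hD hZ.
have h1 : h 1 = 1.
  apply: sI; rewrite -hE io1 eUV mulmxA VU mul1mx; exact: VU.
pose hL := GRing.isLinear.Build k D E *:%R h hl.
pose hR := GRing.isMonoidMorphism.Build D E h (conj h1 hM).
pose H : {lrmorphism D -> E} := HB.pack h hL hR.
exists H; apply: injective_surjective_bijective => [x y hxy|y].
  have : io x = io y by apply: (can_inj fK); rewrite !fE -[h x]/(H x) hxy.
  move=> /matrixP/(_ i0 i0); rewrite !mxE !eqxx !mulr1; exact.
pose Y := g (U *m y%:M *m V).
exists (Y i0 i0); apply: sI; rewrite -[H _]/(h _) -hE.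
have YE : Y = io (Y i0 i0).
  rewrite /io -corner; apply: (can_inj fK); rewrite !fM /Y gK eUV.
  by rewrite !mulmxA -(mulmxA _ V U) VU mulmx1 -!mulmxA (mulmxA V U) VU mul1mx.
by rewrite -YE /Y gK !mulmxA VU mul1mx -mulmxA VU mulmx1.
Qed.

End MatrixIsomorphism.

Section ProductUniqueness.
Variables (k : fieldType).

(** The x with c x = x form a two-sided ideal, which contains c. *)
Lemma matalg_central_idempotent (D : falgType k) n (c : matalg D n) :
  division_alg D -> (forall x, c * x = x * c) -> c * c = c -> c = 0 \/ c = 1.
Proof.
move=> divD cC cc; have [->|c0] := pselect (c = 0); [by left | right].
rewrite -[LHS]mulr1; apply: (@matalg_simple _ _ _ divD (fun x => c * x = x) c) => //.
- by rewrite mulr0.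
- by move=> x y cx cy; rewrite mulrDr cx cy.
- by move=> a x b cx; rewrite !mulrA cC -(mulrA a) cx.
- by apply/eqP.
Qed.

Section Components.
Variables (I : Type) (n : I -> nat) (D : I -> falgType k).
Local Notation P := (matalg_product n D).

(** The family supported at i; the factors have different types, hence the transport
    along i = j. *)
Definition component (i : I) (x : matalg (D i) (n i)) : P := fun j =>
  match pselect (i = j) with
  | left e => eq_rect i (fun j => matalg (D j) (n j)) x j e
  | right _ => 0
  end.

Lemma component_same i x : @component i x i = x.
Proof.
by rewrite /component; case: pselect => // e; rewrite (Prop_irrelevance e erefl).
Qed.

Lemma component_diff i j x : i <> j -> @component i x j = 0.
Proof. by rewrite /component; case: pselect. Qed.

Lemma componentE i (y : P) :
  (forall j, i <> j -> y j = 0) -> y = component (y i).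
Proof.
move=> y0; apply/functional_extensionality_dep => j.
have [<-|ij] := pselect (i = j); first by rewrite component_same.
by rewrite component_diff // y0.
Qed.

Lemma componentD i : {morph @component i : x y / x + y}.
Proof.
move=> x y; apply/esym.
rewrite [LHS](@componentE i) => [|j ij]; rewrite -[(_ + _ : P) _]/(component x _ + component y _).
  by rewrite !component_same.
by rewrite !component_diff // addr0.
Qed.

Lemma component_mull i (y : P) x : y * component x = component (y i * x).
Proof.
rewrite [LHS](@componentE i) => [|j ij]; rewrite -[(_ * _ : P) _]/(y _ * component x _).
  by rewrite component_same.
by rewrite component_diff // mulr0.
Qed.

Lemma component_mulr i (y : P) x : component x * y = component (x * y i).
Proof.
rewrite [LHS](@componentE i) => [|j ij]; rewrite -[(_ * _ : P) _]/(component x _ * y _).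
  by rewrite component_same.
by rewrite component_diff // mul0r.
Qed.

Lemma component_central i y : @component i 1 * y = y * @component i 1.
Proof. by rewrite component_mull component_mulr mul1r mulr1. Qed.

Lemma component_idem i : @component i 1 * @component i 1 = @component i 1.
Proof. by rewrite component_mull component_same mul1r. Qed.

Lemma component_inj i : injective (@component i).
Proof. by move=> x y xy; rewrite -(component_same x) xy component_same. Qed.

End Components.

Section Isomorphism.
Variables (I J : Type) (n : I -> nat) (m : J -> nat).
Variables (D : I -> falgType k) (E : J -> falgType k).
Local Notation P := (matalg_product n D).
Local Notation Q := (matalg_product m E).
Hypotheses (n0 : forall i, (0 < n i)%N) (m0 : forall j, (0 < m j)%N).
Hypotheses (divD : forall i, division_alg (D i)) (divE : forall j, division_alg (E j)).
Variables (F : P -> Q) (G : Q -> P).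
Hypotheses (Fh : alg_hom F) (FK : cancel F G) (GK : cancel G F).

Lemma matalg_one_neq0 i : (1 : matalg (D i) (n i)) <> 0.
Proof.
move=> /matrixP/(_ (Ordinal (n0 i)) (Ordinal (n0 i))).
by rewrite !mxE eqxx => /eqP; rewrite oner_eq0.
Qed.

Let F0 : F 0 = 0.
Proof. by case: Fh => FD _ _ _; apply: (addrI (F 0)); rewrite -FD !addr0. Qed.

(** Algebra isomorphisms preserve central idempotents. *)
Lemma component_image_01 i j : F (component (1 : matalg (D i) (n i))) j = 0 \/
  F (component (1 : matalg (D i) (n i))) j = 1.
Proof.
case: Fh => _ FM _ _; apply: matalg_central_idempotent => // [x|].
  have := component_central i (G (component x)) => /(congr1 F).
  rewrite !FM GK => /(congr1 (fun z => z j)).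
  by rewrite -[LHS]/(_ j * component x j) -[RHS]/(component x j * _ j) component_same.
by have := component_idem n D i => /(congr1 F); rewrite FM => /(congr1 (fun z => z j)).
Qed.

Lemma component_image_exists i :
  exists j, F (component (1 : matalg (D i) (n i))) j = 1.
Proof.
apply: contrapT => nj; apply: (@matalg_one_neq0 i).
apply: component_inj; apply: (can_inj FK).
apply/functional_extensionality_dep => j.
have -> : component (0 : matalg (D i) (n i)) = 0.
  by apply/esym; rewrite [LHS](@componentE _ _ _ i).
rewrite F0; have [//|Fj] := component_image_01 i j.
by case: nj; exists j.
Qed.

End Isomorphism.

Lemma alg_hom_inverse (A B : topAlgType k) (F : A -> B) (G : B -> A) :
  alg_hom F -> cancel F G -> cancel G F -> alg_hom G.
Proof.
move=> [FD FM F1 Fk] FK GK; have FI := can_inj FK.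
by split=> [x y|x y||c]; apply: FI; rewrite ?FD ?FM ?F1 ?Fk !GK.
Qed.

Section Uniqueness.
Variables (I J : Type) (n : I -> nat) (m : J -> nat).
Variables (D : I -> falgType k) (E : J -> falgType k).
Local Notation P := (matalg_product n D).
Local Notation Q := (matalg_product m E).
Hypotheses (n0 : forall i, (0 < n i)%N) (m0 : forall j, (0 < m j)%N).
Hypotheses (divD : forall i, division_alg (D i)) (divE : forall j, division_alg (E j)).
Variables (F : P -> Q) (G : Q -> P).
Hypotheses (Fh : alg_hom F) (FK : cancel F G) (GK : cancel G F).
Let Gh : alg_hom G := alg_hom_inverse Fh FK GK.

(** The unit of the factor i goes to the unit of a factor j: the preimage of the
    latter is a nonzero central idempotent supported at i. *)
Lemma unit_component_image i :
  exists j, F (component (1 : matalg (D i) (n i))) = component (1 : matalg (E j) (m j)).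
Proof.
have [j Fj] := component_image_exists n0 divE Fh FK GK i.
have [i' Gi'] := component_image_exists m0 divD Gh GK FK j.
exists j; apply: (can_inj GK); rewrite FK.
set d := component (1 : matalg (E j) (m j)).
have eG : component (1 : matalg (D i) (n i)) * G d = G d.
  apply: (can_inj FK); have [_ FM _ _] := Fh.
  by rewrite FM GK component_mull Fj mul1r.
have i'i : i' = i.
  apply: contrapT => ii'; apply: (@matalg_one_neq0 _ _ D n0 i').
  rewrite -Gi' -eG component_mulr component_diff //.
  by move=> ii; apply: ii'.
subst i'; rewrite -eG component_mulr.
by rewrite Gi' mulr1.
Qed.

Lemma factor_iso i j :
  F (component (1 : matalg (D i) (n i))) = component (1 : matalg (E j) (m j)) ->
  n i = m j /\ exists f : {lrmorphism D i -> E j}, bijective f.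
Proof.
move=> Fij.
have [FD FM _ Fk] := Fh; have [GD GM _ Gk] := Gh.
pose f (x : 'M[D i]_(n i)) : 'M[E j]_(m j) := F (component (x : matalg (D i) (n i))) j.
pose g (y : 'M[E j]_(m j)) : 'M[D i]_(n i) := G (component (y : matalg (E j) (m j))) i.
have FE (x : matalg (D i) (n i)) : F (component x) = component (F (component x) j).
  have {1}-> : component x = component (1 : matalg (D i) (n i)) * component x.
    by rewrite component_mull component_same mul1r.
  by rewrite FM Fij component_mulr mul1r.
have GE (y : matalg (E j) (m j)) : G (component y) = component (G (component y) i).
  have {1}-> : component y = component (1 : matalg (E j) (m j)) * component y.
    by rewrite component_mull component_same mul1r.
  by rewrite GM -Fij FK component_mulr mul1r.
have fK : cancel f g by move=> x; rewrite /g /f -FE FK component_same.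
have gK : cancel g f by move=> y; rewrite /g /f -GE GK component_same.
have fD : {morph f : x y / x + y} by move=> x y; rewrite /f componentD FD.
have fM : {morph f : x y / x *m y}.
  move=> x y; rewrite /f.
  have -> : component (x *m y : matalg (D i) (n i)) =
      component (x : matalg (D i) (n i)) * component (y : matalg (D i) (n i)).
    by rewrite component_mull component_same.
  by rewrite FM.
have fk (c : k) : f (c%:A)%:M = (c%:A)%:M.
  rewrite /f.
  have -> : component ((c%:A)%:M : matalg (D i) (n i)) =
      kmap c * component (1 : matalg (D i) (n i)).
    by rewrite component_mull mulr1.
  by rewrite FM Fk Fij component_mull mulr1 component_same.
have gD : {morph g : x y / x + y}.
  by move=> x y; apply: (can_inj fK); rewrite fD !gK.
have gM : {morph g : x y / x *m y}.
  by move=> x y; apply: (can_inj fK); rewrite fM !gK.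
split; last exact: (matrix_iso_coefficients (@divD i) (@divE j) fD fM fk fK gK (Ordinal (n0 i))).
apply/eqP; rewrite eqn_leq; apply/andP; split.
  exact: (matrix_iso_size_le (@divD i) (@divE j) fD fM fK gK).
exact: (matrix_iso_size_le (@divE j) (@divD i) gD gM gK fK).
Qed.

End Uniqueness.

(** The units of the factors are the minimal central idempotents of the product, so an
    isomorphism permutes them and restricts to the factors. *)
Theorem matalg_product_unique (I J : Type) (n : I -> nat) (m : J -> nat)
    (D : I -> falgType k) (E : J -> falgType k)
    (F : matalg_product n D -> matalg_product m E) G :
  (forall i, (0 < n i)%N) -> (forall j, (0 < m j)%N) ->
  (forall i, division_alg (D i)) -> (forall j, division_alg (E j)) ->
  alg_hom F -> cancel F G -> cancel G F ->
  exists2 s : I -> J, bijective s &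
    forall i, n i = m (s i) /\
      exists f : {lrmorphism D i -> E (s i)}, bijective f.
Proof.
move=> n0 m0 divD divE Fh FK GK.
have Gh := alg_hom_inverse Fh FK GK.
have [s sP] := choice (unit_component_image n0 m0 divD divE Fh FK GK).
have [t tP] := choice (unit_component_image m0 n0 divE divD Gh GK FK).
have unit_inj (K : Type) (l : K -> nat) (B : K -> falgType k) (a b : K) :
    (forall i, (0 < l i)%N) ->
    component (1 : matalg (B a) (l a)) = component (1 : matalg (B b) (l b)) -> a = b.
  move=> l0 ab; apply: contrapT => ab'; apply: (@matalg_one_neq0 _ _ B l0 b).
  by rewrite -(component_same (1 : matalg (B b) (l b))) -ab component_diff.
exists s; last by move=> i; exact: factor_iso (sP i).
exists t => [i|j].
  by apply: (@unit_inj _ n D) => //; rewrite -tP -sP FK.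
by apply: (@unit_inj _ m E) => //; rewrite -sP -tP GK.
Qed.

End ProductUniqueness.

Theorem proposition3p7 (k : fieldType) (A : topAlgType k)
    (hA : pseudocompact_alg A) :
  [<-> top_semisimple A;
       jacobson_radical A = [set 0%R]%classic;
       exists (I : Type) (S : I -> topModType A),
         (forall i, simple_mod (S i)) /\
         topmod_iso (regmod A) (prod_topology S);
       forall M : topModType A, pseudocompact_mod M -> projective M;
       forall M : topModType A, pseudocompact_mod M -> injective_mod M;
       inverse_limit_of_discrete_algs
         (fun B => findim_alg B /\ semisimple_alg B) A;
       exists (I : Type) (n : I -> nat) (D : I -> falgType k),
         [/\ forall i, (0 < n i)%N, forall i, division_alg (D i)
           & topalg_iso A (matalg_product n D)]]
  /\
  (forall (I J : Type) (n : I -> nat) (m : J -> nat)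
      (D : I -> falgType k) (E : J -> falgType k),
    (forall i, (0 < n i)%N) -> (forall i, division_alg (D i)) ->
    (forall j, (0 < m j)%N) -> (forall j, division_alg (E j)) ->
    topalg_iso A (matalg_product n D) -> topalg_iso A (matalg_product m E) ->
    exists2 s : I -> J, bijective s &
      forall i, n i = m (s i) /\
        exists f : {lrmorphism D i -> E (s i)}, bijective f).
Proof.
have pmA := regmod_pseudocompact hA.
have pcA := pseudocompact_pc pmA.
have J_rs := jacobson_residually_simple pcA.
have rs_open : residually_simple (regmod A) -> open_ideals_complemented A.
  by move=> rsA; apply/top_semisimple_open/residually_simple_top_semisimple.
have mat_rs : (exists (I : Type) (n : I -> nat) (D : I -> falgType k),
    [/\ forall i, (0 < n i)%N, forall i, division_alg (D i)
      & topalg_iso A (matalg_product n D)]) -> residually_simple (regmod A).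
  move=> [I [n [D [_ divD [phi phih phiH]]]]].
  exact: (matrices_residually_simple divD phih phiH).
split.
  tfae.
  - move=> ssA; apply/J_rs.
    exact: (complemented_residually_simple (top_semisimple_open ssA)).
  - move=> /J_rs/(residually_simple_matrices pcA) [I [n [D [_ divD [phi phih phiH]]]]].
    exact: (matrices_product_of_simples divD phih phiH).
  - move=> [I [S [simS isoS]]] M pM.
    apply: open_complemented_projective pM; apply: rs_open.
    exact: product_of_simples_residually_simple simS isoS.
  - move=> proj M pM; apply: open_complemented_injective pM => //; apply: rs_open.
    by apply: residually_simple_of_cyclic => // y W avW; exact: projective_cyclic.
  - move=> inj; apply: complemented_limit => //; apply: rs_open.
    by apply: residually_simple_of_cyclic => // y W avW; exact: injective_cyclic.
  - by move=> /semisimple_limit_residually_simple/(residually_simple_matrices pcA).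
  - by move=> /mat_rs/(residually_simple_top_semisimple pcA).
move=> I J n m D E n0 divD m0 divE [phi phih [_ [phi' [phiK phiK' _]]]].
move=> [psi psih [_ [psi' [psiK psiK' _]]]].
apply: (@matalg_product_unique _ _ _ _ _ _ _ (psi \o phi') (phi \o psi')) => //.
- have [FD FM F1 Fk] := alg_hom_inverse phih phiK phiK'.
  have [HD HM H1 Hk] := psih.
  by split=> [x y|x y||c] /=; rewrite ?FD ?FM ?F1 ?Fk ?HD ?HM ?H1 ?Hk.
- by move=> x; rewrite /= psiK phiK'.
- by move=> x; rewrite /= phiK psiK'.
Qed.
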